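(* Let $d \in \mathbb{N}$, $2 \leq q \leq p' \leq \infty$ and suppose $q$ is not an even integer. Then there exists a positive finite Borel measure $\mu$ on $\mathbb{R}^d$ such that if $u(t,\cdot) = H_t \ast \mu$ then $$Q_{p,q}(t) := t^{\frac{d}{2}\left(\frac{1}{q}-\frac{1}{p'}\right)} \left\| \widehat{u(t,\cdot)^{1/p}} \right\|_{q}$$ is strictly decreasing for sufficiently small $t>0$.
   Context: For $t>0$, $H_t$ denotes the heat kernel on $\mathbb{R}^d$ given by $H_t(x) = t^{-d/2} e^{-\pi |x|^2/t}$, and $(H_t\ast\mu)(x) = \int_{\mathbb{R}^d} H_t(x-y)\,d\mu(y)$. The Fourier transform of a finite Borel measure $\mu$ on $\mathbb{R}^d$ is $\widehat{\mu}(\xi) = \int_{\mathbb{R}^d} e^{-2\pi i x\cdot \xi}\,d\mu(x)$, with the same normalisation for functions. For $p\in[1,\infty]$, $p'$ denotes the dual exponent satisfying $\frac1p+\frac1{p'}=1$. $\|\cdot\|_q$ is the $L^q(\mathbb{R}^d)$ norm, and $u(t,\cdot)^{1/p}$ is the pointwise power of the nonnegative function $u(t,\cdot)$.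
   Formalization: The exponent q is taken to be finite: for q = p' = ∞ (so p = 1) the quantity Q_{p,q}(t) equals the constant μ(ℝ^d) for every μ, so the claim fails there; d is at least 1. *)

(* Defs.v *)
From HB Require Import structures.
From mathcomp Require Import all_boot all_order all_algebra.
From mathcomp Require Import all_classical all_reals all_analysis.
From mathcomp Require Import complex.

Set Implicit Arguments.
Unset Strict Implicit.
Unset Printing Implicit Defensive.

Import Order.TTheory GRing.Theory Num.Theory.
Import numFieldNormedType.Exports.

Local Open Scope classical_set_scope.
Local Open Scope ring_scope.

(* R^d is d.-tuple R, on which the library puts the product sigma-algebra; it
   is the Borel sigma-algebra of R^d. *)

Section lebesgue_tuple.
Context {R : realType}.

Definition consp (d : nat) (z : d.-tuple R * R) : d.+1.-tuple R :=
  [tuple of z.2 :: z.1].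

Lemma measurable_consp d : measurable_fun [set: d.-tuple R * R] (@consp d).
Proof. exact: measurable_cons. Qed.

Definition lebesgue_tupleS d
    (m : {sigma_finite_measure set (d.-tuple R) -> \bar R}) :
    set (d.+1.-tuple R) -> \bar R :=
  pushforward (m \x lebesgue_measure)%E (@consp d).

Section lebesgue_tupleS_measure.
Variables (d : nat) (m : {sigma_finite_measure set (d.-tuple R) -> \bar R}).

HB.instance Definition _ := Measure.copy (lebesgue_tupleS m)
  (measure_function_pushforward__canonical__measure_function_Measure
    (m \x lebesgue_measure)%E (@measurable_consp d)).

Let lebesgue_tupleS_sigma_finite : sigma_finite setT (lebesgue_tupleS m).
Proof.
have /sigma_finiteP[F [TF ndF Foo]] := sigma_finiteT m.
have /sigma_finiteP[G [TG ndG Goo]] := sigma_finiteT (@lebesgue_measure R).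
pose B n : set (d.+1.-tuple R) := (fun v => tnth v ord0) @^-1` G n `&`
    (fun v : d.+1.-tuple R => [tuple of behead v]) @^-1` F n.
have consBE n : @consp d @^-1` B n = F n `*` G n.
  have beheadK v x : [tuple of behead (@consp d (v, x))] = v by exact: val_inj.
  by apply/seteqP; split=> -[v x]; rewrite /B /preimage/= beheadK => -[].
exists B.
  rewrite predeqE => v; split=> // _.
  set w : d.-tuple R := [tuple of behead v].
  have [n _ Fn] : (\bigcup_n F n) w by rewrite -TF.
  have [k _ Gk] : (\bigcup_k G k) (tnth v ord0) by rewrite -TG.
  exists (maxn n k) => //; split.
    by have /subsetPset := ndG _ _ (leq_maxr n k); apply.
  by have /subsetPset := ndF _ _ (leq_maxl n k); apply.
move=> n; have [mF Fn] := Foo n; have [mG Gn] := Goo n; split.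
  apply: measurableI; rewrite -[X in measurable X]setTI.
    exact: measurable_tnth.
  exact: measurable_behead.
rewrite /lebesgue_tupleS /pushforward consBE product_measure1E//.
by rewrite lte_mul_pinfty// ge0_fin_numE.
Qed.

HB.instance Definition _ := Measure_isSigmaFinite.Build _ _ _
  (lebesgue_tupleS m) lebesgue_tupleS_sigma_finite.

End lebesgue_tupleS_measure.

Fixpoint lebesgue_tuple (d : nat) :
    {sigma_finite_measure set (d.-tuple R) -> \bar R} :=
  match d with
  | 0 => \d_[tuple]
  | d'.+1 => lebesgue_tupleS (lebesgue_tuple d')
  end.

Lemma lebesgue_tuple_box d (A : 'I_d -> set R) :
  (forall i, measurable (A i)) ->
  lebesgue_tuple d [set v | forall i, A i (tnth v i)] =
  (\prod_(i < d) lebesgue_measure (A i))%E.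
Proof.
elim: d A => [|d IH] A mA.
  by rewrite big_ord0 /= diracE mem_set// => -[].
have mbox : measurable [set v : d.-tuple R | forall i, A (lift ord0 i) (tnth v i)].
  rewrite [X in measurable X](_ : _ =
      \bigcap_(i in [set: 'I_d]) ((fun v : d.-tuple R => tnth v i) @^-1` A (lift ord0 i))).
    apply: fin_bigcap_measurable => // i _.
    by rewrite -[X in measurable X]setTI; exact: measurable_tnth.
  by apply/seteqP; split => [v H i _|v H i]; exact: H.
rewrite big_ord_recl/= /lebesgue_tupleS /pushforward.
rewrite (_ : _ @^-1` _ =
    [set v : d.-tuple R | forall i, A (lift ord0 i) (tnth v i)] `*` A ord0).
  rewrite product_measure1E//; last exact: mA.
  by rewrite [X in (X * _)%E](IH (fun i => A (lift ord0 i)))// muleC.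
apply/seteqP; split => -[v x]/=.
  move=> H; split; last by have := H ord0; rewrite tnth0.
  by move=> i; have := H (lift ord0 i); rewrite tnthS.
move=> [H Ax] i; case: (unliftP ord0 i) => [j ->|->]; first by rewrite tnthS.
by rewrite tnth0.
Qed.

End lebesgue_tuple.

Section euclidean.
Context {R : realType} {d : nat}.
Implicit Types x y : d.-tuple R.

Definition dotp x y : R := \sum_(i < d) tnth x i * tnth y i.

Definition subt x y : d.-tuple R := [tuple tnth x i - tnth y i | i < d].

End euclidean.

Section heat.
Context {R : realType} {d : nat}.

Definition heat_kernel (t : R) (x : d.-tuple R) : R :=
  t `^ (- (d%:R / 2)) * expR (- (pi * dotp x x / t)).

Definition heat_flow (mu : {finite_measure set (d.-tuple R) -> \bar R})
    (t : R) (x : d.-tuple R) : R :=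
  (\int[mu]_y heat_kernel t (subt x y))%R.

End heat.

Section fourier.
Context {R : realType} {d : nat}.
Implicit Types (f : d.-tuple R -> R) (g : d.-tuple R -> R[i]).

Local Notation leb := (@lebesgue_tuple R d).

Definition expi (theta : R) : R[i] := (cos theta +i* sin theta)%C.

Definition cintegral g : R[i] :=
  ((\int[leb]_x complex.Re (g x))%R +i* (\int[leb]_x complex.Im (g x))%R)%C.

Definition cLnorm (q : \bar R) g : \bar R :=
  Lnorm leb q (fun xi => (Normc.normc (g xi))%:E).

Definition fourier_L1 f (xi : d.-tuple R) : R[i] :=
  cintegral (fun x => expi (- (2 * pi * dotp x xi)) * ((f x)%:C)%C).

Definition truncate f (n : nat) (x : d.-tuple R) : R :=
  if dotp x x <= n%:R ^+ 2 then f x else 0.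

Definition is_fourier_Lp (p : \bar R) f g : Prop :=
  [/\ measurable_fun setT (fun xi => complex.Re (g xi)),
      measurable_fun setT (fun xi => complex.Im (g xi)) &
      cLnorm (hoelder_conjugate p)
        (fun xi => g xi - fourier_L1 (truncate f n) xi) @[n --> \oo] --> 0%E].

(* The Fourier transform on L^p(R^d), 1 <= p <= 2: the defining integral when f
   is integrable; otherwise the limit in L^p' of the transforms of the
   truncations of f to balls, which exists and is unique almost everywhere by
   the Hausdorff-Young inequality (an arbitrary representative is chosen). *)
Definition fourier (p : \bar R) f : d.-tuple R -> R[i] :=
  if `[< leb.-integrable setT (EFin \o f) >] then fourier_L1 f
  else xget (fun=> 0) [set g | is_fourier_Lp p f g].

End fourier.

(* [fine p^-1] is 1/p, with 1/oo = 0. *)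
Definition Q {R : realType} {d : nat} (p : \bar R) (q : R)
    (mu : {finite_measure set (d.-tuple R) -> \bar R}) (t : R) : \bar R :=
  let power := t `^ (d%:R / 2 * (q^-1 - fine (hoelder_conjugate p)^-1%E)) in
  let u_root x := heat_flow mu t x `^ fine p^-1%E in
  (power%:E * cLnorm q%:E (fourier p u_root))%E.

(* Main.v *)
(* Put r = 1/p, lambda = t^(-1/2), and let mu be the sum of four Dirac masses at
   (+-x1, 0, ..., 0) and (+-x2, 0, ..., 0), with x1 = (m' + m)/2 and x2 = (m' - m)/2.
   By dilation, Q(t)^q is a positive constant times the integral of |C phi|^q, where
   phi x = (sum_k exp(- pi (x - lambda x_k)^2))^r and C is the cosine transform.  For
   large lambda the four bumps barely interact, and C phi is, up to an error e,
     z xi = r^(-1/2) exp(- pi xi^2 / r) * 2 cos(pi m lambda xi) * 2 cos(pi m' lambda xi).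
   The integral of |z|^q is a Gaussian mean of W (lambda xi), with W 1-periodic; as
   lambda grows it equals its limit plus a positive multiple of
   a_1(W) exp(- c0 lambda^2), up to lower order, with c0 = pi r / q, so that it
   increases as soon as the first Fourier coefficient a_1(W) is negative.
   Let B_j be the Fourier coefficients of V x = |2 cos (pi x)|^q.  Integration by parts
   gives (q + 2j + 2) B_(j+1) = (q - 2j) B_j, so that, q not being an even integer,
   some B_K is negative while B_1 > 0.  With m' = K m + 1 and m large, a_1(W) is close
   to B_K B_1 < 0.
   The error e and its lambda-Lipschitz constant are O(exp(- c1 lambda^2)) in L^2 with
   c1 = pi r m^2 / 8, which beats c0 once m is large enough; since q > 2, the
   second-order difference bound of [norm_powR_diff2] makes them negligible. *)

Require Import Defs.
From HB Require Import structures.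
From mathcomp Require Import all_boot all_order all_algebra.
From mathcomp Require Import all_classical all_reals all_analysis.
From mathcomp Require Import measurable_realfun lebesgue_integral_under complex ring lra zify.
Set Implicit Arguments.
Unset Strict Implicit.
Unset Printing Implicit Defensive.
Import Order.TTheory GRing.Theory Num.Theory.
Import numFieldNormedType.Exports.
Local Open Scope classical_set_scope.
Local Open Scope ring_scope.

(** The Gaussian mean of cos(2 pi k lambda xi) is a multiple of exp(- c0 k^2 lambda^2), so the
    lowest frequency of the periodic factor decides the monotonicity, and its coefficient has to be
    negative. One symmetric pair of masses would give a dilate of V, whose first coefficient B_1 is
    positive; a negative one occurs only at some K > 1. The second pair makes the frequencies K m
    and K m + 1 beat against each other, which brings B_K B_1 down to frequency 1. The nodes are
    made for this: x1 + x2 = m' and x1 - x2 = m turn the sum of four cosines into a product. Strict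
    monotonicity compares values of lambda that are arbitrarily close. The gain is then proportional
    to their distance, so the error must be too, and a bound on e alone would not do: hence the
    estimates on differences of e and of |z + e|^q - |z|^q. No Fourier series is summed: V is
    approximated uniformly by cosine polynomials, with bounds that do not depend on their degree.
    From 2 < q <= p' follows p <= 2, that is r >= 1/2, which makes the interaction of the bumps
    controllable by their pairwise products. *)

Section derivatives.
Context {R : realType}.
Implicit Types (f g : R -> R) (x a b : R).

Lemma is_derive_fun_cst a x : is_derive x (1:R) (fun=> a) 0.
Proof. exact: is_derive_cst. Qed.

Lemma is_derive_fun_id x : is_derive x (1:R) (fun y : R => y) 1.
Proof. exact: is_derive_id. Qed.

Lemma is_derive_funD f g x a b : is_derive x (1:R) f a -> is_derive x (1:R) g b ->
  is_derive x (1:R) (fun y => f y + g y) (a + b).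
Proof. exact: is_deriveD. Qed.

Lemma is_derive_funB f g x a b : is_derive x (1:R) f a -> is_derive x (1:R) g b ->
  is_derive x (1:R) (fun y => f y - g y) (a - b).
Proof. exact: is_deriveB. Qed.

Lemma is_derive_funN f x a : is_derive x (1:R) f a ->
  is_derive x (1:R) (fun y => - f y) (- a).
Proof. exact: is_deriveN. Qed.

Lemma is_derive_funM f g x a b : is_derive x (1:R) f a -> is_derive x (1:R) g b ->
  is_derive x (1:R) (fun y => f y * g y) (a * g x + f x * b).
Proof.
move=> fa gb; rewrite addrC (mulrC a).
exact: is_deriveM fa gb.
Qed.

Lemma is_derive_val f x a b : is_derive x (1:R) f a -> a = b ->
  is_derive x (1:R) f b.
Proof. by move=> ? <-. Qed.

Lemma is_derive_funX f x a n : is_derive x (1:R) f a ->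
  is_derive x (1:R) (fun y => f y ^+ n.+1) (n.+1%:R * f x ^+ n * a).
Proof.
move=> fa; elim: n => [|n IH].
  by rewrite mul1r expr0 mul1r; under eq_fun do rewrite expr1.
under eq_fun do rewrite exprS.
apply: is_derive_val (is_derive_funM fa IH) _.
by rewrite exprS -[in RHS]natr1; ring.
Qed.

Lemma is_derive_fun_comp f g x a b : is_derive (g x) (1:R) f a ->
  is_derive x (1:R) g b -> is_derive x (1:R) (fun y => f (g y)) (a * b).
Proof. exact: is_derive1_comp. Qed.

Lemma is_derive_fun_cos g x b : is_derive x (1:R) g b ->
  is_derive x (1:R) (fun y => cos (g y)) (- sin (g x) * b).
Proof. exact: is_derive_fun_comp (is_derive_cos _). Qed.

Lemma is_derive_fun_sin g x b : is_derive x (1:R) g b ->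
  is_derive x (1:R) (fun y => sin (g y)) (cos (g x) * b).
Proof. exact: is_derive_fun_comp (is_derive_sin _). Qed.

Lemma is_derive_fun_expR g x b : is_derive x (1:R) g b ->
  is_derive x (1:R) (fun y => expR (g y)) (expR (g x) * b).
Proof. exact: is_derive_fun_comp (is_derive_expR _). Qed.

Lemma is_derive_fun_powR g x b s : 0 < g x -> is_derive x (1:R) g b ->
  is_derive x (1:R) (fun y => g y `^ s) (s * g x `^ (s - 1) * b).
Proof. move=> gx0 gb. have H := is_derive1_powR s gx0. exact: (@is_derive_fun_comp (fun z => z `^ s) g _ _ _ H gb). Qed.

Lemma is_derive_continuous f a x : is_derive x (1:R) f a -> {for x, continuous f}.
Proof. by move=> [fx _]; exact/differentiable_continuous/derivable1_diffP. Qed.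

Lemma MVT_is_derive f df u v : u <= v ->
  (forall x, is_derive x (1:R) f (df x)) ->
  exists2 c, u <= c <= v & f v - f u = df c * (v - u).
Proof.
move=> uv fdf.
have cf : {within `[u, v], continuous f}.
  by apply: continuous_subspaceT => x; exact: is_derive_continuous (fdf x).
have [c cuv ->] := @MVT_segment R f df u v uv (fun x _ => fdf x) cf.
by exists c => //; move: cuv; rewrite in_itv.
Qed.

End derivatives.

(** The rules compute the derivative of an explicit expression, and [derive_by] leaves its equality
    with the claimed value as the remaining goal. [eassumption] comes first so that derivatives
    found in the context act as further rules. *)
Ltac derive_rule :=
  first [ eassumption
        | notypeclasses refine (is_derive_fun_cst _ _)
        | notypeclasses refine (is_derive_fun_id _)
        | notypeclasses refine (is_derive_funD _ _)
        | notypeclasses refine (is_derive_funB _ _)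
        | notypeclasses refine (is_derive_funN _)
        | notypeclasses refine (is_derive_funX _ _)
        | notypeclasses refine (is_derive_funM _ _)
        | notypeclasses refine (is_derive_fun_cos _)
        | notypeclasses refine (is_derive_fun_sin _)
        | notypeclasses refine (is_derive_fun_expR _) ].
Ltac derive_by :=
  notypeclasses refine (is_derive_val _ _); [repeat derive_rule|rewrite /=].

(** * Affine changes of variables in Lebesgue integrals *)

Section affine.
Context {R : realType}.
Notation mu := (@lebesgue_measure R).

Lemma measurable_affine (a b : R) : measurable_fun setT (fun x => a * x + b).
Proof. by apply: measurable_funD => //; exact: measurable_funM. Qed.

(** Both sides are measures in [A], so by uniqueness of Lebesgue measure it is enough to compare
    them on half-open intervals. For negative [a] the preimage is open at the other end, which does
    not change its length. *)
Lemma lebesgue_measure_affine (a b : R) A : a != 0 -> measurable A ->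
  ((`|a|%R)%:E * mu ((fun x => a * x + b)%R @^-1` A))%E = mu A.
Proof.
move=> a0 mA; pose m : {measure set (measurableTypeR R) -> \bar R} := measure_function_pushforward__canonical__measure_function_Measure mu (measurable_affine a b : @measurable_fun _ _ (measurableTypeR R) (measurableTypeR R) _ _).
have k0 : 0 <= `|a| by [].
rewrite -[RHS](_ : mscale (NngNum k0) m A = _)//.
symmetry; apply: (@lebesgue_measure_unique R (mscale (NngNum k0) m)) => // X [[u v] /= _ <-].
rewrite /mscale/= /pushforward.
have [uv|vu] := ltP u v; last by rewrite set_itv_ge ?bnd_simp -?leNgt// preimage_set0 !measure0 mule0.
rewrite lebesgue_measure_itv/= lte_fin uv.
have [a_gt0|] := ltP 0 a; last rewrite le_eqVlt (negbTE a0)/= => a_lt0.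
  rewrite (_ : _ @^-1` _ = `](u - b) / a, (v - b) / a]%classic); last first.
    apply/seteqP; split => x/=; rewrite !in_itv/= ltr_pdivrMr// ler_pdivlMr// ltrBlDr lerBrDr (mulrC x)//.
  rewrite lebesgue_measure_itv/= lte_fin ltr_pM2r ?invr_gt0// ltrD2r uv gtr0_norm//.
  by rewrite -EFinB -EFinM -mulrBl; congr EFin; field.
rewrite (_ : _ @^-1` _ = `[(v - b) / a, (u - b) / a[%classic); last first.
  apply/seteqP; split => x/=; rewrite !in_itv/= ltr_ndivlMr// ler_ndivrMr// ltrBlDr lerBrDr (mulrC x) andbC//.
rewrite lebesgue_measure_itv/= lte_fin ltr_nM2r ?invr_lt0// ltrD2r uv ltr0_norm//.
by rewrite -EFinB -EFinM -mulrBl; congr EFin; field.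
Qed.

Lemma ge0_integral_affine (a b : R) (f : R -> \bar R) : a != 0 ->
  measurable_fun setT f -> (forall x, 0 <= f x)%E ->
  (\int[mu]_x f x = (`|a|%R)%:E * \int[mu]_x f (a * x + b)%R)%E.
Proof.
move=> a0 mf f0.
pose m : {measure set (measurableTypeR R) -> \bar R} := measure_function_pushforward__canonical__measure_function_Measure mu (measurable_affine a b : @measurable_fun _ _ (measurableTypeR R) (measurableTypeR R) _ _).
have k0 : 0 <= `|a| by [].
transitivity (\int[mscale (NngNum k0) m]_x f x)%E.
  apply: eq_measure_integral => A mA _.
  exact/esym/lebesgue_measure_affine.
rewrite ge0_integral_mscale//; congr (_ * _)%E.
rewrite ge0_integral_pushforward ?preimage_setT//.
exact: measurable_affine.
Qed.

Lemma integrable_affine (a b : R) (f : R -> R) : a != 0 ->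
  mu.-integrable setT (EFin \o f) ->
  mu.-integrable setT (EFin \o (fun x => f (a * x + b))).
Proof.
move=> a0 /integrableP[mf fi]; apply/integrableP; split.
  by apply: (measurableT_comp mf); exact: measurable_affine.
move: fi; rewrite (@ge0_integral_affine a b)//; last exact: measurableT_comp.
rewrite muleC -lte_pdivlMr ?normr_gt0// => h; apply: (lt_le_trans h).
by rewrite leey.
Qed.

Lemma Rintegral_affine (a b : R) (f : R -> R) : a != 0 ->
  mu.-integrable setT (EFin \o f) ->
  \int[mu]_x f x = `|a| * \int[mu]_x f (a * x + b).
Proof.
move=> a0 fi; have /integrableP[mf _] := fi.
have fi' := integrable_affine b a0 fi.
have {}fi' : mu.-integrable setT ((EFin \o f) \o (fun x => a * x + b)) by exact: fi'.
have := integrable_funeneg measurableT fi'.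
have := integrable_funepos measurableT fi'.
rewrite funepos_comp funeneg_comp => /(integrable_fin_num measurableT) hp /(integrable_fin_num measurableT) hn.
rewrite /Rintegral [in LHS]integralE.
rewrite (@ge0_integral_affine a b (fun x => (EFin \o f)^\+ x)%E)//; last exact: measurable_funepos.
rewrite (@ge0_integral_affine a b (fun x => (EFin \o f)^\- x)%E)//; last exact: measurable_funeneg.
rewrite -muleBr//; last exact: fin_num_adde_defr.
rewrite fineM//; last by rewrite fin_numB hp hn.
congr (_ * fine _); symmetry.
transitivity (\int[mu]_x ((EFin \o f) \o (fun x => (a * x + b)%R)) x)%E => //.
by rewrite integralE funepos_comp funeneg_comp.
Qed.

End affine.

(** * Integrability of real-valued functions *)

Section integrable_real.
Context d (T : measurableType d) (R : realType) (m : {measure set T -> \bar R}).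
Implicit Types f g : T -> R.

Lemma integrable_EFin_measurable f :
  m.-integrable setT (EFin \o f) -> measurable_fun setT f.
Proof. by move=> /integrableP[/measurable_EFinP]. Qed.

Lemma integrable_dominated f g : measurable_fun setT f ->
  (forall x, `|f x| <= g x) ->
  m.-integrable setT (EFin \o g) -> m.-integrable setT (EFin \o f).
Proof.
move=> mf fg; apply: le_integrable => //; first exact/measurable_EFinP.
by move=> x _ /=; rewrite lee_fin (le_trans (fg x)) ?ler_norm.
Qed.

Lemma integrable_EFinD f g : m.-integrable setT (EFin \o f) ->
  m.-integrable setT (EFin \o g) ->
  m.-integrable setT (EFin \o (fun x => f x + g x)).
Proof. move=> fi gi; by apply: eq_integrable (integrableD measurableT fi gi). Qed.

Lemma integrable_EFinB f g : m.-integrable setT (EFin \o f) ->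
  m.-integrable setT (EFin \o g) ->
  m.-integrable setT (EFin \o (fun x => f x - g x)).
Proof. move=> fi gi; by apply: eq_integrable (integrableB measurableT fi gi). Qed.

Lemma integrable_EFinZl k f : m.-integrable setT (EFin \o f) ->
  m.-integrable setT (EFin \o (fun x => k * f x)).
Proof. move=> fi; by apply: eq_integrable (integrableZl measurableT k fi). Qed.

Lemma integrable_EFin_sum n (F : 'I_n -> T -> R) :
  (forall k, m.-integrable setT (EFin \o F k)) ->
  m.-integrable setT (EFin \o (fun x => \sum_(k < n) F k x)).
Proof.
elim: n F => [|n IH] F iF.
  rewrite (_ : _ \o _ = cst 0%E); first exact: integrable0.
  by apply/funext => x /=; rewrite big_ord0.
under [X in EFin \o X]eq_fun do rewrite big_ord_recl.
by apply: integrable_EFinD; [exact: iF|apply: IH => k; exact: iF].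
Qed.

Lemma Rintegral_sum n (F : 'I_n -> T -> R) :
  (forall k, m.-integrable setT (EFin \o F k)) ->
  \int[m]_x (\sum_(k < n) F k x) = \sum_(k < n) \int[m]_x F k x.
Proof.
elim: n F => [|n IH] F iF.
  rewrite big_ord0; under eq_Rintegral do rewrite big_ord0.
  by rewrite /Rintegral integral0.
under eq_Rintegral do rewrite big_ord_recl.
rewrite RintegralD//; last exact: integrable_EFin_sum.
by rewrite big_ord_recl IH.
Qed.

Lemma integrable_EFin_bounded f g (B : R) : measurable_fun setT g ->
  (forall x, `|g x| <= B) -> m.-integrable setT (EFin \o f) ->
  m.-integrable setT (EFin \o (fun x => f x * g x)).
Proof.
move=> mg gB fi; apply: (@integrable_dominated _ (fun x => B * `|f x|)).
- by apply: measurable_funM => //; exact: integrable_EFin_measurable.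
- by move=> x; rewrite normrM mulrC ler_wpM2r.
- by apply: integrable_EFinZl; exact: (integrable_norm fi).
Qed.

End integrable_real.

(** * Gaussian integrals *)

Section gaussian.
Context {R : realType}.
Notation mu := (@lebesgue_measure R).

(** By translation invariance the integral of [K (x + h)] does not depend on [h]; differentiate it
    under the integral sign at [h = 0]. This is integration by parts on the whole line without
    limits at infinity. *)
Lemma integral_derive_eq0 (K dK G : R -> R) :
  (forall x : R, is_derive x (1:R) K (dK x)) ->
  mu.-integrable setT (EFin \o K) -> mu.-integrable setT (EFin \o G) ->
  (forall x h, `|h| < 1 -> `|dK (x + h)| <= G x) ->
  \int[mu]_x dK x = 0.
Proof.
move=> dKE Ki Gi KG.
pose f (h x : R) := K (x + h).
have fi h : mu.-integrable setT (EFin \o f h).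
  have := integrable_affine h (oner_neq0 R) Ki.
  by apply: eq_integrable => // x _ /=; rewrite mul1r.
have fd x h : is_derive h (1:R) (f ^~ x) (dK (x + h)).
  have H : is_derive h (1:R) (fun h => x + h) 1.
    by derive_by; ring.
  have := @is_derive1_comp _ K (fun h => x + h) h _ _ (dKE _) H.
  by rewrite mulr1.
have dfE h x : partial1of2 f h x = dK (x + h).
  by rewrite partial1of2E; exact: (@derive_val _ _ _ _ _ _ _ (fd x h)).
have I0 : `](-1), 1[%classic (0:R) by rewrite /= in_itv/= oppr_lt0 ltr01.
have := @differentiation_under_integral _ _ _ mu f setT measurableT 0 (-1) 1 I0
  (fun h _ => fi h) (fun h x _ _ => @ex_derive _ _ _ _ _ _ _ (fd x h)) G _ Gi.
have -> : (fun h => \int[mu]_y f h y) = cst (\int[mu]_x K x).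
  apply/funext => h; rewrite /f [in RHS](@Rintegral_affine _ 1 h)// ?oner_neq0// normr1 mul1r.
  by apply: eq_Rintegral => x _; rewrite mul1r.
rewrite derive1_cst => H; rewrite [RHS]H => [|y|h x /=] //.
- by apply: eq_Rintegral => x _; rewrite dfE addr0.
- by apply: le_trans (KG y 0 _); rewrite ?normr0.
- by rewrite in_itv/= => hI _; rewrite dfE KG// ltr_norml.
Qed.

Definition gauss (a x : R) := expR (- (a * x ^+ 2)).

Lemma gauss_gt0 a x : 0 < gauss a x. Proof. exact: expR_gt0. Qed.

Lemma gauss_ge0 a x : 0 <= gauss a x. Proof. exact: expR_ge0. Qed.

Lemma gauss_le1 a x : 0 <= a -> gauss a x <= 1.
Proof. by move=> a0; rewrite -expR0 ler_expR lerNl oppr0 mulr_ge0// sqr_ge0. Qed.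

Lemma gaussN a x : gauss a (- x) = gauss a x.
Proof. by rewrite /gauss sqrrN. Qed.

Lemma gaussM a x y : gauss a (x * y) = gauss (a * x ^+ 2) y.
Proof. by rewrite /gauss exprMn mulrA. Qed.

Lemma gauss_powR a s x : gauss a x `^ s = gauss (s * a) x.
Proof. by rewrite /gauss -expRM; congr expR; ring. Qed.

Lemma is_derive_gauss a x : is_derive (x:R) (1:R) (gauss a) (- (2 * a * x) * gauss a x).
Proof.
rewrite /gauss.
have H : is_derive x (1:R) (fun x : R => - (a * x ^+ 2)) (- (2 * a * x)).
  by derive_by; ring.
have := @is_derive1_comp _ expR _ x _ _ (is_derive_expR _) H.
by rewrite mulrC.
Qed.

Lemma measurable_gauss a : measurable_fun setT (gauss a).
Proof.
apply: measurableT_comp => //; apply: measurable_funN; exact: measurable_funM.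
Qed.

Lemma integrable_gauss a : 0 < a -> mu.-integrable setT (EFin \o gauss a).
Proof.
move=> a0; have s0 : Num.sqrt a != 0 by rewrite gt_eqF// sqrtr_gt0.
have := integrable_affine 0 s0 (@integrableT_gauss R).
apply: eq_integrable => // x _ /=.
by rewrite /gauss_fun /gauss addr0 exprMn sqr_sqrtr// ltW.
Qed.

Lemma Rintegral_gauss a : 0 < a -> \int[mu]_x gauss a x = Num.sqrt (pi / a).
Proof.
move=> a0; have s0 : Num.sqrt a != 0 by rewrite gt_eqF// sqrtr_gt0.
have := Rintegral_affine 0 s0 (@integrableT_gauss R).
rewrite /Rintegral integralT_gauss/= ger0_norm ?sqrtr_ge0// => H.
rewrite sqrtrM ?pi_ge0// sqrtrV ?ltW// H mulrC mulrA mulVf// mul1r.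
congr fine; apply: eq_integral => x _.
by rewrite /gauss_fun /gauss addr0 exprMn sqr_sqrtr// ltW.
Qed.

(** Half of the exponent absorbs the factor [x ^+ 2], through y <= exp y. *)
Lemma sqr_gauss_le a x : 0 < a -> x ^+ 2 * gauss a x <= 2 / a * gauss (a / 2) x.
Proof.
move=> a0.
have -> : gauss a x = gauss (a / 2) x * gauss (a / 2) x.
  by rewrite /gauss -expRD; congr expR; field.
rewrite mulrA ler_pM2r ?gauss_gt0//.
rewrite /gauss expRN ler_pdivrMr ?expR_gt0//.
have h : a / 2 * x ^+ 2 <= expR (a / 2 * x ^+ 2).
  by rewrite (le_trans _ (expR_ge1Dx _))// lerDr.
have E : x ^+ 2 = 2 / a * (a / 2 * x ^+ 2) by field; rewrite gt_eqF.
by rewrite [leLHS]E ler_pM2l// divr_gt0.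
Qed.

Lemma integrable_sqr_gauss a : 0 < a ->
  mu.-integrable setT (EFin \o (fun x => x ^+ 2 * gauss a x)).
Proof.
move=> a0; apply: (@integrable_dominated _ _ _ mu _ (fun x => 2 / a * gauss (a / 2) x)).
- by apply: measurable_funM; [exact: measurable_funX|exact: measurable_gauss].
- by move=> x; rewrite ger0_norm ?sqr_gauss_le// mulr_ge0 ?sqr_ge0 ?gauss_ge0.
- by apply: integrable_EFinZl; apply: integrable_gauss; rewrite divr_gt0.
Qed.

Lemma integrable_normM_gauss a : 0 < a ->
  mu.-integrable setT (EFin \o (fun x => `|x| * gauss a x)).
Proof.
move=> a0; apply: (@integrable_dominated _ _ _ mu _ (fun x => gauss a x + x ^+ 2 * gauss a x)).
- apply: measurable_funM; last exact: measurable_gauss.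
  by apply: continuous_measurable_fun; exact: norm_continuous.
- move=> x; rewrite ger0_norm ?mulr_ge0 ?gauss_ge0// -[X in X + _]mul1r -mulrDl ler_wpM2r ?gauss_ge0//.
  by rewrite -(real_normK (num_real x)); have := normr_ge0 x; nra.
- by apply: integrable_EFinD; [exact: integrable_gauss|exact: integrable_sqr_gauss].
Qed.

Lemma measurable_cosM (b : R) : measurable_fun setT (fun x => cos (b * x)).
Proof.
apply: (measurableT_comp (continuous_measurable_fun (@continuous_cos R))).
exact: measurable_funM.
Qed.

Lemma measurable_sinM (b : R) : measurable_fun setT (fun x => sin (b * x)).
Proof.
apply: (measurableT_comp (continuous_measurable_fun (@continuous_sin R))).
exact: measurable_funM.
Qed.

End gaussian.

(** * Fubini's theorem for real-valued integrals *)

Section fubini_real.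
Context d1 d2 (T1 : measurableType d1) (T2 : measurableType d2) (R : realType).
Variables (m1 : {sigma_finite_measure set T1 -> \bar R})
  (m2 : {sigma_finite_measure set T2 -> \bar R}).
Implicit Types (f : T1 -> R) (g : T2 -> R) (k : T1 * T2 -> R).

Lemma integrable_prod f g : m1.-integrable setT (EFin \o f) ->
  m2.-integrable setT (EFin \o g) ->
  (m1 \x m2)%E.-integrable setT (EFin \o (fun z => f z.1 * g z.2)).
Proof.
move=> fi gi.
have mf := integrable_EFin_measurable fi; have mg := integrable_EFin_measurable gi.
have mfg : measurable_fun setT (fun z : T1 * T2 => f z.1 * g z.2).
  by apply: measurable_funM; apply: measurableT_comp.
apply/integrable12ltyP; first exact/measurable_EFinP.
rewrite (eq_integral (fun x => (\int[m2]_y `|g y|%:E) * `|f x|%:E)%E); last first.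
  move=> x _; rewrite muleC -ge0_integralZl//=.
  - by apply: eq_integral => y _; rewrite normrM EFinM.
  - by apply/measurable_EFinP; exact: measurableT_comp.
have /integrableP[_ gfin] := gi; have /integrableP[_ ffin] := fi.
rewrite ge0_integralZl//=.
- apply: lte_mul_pinfty => //; first exact: integral_ge0.
  by rewrite ge0_fin_numE//; exact: integral_ge0.
- by apply/measurable_EFinP; exact: measurableT_comp.
- exact: integral_ge0.
Qed.

Lemma Rintegral_prod f g : m1.-integrable setT (EFin \o f) ->
  m2.-integrable setT (EFin \o g) ->
  \int[(m1 \x m2)%E]_z (f z.1 * g z.2) = \int[m1]_x f x * \int[m2]_y g y.
Proof.
move=> fi gi; rewrite {1}/Rintegral.
rewrite -(integral12_prod_meas1 (integrable_prod fi gi)) /fubini_F/=.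
rewrite (eq_integral (fun x => (\int[m2]_y g y)%:E * (f x)%:E)%E); last first.
  move=> x _; rewrite /Rintegral fineK; last exact: (integrable_fin_num measurableT gi).
  by rewrite muleC -integralZl.
rewrite (integralZl measurableT fi) fineM; first by rewrite /= mulrC.
  by [].
exact: (integrable_fin_num measurableT fi).
Qed.

(** A bounded kernel against a product of integrable functions is integrable on the product space.
    The kernel will be a cosine. *)
Lemma Rintegral_fubini f g k (B : R) : m1.-integrable setT (EFin \o f) ->
  m2.-integrable setT (EFin \o g) -> measurable_fun setT k ->
  (forall z, `|k z| <= B) ->
  \int[m1]_x (f x * \int[m2]_y (g y * k (x, y))) =
  \int[m2]_y (g y * \int[m1]_x (f x * k (x, y))).
Proof.
move=> fi gi mk kB.
have hi := integrable_EFin_bounded mk kB (integrable_prod fi gi).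
have gki x : m2.-integrable setT (EFin \o (fun y => g y * k (x, y))).
  by apply: integrable_EFin_bounded gi => //; exact: measurable_fun_pair2.
have fki y : m1.-integrable setT (EFin \o (fun x => f x * k (x, y))).
  apply: (@integrable_EFin_bounded _ _ _ _ _ (fun x => k (x, y)) B) fi => //; exact: measurable_fun_pair1.
rewrite /Rintegral; congr fine.
transitivity (\int[m1]_x \int[m2]_y (f x * g y * k (x, y))%:E)%E.
  apply: eq_integral => x _.
  rewrite EFinM fineK; last exact: (integrable_fin_num measurableT (gki x)).
  rewrite -integralZl//; last exact: gki.
  by apply: eq_integral => y _; rewrite -EFinM mulrA.
rewrite (Fubini hi); apply: eq_integral => y _.
rewrite EFinM fineK; last exact: (integrable_fin_num measurableT (fki y)).
rewrite -integralZl//; last exact: fki.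
by apply: eq_integral => x _; rewrite -EFinM; congr EFin => /=; ring.
Qed.

End fubini_real.

(** * The cosine transform and its values on Gaussians *)

Section cosine_transform.
Context {R : realType}.
Notation mu := (@lebesgue_measure R).
Notation L1 f := (mu.-integrable setT (EFin \o f)).

Lemma Rintegral_odd (f : R -> R) : L1 f -> (forall x, f (- x) = - f x) ->
  \int[mu]_x f x = 0.
Proof.
move=> fi fN; have := Rintegral_affine 0 (_ : (-1:R) != 0) fi.
rewrite oppr_eq0 oner_eq0 normrN1 mul1r => /(_ isT).
under [in X in _ = X -> _]eq_Rintegral do rewrite addr0 mulN1r fN -mulN1r.
by rewrite RintegralZl// mulN1r; set I := (\int[mu]_x f x) => h; lra.
Qed.

Lemma integrable_cosM (f : R -> R) b : L1 f -> L1 (fun x => f x * cos (b * x)).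
Proof.
move=> fi; apply: integrable_EFin_bounded fi; first exact: measurable_cosM.
by move=> x; exact: cos_max.
Qed.

Lemma integrable_sinM (f : R -> R) b : L1 f -> L1 (fun x => f x * sin (b * x)).
Proof.
move=> fi; apply: integrable_EFin_bounded fi; first exact: measurable_sinM.
by move=> x; exact: sin_max.
Qed.

(** Halving the parameter pays for the translation: the two exponents differ by the square
    [a / 2 * (x + 2 * h) ^+ 2]. *)
Lemma gauss_shift_le (a x h : R) : 0 <= a ->
  gauss a (x + h) <= expR (a * h ^+ 2) * gauss (a / 2) x.
Proof.
move=> a0; rewrite /gauss -expRD ler_expR.
have H : 0 <= a / 2 * (x + 2 * h) ^+ 2 by rewrite mulr_ge0 ?divr_ge0 ?sqr_ge0.
rewrite -subr_ge0.
have -> : a * h ^+ 2 + - (a / 2 * x ^+ 2) - - (a * (x + h) ^+ 2) =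
  a / 2 * (x + 2 * h) ^+ 2 by field.
exact: H.
Qed.

Lemma gauss_le (a b x : R) : b <= a -> gauss a x <= gauss b x.
Proof. by move=> ba; rewrite ler_expR lerN2 ler_wpM2r ?sqr_ge0. Qed.

Lemma normM_gauss_le (a x : R) : 0 < a -> `|x| * gauss a x <= (1 + 2 / a) * gauss (a / 2) x.
Proof.
move=> a0; rewrite mulrDl mul1r.
apply: (@le_trans _ _ (gauss a x + x ^+ 2 * gauss a x)).
  rewrite -[X in X + _]mul1r -mulrDl ler_wpM2r ?gauss_ge0//.
  by rewrite -(real_normK (num_real x)); have := normr_ge0 x; nra.
by rewrite lerD ?sqr_gauss_le// gauss_le//; lra.
Qed.

(** As a function of [b] the integral solves G' = - b / (2 a) G, by differentiation under the
    integral and integration by parts. Hence G(b) exp(b^2 / (4 a)) is constant, equal to the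
    Gaussian integral at [b = 0]. *)
Lemma Rintegral_gauss_cos a b : 0 < a ->
  \int[mu]_x (gauss a x * cos (b * x)) = Num.sqrt (pi / a) * gauss (4 * a)^-1 b.
Proof.
move=> a0; pose G b := \int[mu]_x (gauss a x * cos (b * x)).
have dG b0 : is_derive (b0:R) (1:R) G (- (b0 / (2 * a)) * G b0).
  pose f (b x : R) := gauss a x * cos (b * x).
  have fd x c : is_derive c (1:R) (f ^~ x) (- (x * gauss a x * sin (c * x))).
    by derive_by; rewrite /=; ring.
  have I0 : `](b0 - 1), (b0 + 1)[%classic b0 by rewrite /= in_itv/= ltrDl ltr01 ltrBlDr ltrDl ltr01.
  have dfE c x : partial1of2 f c x = - (x * gauss a x * sin (c * x)).
    by rewrite partial1of2E; exact: (@derive_val _ _ _ _ _ _ _ (fd x c)).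
  have fi c : L1 (f c) by apply: integrable_cosM; exact: integrable_gauss.
  have ub c x : `](b0 - 1), (b0 + 1)[%classic c -> setT x -> `|partial1of2 f c x| <= `|x| * gauss a x.
    move=> _ _; rewrite dfE normrN !normrM (ger0_norm (gauss_ge0 _ _)).
    by rewrite ler_piMr// ?mulr_ge0 ?gauss_ge0// sin_max.
  have Gi : L1 (fun x => `|x| * gauss a x) by exact: integrable_normM_gauss.
  have fdi c x : `](b0 - 1), (b0 + 1)[%classic c -> setT x -> derivable (f ^~ x) c 1.
    by move=> _ _; exact: (@ex_derive _ _ _ _ _ _ _ (fd x c)).
  have Gi0 x : 0 <= `|x| * gauss a x by rewrite mulr_ge0 ?gauss_ge0.
  have D1 := @differentiation_under_integral _ _ _ mu f setT measurableT b0 _ _ I0 (fun c _ => fi c) fdi _ Gi0 Gi ub.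
  have D2 := @derivable_under_integral _ _ _ mu f setT measurableT b0 _ _ I0 (fun c _ => fi c) fdi _ Gi0 Gi ub.
  apply: DeriveDef => //; rewrite -derive1E D1.
  rewrite (@eq_Rintegral _ _ _ mu setT (fun x => - (x * gauss a x * sin (b0 * x)))); last by move=> x _; exact: dfE.
  have mxg : measurable_fun setT (fun x : R => x * gauss a x).
    by apply: measurable_funM => //; exact: measurable_gauss.
  have xgi : L1 (fun x : R => x * gauss a x).
    apply: integrable_dominated Gi => // x.
    by rewrite normrM (ger0_norm (gauss_ge0 _ _)).
  have xsi : L1 (fun x : R => x * gauss a x * sin (b0 * x)) by exact: integrable_sinM.
  (* integration by parts *)
  have : \int[mu]_x (b0 * (gauss a x * cos (b0 * x)) - 2 * a * (x * gauss a x * sin (b0 * x))) = 0.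
    (* The derivative at [x + h] is at most a multiple of [gauss (a / 2) (x + h)]. Undoing the shift
       halves the parameter once more and costs at most [expR (a / 2)], as |h| < 1. *)
    pose C := (`|b0| + 2 * a * (1 + 2 / a)) * expR (a / 2).
    have dK (x : R) : is_derive x (1:R) (fun x => gauss a x * sin (b0 * x))
        (b0 * (gauss a x * cos (b0 * x)) - 2 * a * (x * gauss a x * sin (b0 * x))).
      by have gd := is_derive_gauss a x; derive_by; ring.
    apply: (@integral_derive_eq0 _ _ _ (fun x => C * gauss (a / 2 / 2) x) dK).
    - by apply: integrable_sinM; exact: integrable_gauss.
    - by apply: integrable_EFinZl; apply: integrable_gauss; rewrite !divr_gt0.
    move=> x h h1; set y := x + h.
    have a20 : 0 <= a / 2 by rewrite divr_ge0 ?ltW.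
    apply: (@le_trans _ _ ((`|b0| + 2 * a * (1 + 2 / a)) * gauss (a / 2) y)).
      apply: le_trans (ler_normB _ _) _; rewrite [leRHS]mulrDl lerD//.
        rewrite normrM ler_wpM2l// normrM (ger0_norm (gauss_ge0 _ _)).
        apply: le_trans (_ : gauss a y <= _); last by apply: gauss_le; lra.
        by rewrite ler_piMr ?gauss_ge0// cos_max.
      rewrite normrM (ger0_norm (_ : 0 <= 2 * a)); last by lra.
      rewrite -[leRHS]mulrA ler_wpM2l//; first by lra.
      apply: le_trans (normM_gauss_le y a0).
      rewrite !normrM (ger0_norm (gauss_ge0 _ _)).
      by rewrite ler_piMr ?mulr_ge0 ?gauss_ge0// sin_max.
    rewrite /C -[leRHS]mulrA ler_wpM2l//.
      by rewrite addr_ge0// mulr_ge0 ?addr_ge0 ?divr_ge0 ?ltW// mulr_gt0.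
    apply: le_trans (gauss_shift_le _ _ a20) _.
    rewrite ler_wpM2r ?gauss_ge0// ler_expR ler_piMr//.
    by rewrite -(real_normK (num_real h)) expr_le1// ltW.
  rewrite RintegralB//; last 2 first.
  - by apply: integrable_EFinZl; exact: fi.
  - exact: integrable_EFinZl.
  rewrite (RintegralZl _ _ (fi b0))// (RintegralZl _ _ xsi)// -/(G b0).
  have -> : \int[mu]_x (- (x * gauss a x * sin (b0 * x))) =
      - \int[mu]_x (x * gauss a x * sin (b0 * x)).
    by rewrite -mulN1r -(RintegralZl _ _ xsi)//; apply: eq_Rintegral => x _; rewrite mulN1r.
  set J := \int[mu]_x _ => H.
  have -> : J = b0 * G b0 / (2 * a).
    by rewrite (_ : b0 * G b0 = 2 * a * J); [field; rewrite gt_eqF|lra].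
  by field; rewrite gt_eqF.
pose F b := G b * expR ((4 * a)^-1 * b ^+ 2).
have dF c : is_derive (c:R) (1:R) F 0.
  have dGc := dG c.
  by rewrite /F; derive_by; field; rewrite gt_eqF.
have := is_derive_0_is_cst b 0 dF.
rewrite /F expr0n/= mulr0 expR0 mulr1.
have -> : G 0 = Num.sqrt (pi / a).
  rewrite -Rintegral_gauss// /G; apply: eq_Rintegral => x _.
  by rewrite mul0r cos0 mulr1.
by move=> <-; rewrite /gauss -mulrA -expRD addrN expR0 mulr1.
Qed.

Lemma Rintegral_gauss_shift_cos a b c : 0 < a ->
  \int[mu]_x (gauss a (x - c) * cos (b * x)) =
  Num.sqrt (pi / a) * gauss (4 * a)^-1 b * cos (b * c).
Proof.
move=> a0.
have gi := integrable_gauss a0.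
have gci := integrable_cosM b gi; have gsi := integrable_sinM b gi.
have si : L1 (fun x => gauss a (x - c) * cos (b * x)).
  apply: integrable_cosM.
  by have := integrable_affine (- c) (oner_neq0 R) gi; apply: eq_integrable => // x _ /=; rewrite mul1r.
rewrite (Rintegral_affine c (oner_neq0 R) si) normr1 mul1r.
rewrite (@eq_Rintegral _ _ _ mu setT (fun x => cos (b * c) * (gauss a x * cos (b * x)) - sin (b * c) * (gauss a x * sin (b * x)))); last first.
  by move=> x _; rewrite mul1r addrK mulrDr cosD; ring.
rewrite RintegralB//; [|exact: integrable_EFinZl|exact: integrable_EFinZl].
rewrite !RintegralZl// Rintegral_gauss_cos// [X in _ - _ * X]Rintegral_odd//.
  by rewrite mulr0 subr0 mulrC.
by move=> x; rewrite gaussN mulrN sinN mulrN.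
Qed.

(** For even [f] this is the Fourier transform, the sine part being the integral of an odd
    function. *)
Definition cos_transform (f : R -> R) (xi : R) :=
  \int[mu]_x (f x * cos (2 * pi * xi * x)).

Lemma continuous_cos_transform (f : R -> R) : L1 f -> continuous (cos_transform f).
Proof.
move=> fi xi; have mf := integrable_EFin_measurable fi.
have I0 : xi \in `](xi - 1), (xi + 1)[%classic.
  by rewrite inE/= in_itv/= ltrDl ltr01 ltrBlDr ltrDl ltr01.
apply: (@continuity_under_integral _ _ _ mu (fun xi x => f x * cos (2 * pi * xi * x))
  setT measurableT (xi - 1) (xi + 1) _ _ (fun x => `|f x|) _ _ xi I0).
- by move=> c _; exact: integrable_cosM.
- apply: aeW => x _ c _.
  apply: continuousM; first exact: cst_continuous.
  have dc : is_derive (c:R) (1:R) (fun c => cos (2 * pi * c * x)) (- sin (2 * pi * c * x) * (2 * pi * x)).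
    by derive_by; ring.
  exact: is_derive_continuous dc.
- exact: (integrable_norm fi).
- move=> c _; apply: aeW => x _.
  by rewrite normrM ler_piMr// cos_max.
Qed.

Lemma measurable_cos_transform (f : R -> R) : L1 f ->
  measurable_fun setT (cos_transform f).
Proof. by move=> fi; apply: continuous_measurable_fun; apply: continuous_cos_transform. Qed.

Lemma cos_transform_bounded (f : R -> R) xi : L1 f ->
  `|cos_transform f xi| <= \int[mu]_x `|f x|.
Proof.
move=> fi; apply: le_trans (le_normr_Rintegral measurableT (integrable_cosM _ fi)) _.
apply: le_Rintegral => //; first exact: integrable_norm (integrable_cosM _ fi).
  exact: integrable_norm fi.
by move=> x _; rewrite normrM ler_piMr// cos_max.
Qed.

End cosine_transform.

Section integrable_bound.
Context d (T : measurableType d) (R : realType) (m : {measure set T -> \bar R}).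

Lemma EFin_Rintegral (f : T -> R) : m.-integrable setT (EFin \o f) ->
  (\int[m]_x f x)%:E = (\int[m]_x (f x)%:E)%E.
Proof. by move=> fi; rewrite /Rintegral fineK//; exact: (integrable_fin_num measurableT fi). Qed.

Lemma ge0_integrable_bound (f : T -> R) (B : R) : measurable_fun setT f ->
  (forall x, 0 <= f x) -> (\int[m]_x (f x)%:E <= B%:E)%E ->
  m.-integrable setT (EFin \o f) /\ \int[m]_x f x <= B.
Proof.
move=> mf f0 fB.
have fi : m.-integrable setT (EFin \o f).
  apply/integrableP; split; first exact/measurable_EFinP.
  rewrite (eq_integral (fun x => (f x)%:E)); last by move=> x _ /=; rewrite ger0_norm.
  by rewrite (le_lt_trans fB)// ltry.
by split => //; rewrite -lee_fin EFin_Rintegral.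
Qed.

End integrable_bound.

(** * Bessel's inequality for the cosine transform *)

(* For a Gaussian weight of parameter [a], Fubini turns the weighted square integral of
   the transform into a double integral of [f x * f y * K (x, y)], where [K] is symmetric,
   nonnegative and has mass 1 in each variable; bound [f x * f y] by AM-GM, let [a] tend
   to 0. *)
Section bessel.
Context {R : realType}.
Notation mu := (@lebesgue_measure R).
Notation L1 f := (mu.-integrable setT (EFin \o f)).
Variable f : R -> R.
Hypotheses (fi : L1 f) (f2i : L1 (fun x => f x ^+ 2)).

Let C := cos_transform f.
Let B := \int[mu]_x `|f x|.

Section weighted.
Variable a : R.
Hypothesis a0 : 0 < a.

Let k (z : R * R) : R := cos (2 * pi * z.1 * z.2).
(** The cosine transform of the weight [gauss a], a Gaussian of mass 1. The two terms of [K] come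
    from writing a product of cosines as half the sum of the cosines of the difference and of the
    sum. *)
Let kap (u : R) := Num.sqrt (pi / a) * gauss (pi ^+ 2 / a) u.
Let K (z : R * R) := (kap (z.1 - z.2) + kap (z.1 + z.2)) / 2.

Let pi2a : 0 < pi ^+ 2 / a. Proof. by rewrite divr_gt0// exprn_gt0// pi_gt0. Qed.

Let mk : measurable_fun setT k.
Proof.
apply: (measurableT_comp (continuous_measurable_fun (@continuous_cos R))).
by apply: measurable_funM => //; apply: measurable_funM.
Qed.

Let k_le1 z : `|k z| <= 1. Proof. exact: cos_max. Qed.

Let kap_ge0 u : 0 <= kap u. Proof. by rewrite mulr_ge0 ?sqrtr_ge0 ?gauss_ge0. Qed.

Let kap_le u : kap u <= Num.sqrt (pi / a).
Proof. by rewrite ler_piMr ?sqrtr_ge0// gauss_le1// ltW. Qed.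

Let mkap : measurable_fun setT kap.
Proof. by apply: measurable_funM => //; exact: measurable_gauss. Qed.

Let mK : measurable_fun setT K.
Proof.
apply: measurable_funM => //; apply: measurable_funD.
  by apply: (measurableT_comp mkap); exact: measurable_funB.
by apply: (measurableT_comp mkap); exact: measurable_funD.
Qed.

Let K_ge0 z : 0 <= K z. Proof. by rewrite divr_ge0// addr_ge0. Qed.

Let K_le z : `|K z| <= Num.sqrt (pi / a).
Proof.
by rewrite ger0_norm// ler_pdivrMr// mulr_natr mulr2n lerD.
Qed.

Let KC x y : K (x, y) = K (y, x).
Proof. by rewrite /K/= /kap (addrC y x) -[y - x]opprB gaussN. Qed.

Let kapi : L1 kap.
Proof. by apply: integrable_EFinZl; exact: integrable_gauss. Qed.

Let Rkap : \int[mu]_x kap x = 1.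
Proof.
rewrite RintegralZl//; last exact: integrable_gauss.
rewrite Rintegral_gauss// -sqrtrM ?divr_ge0 ?pi_ge0 ?ltW//.
rewrite (_ : _ * _ = 1) ?sqrtr1//.
have := lt0r_neq0 (pi_gt0 R); move: (pi : R) => P P0; by field; rewrite P0 gt_eqF.
Qed.

Let KE x : (fun y => K (x, y)) = (fun y => 2^-1 * (kap (1 * y + - x) + kap (1 * y + x))).
Proof.
apply/funext => y; rewrite /K/= mulrC; congr (_ * (_ + _)); rewrite /kap.
  by rewrite -[x - y]opprB gaussN mul1r.
by rewrite addrC mul1r.
Qed.

Let Ki x : L1 (fun y => K (x, y)).
Proof.
rewrite KE; apply: integrable_EFinZl.
by apply: integrable_EFinD; exact: (integrable_affine _ (oner_neq0 R) kapi).
Qed.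

Let RK x : \int[mu]_y K (x, y) = 1.
Proof.
rewrite KE.
have i1 c := integrable_affine c (oner_neq0 R) kapi.
have e1 c : \int[mu]_y kap (1 * y + c) = 1.
  by rewrite -[RHS]Rkap [in RHS](Rintegral_affine c (oner_neq0 R) kapi) normr1 mul1r.
rewrite RintegralZl//; last by apply: integrable_EFinD.
by rewrite RintegralD// !e1; field.
Qed.

Let gC x := gauss a x * C x.

Let gCi : L1 gC.
Proof.
apply: integrable_EFin_bounded (integrable_gauss a0).
  exact: measurable_cos_transform.
by move=> x; exact: cos_transform_bounded.
Qed.

Let D := cos_transform gC.

Let DE x : D x = \int[mu]_y (f y * K (x, y)).
Proof.
transitivity (\int[mu]_xi (gauss a xi * k (x, xi) * \int[mu]_y (f y * k (xi, y)))).
  by apply: eq_Rintegral => xi _; rewrite /gC /C /cos_transform /k/=; ring.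
have gki : L1 (fun xi => gauss a xi * k (x, xi)).
  exact: (integrable_cosM (2 * pi * x) (integrable_gauss a0)).
rewrite (Rintegral_fubini gki fi mk k_le1).
apply: eq_Rintegral => y _; congr (_ * _).
rewrite (@eq_Rintegral _ _ _ mu setT (fun xi => 2^-1 * (gauss a xi * cos (2 * pi * (x - y) * xi) + gauss a xi * cos (2 * pi * (x + y) * xi)))); last first.
  move=> xi _; rewrite /k/=.
  have -> : 2 * pi * (x - y) * xi = 2 * pi * x * xi - 2 * pi * xi * y by ring.
  have -> : 2 * pi * (x + y) * xi = 2 * pi * x * xi + 2 * pi * xi * y by ring.
  by rewrite cosB cosD; field.
rewrite RintegralZl//; last by apply: integrable_EFinD; apply: integrable_cosM; exact: integrable_gauss.
rewrite RintegralD//; [|by apply: integrable_cosM; exact: integrable_gauss..].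
rewrite !Rintegral_gauss_cos// /K /kap mulrC /=.
have E4 (P : R) : (4 * a)^-1 * (2 * P) ^+ 2 = P ^+ 2 / a by field; rewrite gt_eqF.
have gE u : gauss (4 * a)^-1 (2 * pi * u) = gauss (pi ^+ 2 / a) u by rewrite gaussM E4.
by rewrite !gE.
Qed.

Let S x := \int[mu]_y (f y ^+ 2 * K (x, y)).

Let f2Ki x : L1 (fun y => f y ^+ 2 * K (x, y)).
Proof. by apply: integrable_EFin_bounded f2i => //; exact: measurable_fun_pair2. Qed.

Let mf := integrable_EFin_measurable fi.

Let h (z : R * R) := f z.2 ^+ 2 * K z.

Let mh : measurable_fun setT h.
Proof.
apply: measurable_funM => //; apply: measurable_funX.
exact: (measurableT_comp mf).
Qed.

Let Sint y : (\int[mu]_x (h (x, y))%:E)%E = (f y ^+ 2)%:E.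
Proof.
rewrite /h/= (@eq_integral _ _ _ mu setT (fun x => (f y ^+ 2)%:E * (K (y, x))%:E)%E); last by move=> x _; rewrite EFinM KC.
rewrite integralZl//; last exact: Ki.
by rewrite -EFin_Rintegral ?RK ?mule1//; exact: Ki.
Qed.

Let hi : (mu \x mu)%E.-integrable setT (EFin \o h).
Proof.
apply/integrable21ltyP; first exact/measurable_EFinP.
rewrite (@eq_integral _ _ _ mu setT (fun y => (f y ^+ 2)%:E)); last first.
  move=> y _; rewrite -Sint; apply: eq_integral => x _.
  by rewrite /= ger0_norm// mulr_ge0 ?sqr_ge0.
exact: integrable_lty f2i.
Qed.

Let SE : EFin \o S = fubini_F mu (EFin \o h).
Proof. by apply/funext => x; rewrite /= EFin_Rintegral//; exact: f2Ki. Qed.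

Let Si : L1 S.
Proof. by rewrite SE; exact: integrable_fubini_F hi. Qed.

Let RS : \int[mu]_x S x = \int[mu]_x f x ^+ 2.
Proof.
rewrite /Rintegral; congr fine.
transitivity (\int[mu]_x (fubini_F mu (EFin \o h)) x)%E; first by rewrite -SE.
rewrite integral12_prod_meas1// -integral21_prod_meas1//.
by apply: eq_integral => y _; rewrite /fubini_G/= Sint.
Qed.

Lemma bessel_weighted : \int[mu]_xi (gauss a xi * C xi ^+ 2) <= \int[mu]_x f x ^+ 2.
Proof.
have -> : \int[mu]_xi (gauss a xi * C xi ^+ 2) = \int[mu]_x (f x * D x).
  transitivity (\int[mu]_xi (gC xi * \int[mu]_x (f x * k (xi, x)))).
    by apply: eq_Rintegral => xi _; rewrite /gC /C /cos_transform /k/=; ring.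
  rewrite (Rintegral_fubini gCi fi mk k_le1).
  apply: eq_Rintegral => x _; congr (_ * _); apply: eq_Rintegral => xi _.
  by rewrite /k/=; congr (_ * cos _); ring.
apply: (@le_trans _ _ (\int[mu]_x (2^-1 * (f x ^+ 2 + S x)))); last first.
  rewrite RintegralZl//; last exact: integrable_EFinD.
  by rewrite RintegralD// RS; lra.
apply: le_Rintegral => //.
- apply: integrable_EFin_bounded fi; first exact: measurable_cos_transform.
  by move=> x; exact: cos_transform_bounded.
- by apply: integrable_EFinZl; exact: integrable_EFinD.
move=> x _; rewrite DE.
have fKi : L1 (fun y => f y * K (x, y)).
  by apply: integrable_EFin_bounded fi => //; exact: measurable_fun_pair2.
rewrite -RintegralZl//.
apply: (@le_trans _ _ (\int[mu]_y (2^-1 * (f x ^+ 2 * K (x, y) + f y ^+ 2 * K (x, y))))); last first.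
  rewrite RintegralZl//; last by apply: integrable_EFinD => //; apply: integrable_EFinZl; exact: Ki.
  rewrite RintegralD//; last by apply: integrable_EFinZl; exact: Ki.
  by rewrite RintegralZl// ?RK ?mulr1//; exact: Ki.
apply: le_Rintegral => //.
- exact: integrable_EFinZl.
- by apply: integrable_EFinZl; apply: integrable_EFinD => //; apply: integrable_EFinZl; exact: Ki.
move=> y _; rewrite mulrA -mulrDl [leRHS]mulrA ler_wpM2r//.
by have := sqr_ge0 (f x - f y); nra.
Qed.

End weighted.

(** An inequality is enough, because only error terms, which need upper bounds, are passed through
    it. *)
Lemma bessel : L1 (fun xi => C xi ^+ 2) /\ \int[mu]_xi C xi ^+ 2 <= \int[mu]_x f x ^+ 2.
Proof.
have mC : measurable_fun setT C by exact: measurable_cos_transform.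
apply: ge0_integrable_bound; first exact: measurable_funX.
  by move=> xi; exact: sqr_ge0.
(* The parameters of the weights decrease to 0, so the weights increase to 1 and monotone
   convergence applies. *)
pose g (n : nat) (xi : R) := (gauss n.+1%:R^-1 xi * C xi ^+ 2)%:E.
have gi (n : nat) : L1 (fun xi => gauss n.+1%:R^-1 xi * C xi ^+ 2).
  apply: (@integrable_EFin_bounded _ _ _ _ _ _ (B ^+ 2)); [exact: measurable_funX| |exact: integrable_gauss].
  move=> xi; rewrite normrX ler_pXn2r ?nnegrE//; first exact: cos_transform_bounded.
  by rewrite /B Rintegral_ge0.
have := @monotone_convergence _ _ _ mu setT measurableT g.
rewrite (_ : (\int[mu]_x limn (g^~ x))%E = (\int[mu]_x (C x ^+ 2)%:E)%E); last first.
  apply: eq_integral => xi _; apply/cvg_lim => //; apply: cvg_EFin; first exact: nearW.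
  have dg : is_derive (0:R) (1:R) (fun u => gauss u xi) (- xi ^+ 2).
    by rewrite /gauss; derive_by; rewrite mul0r oppr0 expR0; ring.
  have cg : gauss u xi @[u --> (0:R)] --> (1:R).
    have g01 : 1 = gauss 0 xi by rewrite /gauss mul0r oppr0 expR0.
    by rewrite g01; exact: (is_derive_continuous dg).
  rewrite -[X in _ --> X]mul1r /g /comp/=; apply: cvgMr_tmp.
  exact: (cvg_comp _ _ (@cvg_harmonic R) cg).
have mg n : measurable_fun setT (g n).
  by apply/measurable_EFinP; exact: integrable_EFin_measurable (gi n).
have g0 n x : setT x -> (0 <= g n x)%E.
  by move=> _; rewrite lee_fin mulr_ge0 ?gauss_ge0 ?sqr_ge0.
have ndg x : setT x -> {homo g^~ x : n m / (n <= m)%N >-> (n <= m)%E}.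
  move=> _ n m nm; rewrite lee_fin ler_wpM2r ?sqr_ge0// gauss_le//.
  by rewrite lef_pV2 ?posrE// ler_nat ltnS.
move=> /(_ mg g0 ndg) ->; apply: lime_le.
  apply: ereal_nondecreasing_is_cvgn => n m nm.
  by apply: ge0_le_integral; solve [done|exact: g0|exact: mg|move=> x xT; exact: ndg].
apply: nearW => n; rewrite /g -EFin_Rintegral// lee_fin.
by apply: bessel_weighted; rewrite invr_gt0.
Qed.

End bessel.

(** * Second-order differences of a power of the norm *)

Section norm_power.
Context {R : realType}.
Implicit Types s q x y B : R.

Lemma is_derive_fun_sum n (F : 'I_n -> R -> R) (a : 'I_n -> R) x :
  (forall k, is_derive x (1:R) (F k) (a k)) ->
  is_derive x (1:R) (fun y => \sum_(k < n) F k y) (\sum_(k < n) a k).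
Proof.
move=> dF; rewrite (_ : (fun y => _) = \sum_(k < n) F k); first exact: is_derive_sum.
by apply/funext => y; rewrite fct_sumE.
Qed.

Lemma cvg_normr_powR0 s : 0 < s -> {for 0, continuous (fun x : R => `|x| `^ s)}.
Proof.
move=> s0; apply/cvgrPdist_lt => e e0.
rewrite normr0 powR0 ?gt_eqF//; near=> x.
rewrite sub0r normrN ger0_norm ?powR_ge0//.
have -> : e = (e `^ s^-1) `^ s by rewrite -powRrM mulVf ?gt_eqF// powRr1// ltW.
apply: gt0_ltr_powR; rewrite ?nnegrE ?powR_ge0//.
rewrite -[x]subr0 distrC; near: x.
apply: (@nbhsx_ballx _ R^o (0:R)); exact: powR_gt0.
Unshelve. all: end_near. Qed.

(** A smooth power for positive [x], extended by oddness to negative [x]. At 0 the slope function is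
    |x|^s itself, which is continuous there because [s] is positive. *)
Lemma is_derive_norm_powRM s x : 0 < s ->
  is_derive x (1:R) (fun y => `|y| `^ s * y) ((s + 1) * `|x| `^ s).
Proof.
move=> s0.
have pos y : 0 < y -> is_derive y (1:R) (fun y => `|y| `^ s * y) ((s + 1) * `|y| `^ s).
  move=> y0; have d0 : is_derive y (1:R) (fun y => y `^ s * y) ((s + 1) * `|y| `^ s).
    have di := is_derive_fun_id y.
    apply: is_derive_val (is_derive_funM (is_derive_fun_powR s y0 di) di) _.
    rewrite (ger0_norm (ltW y0)) -(mulr_powRB1 (ltW y0) s0); ring.
  apply: near_eq_is_derive d0; near=> z; rewrite gtr0_norm//.
  by near: z; exact: lt_nbhsr.
have [x0|x0|<-] := ltgtP 0 x; first exact: pos.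
  have dN : is_derive x (1:R) (fun y => - y) (-1).
    by have di := is_derive_fun_id x; exact: is_derive_funN di.
  have Nx0 : 0 < - x by rewrite oppr_gt0.
  have := is_derive_funN (is_derive_fun_comp (g := fun y => - y) (pos _ Nx0) dN).
  rewrite normrN mulrN1 opprK; congr is_derive.
  by apply/funext => y; rewrite normrN mulrN opprK.
apply/is_derive1_caratheodory; exists (fun x => `|x| `^ s); split.
- by move=> z; rewrite mulr0 subr0 subr0.
- exact: cvg_normr_powR0.
- by rewrite normr0 powR0 ?mulr0// gt_eqF.
Unshelve. all: end_near. Qed.

Lemma norm_powR_split q x : 2 < q -> `|x| `^ q = `|x| `^ (q - 2) * x * x.
Proof.
move=> q2; have e : q = (q - 2) + 2 by ring.
rewrite {1}e (@powRD _ _ (q - 2) 2); last by rewrite -e gt_eqF//; apply: lt_trans q2.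
by rewrite powR_mulrn// real_normK ?num_real// mulrA.
Qed.

Lemma is_derive_norm_powR q x : 2 < q ->
  is_derive x (1:R) (fun y => `|y| `^ q) (q * (`|x| `^ (q - 2) * x)).
Proof.
move=> q2; have s0 : 0 < q - 2 by rewrite subr_gt0.
rewrite (_ : (fun y => _) = (fun y => `|y| `^ (q - 2) * y * y)).
  apply: is_derive_val (is_derive_funM (is_derive_norm_powRM x s0) (is_derive_fun_id x)) _.
  ring.
by apply/funext => y; exact: norm_powR_split.
Qed.

Lemma norm_powRM_lipschitz s B x y : 0 < s -> `|x| <= B -> `|y| <= B ->
  `| `|x| `^ s * x - `|y| `^ s * y| <= (s + 1) * B `^ s * `|x - y|.
Proof.
move=> s0; wlog yx : x y / y <= x.
  move=> H xB yB; have [yx|/ltW xy] := leP y x; first exact: H.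
  by rewrite distrC [`|x - y|]distrC; exact: H.
move=> xB yB.
have [c /andP[yc cx] ->] := MVT_is_derive yx (fun z => is_derive_norm_powRM z s0).
rewrite normrM ler_wpM2r// normrM (ger0_norm (_ : 0 <= s + 1)); last lra.
rewrite ler_wpM2l//; first lra.
rewrite ger0_norm ?powR_ge0//.
have cB : `|c| <= B.
  move: xB yB; rewrite !ler_norml => /andP[_ xB] /andP[yB _].
  by rewrite (le_trans yB yc) (le_trans cx xB).
by apply: ge0_ler_powR; rewrite ?nnegrE ?(ltW s0)// (le_trans _ cB).
Qed.

(* The mean value theorem is applied to the difference of [|z + s e|^q] and
   [|z' + s e'|^q] as a function of [s], so that each term of the bound has a factor
   coming from [e], [e']. *)
Lemma norm_powR_diff2 q B (z e z' e' : R) : 2 < q ->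
  `|z| <= B -> `|e| <= B -> `|z'| <= B -> `|e'| <= B ->
  `| (`|z + e| `^ q - `|z| `^ q) - (`|z' + e'| `^ q - `|z'| `^ q)| <=
  q * ((q - 1) * (B + B) `^ (q - 2)) *
  ((`|z - z'| + `|e - e'|) * `|e| + (`|z'| + `|e'|) * `|e - e'|).
Proof.
move=> q2 zB eB z'B e'B.
have s0 : 0 < q - 2 by rewrite subr_gt0.
pose h x := `|x| `^ (q - 2) * x.
pose psi s := `|z + s * e| `^ q - `|z' + s * e'| `^ q.
pose dpsi s := q * h (z + s * e) * e - q * h (z' + s * e') * e'.
have dpsiE s : is_derive s (1:R) psi (dpsi s).
  have dl (u v : R) : is_derive s (1:R) (fun s => u + s * v) v by derive_by; ring.
  have d1 := is_derive_fun_comp (g := fun s => z + s * e) (is_derive_norm_powR (z + s * e) q2) (dl z e).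
  have d2 := is_derive_fun_comp (g := fun s => z' + s * e') (is_derive_norm_powR (z' + s * e') q2) (dl z' e').
  apply: is_derive_val (is_derive_funB d1 d2) _.
  by [].
have [c /andP[c0 c1]] := MVT_is_derive (ler01 : (0:R) <= 1) dpsiE.
rewrite subr0 mulr1 /psi !mul1r !mul0r !addr0.
have -> : `|z + e| `^ q - `|z| `^ q - (`|z' + e'| `^ q - `|z'| `^ q) =
  `|z + e| `^ q - `|z' + e'| `^ q - (`|z| `^ q - `|z'| `^ q) by ring.
move=> ->.
have bnd (u v : R) : `|u| <= B -> `|v| <= B -> `|u + c * v| <= B + B.
  move=> uB vB; apply: le_trans (ler_normD _ _) _; rewrite lerD// normrM.
  by rewrite (ger0_norm c0) (le_trans _ vB)// ler_piMl.
have Zb := bnd _ _ zB eB; have Z'b := bnd _ _ z'B e'B.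
set Z := z + c * e in Zb *; set Z' := z' + c * e' in Z'b *.
have -> : dpsi c = q * ((h Z - h Z') * e + h Z' * (e - e')) by rewrite /dpsi -/Z -/Z'; ring.
set L := (q - 1) * _.
have L0 : 0 <= L by rewrite mulr_ge0 ?powR_ge0//; lra.
have hl u v : `|u| <= B + B -> `|v| <= B + B -> `|h u - h v| <= L * `|u - v|.
  move=> uB vB; have := norm_powRM_lipschitz s0 uB vB.
  by rewrite /L (_ : q - 2 + 1 = q - 1)//; ring.
have h0 : h 0 = 0 by rewrite /h mulr0.
have hZ' : `|h Z'| <= L * `|Z'|.
  by have := hl Z' 0 Z'b; rewrite normr0 h0 !subr0; apply; apply: le_trans (normr_ge0 _) Zb.
have q0 : 0 <= q by lra.
rewrite normrM (ger0_norm q0) -mulrA ler_wpM2l//.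
apply: le_trans (ler_normD _ _) _.
rewrite (normrM (h Z - h Z')) (normrM (h Z')) mulrDr lerD//.
  apply: (le_trans (ler_wpM2r (normr_ge0 e) (hl _ _ Zb Z'b))).
  rewrite -mulrA ler_wpM2l// ler_wpM2r//.
  have -> : Z - Z' = (z - z') + c * (e - e') by rewrite /Z /Z'; ring.
  apply: le_trans (ler_normD _ _) _; rewrite lerD2l normrM (ger0_norm c0).
  by rewrite ler_piMl.
apply: (@le_trans _ _ (L * `|Z'| * `|e - e'|)); first by rewrite ler_wpM2r.
rewrite -mulrA ler_wpM2l// ler_wpM2r//.
apply: le_trans (ler_normD _ _) _; rewrite lerD2l normrM (ger0_norm c0).
by rewrite ler_piMl.
Qed.

End norm_power.

(** * How far a concave power is from being additive *)

Section power_sum.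
Context {R : realType}.
Variables (n : nat) (r : R).
Hypotheses (r_ge : 2^-1 <= r) (r_le : r <= 1).
Implicit Types b : 'I_n -> R.

Let r0 : 0 < r. Proof. by apply: lt_le_trans r_ge; rewrite invr_gt0. Qed.

(** With S the sum of the b_j, these quantities add up to the sum of the b_k^r minus S^r. For y =
    b_k / S the comparison of y^(1-r) with y^r leaves b_k^r (S^r - b_k^r) / S^r; subadditivity of
    the power bounds S^r - b_k^r by the sum of the other b_j^r; and b_k b_j <= S^2 exchanges half of
    the power of b_k b_j for the division by S^r. Only products of two distinct terms remain, which
    are small for distant bumps. *)
Lemma power_sum_defect b k : (forall j, 0 < b j) ->
  0 <= b k * (b k `^ (r - 1) - (\sum_(j < n) b j) `^ (r - 1)) <=
  \sum_(j < n | j != k) (b k * b j) `^ (r / 2).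
Proof.
move=> b0; set S := \sum_(j < n) b j.
have bS j : b j <= S.
  by rewrite /S (bigD1 j)//= lerDl sumr_ge0// => i _; exact: ltW.
have S0 : 0 < S by apply: lt_le_trans (bS k).
have powB u : 0 < u -> u * u `^ (r - 1) = u `^ r.
  by move=> u0; rewrite mulr_powRB1// ltW.
have leS j : S `^ (r - 1) <= b j `^ (r - 1).
  rewrite -[r - 1]opprB !powRN lef_pV2 ?posrE ?powR_gt0//.
  by apply: ge0_ler_powR; rewrite ?nnegrE ?subr_ge0 ?(ltW (b0 _)) ?(ltW S0)//.
apply/andP; split; first by rewrite mulr_ge0 ?subr_ge0 ?(ltW (b0 _)).
have Sr0 : 0 < S `^ r by exact: powR_gt0.
(* as 1 - r <= r, the ratio y := b k / S satisfies y^(1-r) >= y^r *)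
have H1 : b k * (b k `^ (r - 1) - S `^ (r - 1)) <= b k `^ r * (S `^ r - b k `^ r) / S `^ r.
  rewrite mulrBr powB// mulrBr mulrBl mulfK ?gt_eqF// lerD2l lerN2.
  have y01 : 0 < b k / S <= 1 by rewrite divr_gt0//= ler_pdivrMr// mul1r.
  have r1r : 1 - r <= r by move: r_ge; rewrite -[2^-1]div1r ler_pdivrMr// => r_ge'; lra.
  have h : (b k / S) `^ r <= (b k / S) `^ (1 - r) by exact: ger_powR.
  have e (s : R) : (b k / S) `^ s = b k `^ s / S `^ s.
    by rewrite powRM ?invr_ge0 ?ltW// -powR_inv1 ?ltW// -powRrM mulN1r powRN.
  have -> : b k * S `^ (r - 1) = b k `^ r * ((b k / S) `^ (1 - r)).
    have r1 : r + (1 - r) = 1 by ring.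
    rewrite e mulrA -powRD r1 ?oner_eq0// powRr1 ?(ltW (b0 k))//.
    by rewrite -[r - 1]opprB powRN.
  by rewrite -mulrA -e ler_wpM2l ?powR_ge0.
apply: le_trans H1 _.
have H2 : S `^ r - b k `^ r <= \sum_(j < n | j != k) b j `^ r.
  rewrite lerBlDl -[leRHS](bigD1 k (P := predT) (F := fun j => b j `^ r))//=.
  rewrite -powB// /S mulr_suml; apply: ler_sum => j _.
  by rewrite -powB// ler_wpM2l ?(ltW (b0 j)).
apply: (@le_trans _ _ (b k `^ r * (\sum_(j < n | j != k) b j `^ r) / S `^ r)).
  by rewrite ler_wpM2r ?invr_ge0 ?powR_ge0// ler_wpM2l ?powR_ge0.
rewrite mulr_sumr mulr_suml; apply: ler_sum => j _.
rewrite ler_pdivrMr// -powRM ?(ltW (b0 _))//.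
have -> : (b k * b j) `^ r = (b k * b j) `^ (r / 2) * (b k * b j) `^ (r / 2).
  by rewrite -powRD; [congr powR; field|rewrite implybE; apply/orP; right; rewrite mulf_neq0 ?gt_eqF].
rewrite ler_wpM2l ?powR_ge0//.
have -> : S `^ r = (S * S) `^ (r / 2).
  rewrite powRM ?(ltW S0)// -powRD; first by congr powR; field.
  by rewrite (gt_eqF S0) implybT.
apply: ge0_ler_powR; rewrite ?nnegrE ?mulr_ge0 ?(ltW S0) ?(ltW (b0 _))//.
  exact: ltW.
by apply: ler_pM => //; exact: ltW.
Qed.

End power_sum.

(** * Powers of sums of Gaussian bumps *)

Lemma common_bound (R : realType) (a b c : R) : 0 <= a -> 0 <= b -> 0 <= c ->
  exists C : R, [/\ 0 < C, a <= C, b <= C & c <= C].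
Proof. by move=> a0 b0 c0; exists (1 + a + b + c); split; lra. Qed.

Section profile.
Context {R : realType}.
Notation mu := (@lebesgue_measure R).
Notation L1 f := (mu.-integrable setT (EFin \o f)).
Variables (n : nat) (xs : 'I_n -> R) (X m r : R).
Hypotheses (r_ge : 2^-1 <= r) (r_le : r <= 1).
Hypotheses (xs_le : forall k, `|xs k| <= X).
Hypotheses (m_ge0 : 0 <= m) (xs_sep : forall j k, j != k -> m <= `|xs j - xs k|).
Implicit Types (l x : R) (k j : 'I_n).

Definition bump l x k := gauss pi (x - l * xs k).

Definition profile l x := (\sum_(k < n) bump l x k) `^ r.

Definition profile_error l x := profile l x - \sum_(k < n) bump l x k `^ r.

(** [alpha] is the parameter of the power [r / 2] of a bump. It is halved three times to reach
    [beta]: to extract the overlap, to absorb a linear factor and to move the centre. *)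
Let alpha : R := pi * r / 2.
Let beta : R := alpha / 8.

Let G l x := \sum_(k < n) gauss beta (x - l * xs k).

Definition overlap l := gauss (alpha * m ^+ 2 / 4) l.

Let r0 : 0 < r. Proof. by apply: lt_le_trans r_ge; rewrite invr_gt0. Qed.

Let alpha_gt0 : 0 < alpha. Proof. by rewrite divr_gt0// mulr_gt0// pi_gt0. Qed.

Let beta_gt0 : 0 < beta. Proof. by rewrite divr_gt0. Qed.

Lemma bump_gt0 l x k : 0 < bump l x k. Proof. exact: gauss_gt0. Qed.

Lemma bump_powR l x k s : bump l x k `^ s = gauss (s * pi) (x - l * xs k).
Proof. exact: gauss_powR. Qed.

Let overlap_ge0 l : 0 <= overlap l. Proof. exact: gauss_ge0. Qed.

Let G_ge0 l x : 0 <= G l x. Proof. by apply: sumr_ge0 => k _; exact: gauss_ge0. Qed.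

(** The centres are at distance at least [l * m]. A quarter of the square of this distance is spent
    on [overlap], and half of the square of [x - l * xs k] is kept for integrability in [x]. *)
Lemma bump_pair l x j k : j != k ->
  (bump l x k * bump l x j) `^ (r / 2) <= overlap l * gauss (alpha / 2) (x - l * xs k).
Proof.
move=> jk; rewrite powRM ?(ltW (bump_gt0 _ _ _))// !bump_powR.
have -> : r / 2 * pi = alpha by rewrite /alpha; ring.
rewrite /overlap /gauss -!expRD ler_expR.
have h : m ^+ 2 <= (xs j - xs k) ^+ 2.
  by rewrite -[leRHS]real_normK ?num_real// ler_pXn2r ?nnegrE// xs_sep.
have hl : l ^+ 2 * m ^+ 2 <= l ^+ 2 * (xs j - xs k) ^+ 2 by rewrite ler_wpM2l ?sqr_ge0.
set u := x - l * xs k; set v := x - l * xs j.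
have uv : l ^+ 2 * (xs j - xs k) ^+ 2 = (u - v) ^+ 2 by rewrite /u /v; ring.
rewrite uv in hl.
(* By [hl], the right side exceeds the left one by at least (u + v)^2 / 4 + v^2 / 2. *)
have h2 : m ^+ 2 / 4 * l ^+ 2 + u ^+ 2 / 2 <= u ^+ 2 + v ^+ 2.
  by have := sqr_ge0 (u + v); have := sqr_ge0 v; nra.
have := ler_wpM2l (ltW alpha_gt0) h2.
have -> : alpha * m ^+ 2 / 4 * l ^+ 2 = alpha * (m ^+ 2 / 4 * l ^+ 2) by ring.
have -> : alpha / 2 * u ^+ 2 = alpha * (u ^+ 2 / 2) by ring.
by rewrite !mulrDr; lra.
Qed.

Let T l x k := bump l x k * (bump l x k `^ (r - 1) - (\sum_(j < n) bump l x j) `^ (r - 1)).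

Let T_bound l x k : 0 <= T l x k <= n%:R * (overlap l * gauss (alpha / 2) (x - l * xs k)).
Proof.
have /andP[T0 T1] := power_sum_defect r_ge r_le k (bump_gt0 l x).
rewrite /T T0/=; apply: (le_trans T1).
apply: (@le_trans _ _ (\sum_(j < n) (overlap l * gauss (alpha / 2) (x - l * xs k)))); last first.
  by rewrite sumr_const card_ord mulr_natl.
rewrite big_mkcond/=; apply: ler_sum => j _; case: ifPn => jk; first exact: bump_pair.
by rewrite mulr_ge0 ?gauss_ge0.
Qed.

Lemma bump_sum_gt0 l x : 'I_n -> 0 < \sum_(j < n) bump l x j.
Proof.
move=> k; apply: lt_le_trans (bump_gt0 l x k) _.
by rewrite (bigD1 k)//= lerDl sumr_ge0// => i _; exact: ltW (bump_gt0 _ _ _).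
Qed.

Let error_sum l x : profile_error l x = - \sum_(k < n) T l x k.
Proof.
(* The index set may be empty. The sum of the bumps is then 0 instead of positive, but all terms
   vanish. *)
have [k0|k0] := pselect ('I_n -> False); last first.
  have [k _] : exists k : 'I_n, True by apply: contrapT => h; apply: k0 => k; apply: h; exists k.
  have S0 := bump_sum_gt0 l x k.
  rewrite /profile_error /T; under [in RHS]eq_bigr do rewrite mulrBr.
  rewrite sumrB -mulr_suml mulr_powRB1 ?(ltW S0)// opprB; congr (_ - _).
  by apply: eq_bigr => j _; rewrite mulr_powRB1// ltW// bump_gt0.
have n0 : n = 0%N by case: n k0 => // n' /(_ ord0).
rewrite /profile_error /profile /T !big1; try by move=> k; case: (k0 k).
by rewrite powR0 ?gt_eqF// subrr oppr0.
Qed.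

Let error_bound l x : `|profile_error l x| <= n%:R * overlap l * G l x.
Proof.
rewrite error_sum normrN; apply: le_trans (ler_norm_sum _ _ _) _.
rewrite /G mulr_sumr; apply: ler_sum => k _.
have /andP[T0 T1] := T_bound l x k.
rewrite ger0_norm// (le_trans T1)// mulrA ler_wpM2l ?mulr_ge0// gauss_le// /beta.
by have := alpha_gt0; lra.
Qed.

(** Differentiation in [l] multiplies each bump by its logarithmic derivative
    [2 * pi * xs k * (x - l * xs k)] and leaves the same defect [T]. The derivative of the error is
    therefore as small as the error itself. *)
Let dT l x k := r * T l x k * (2 * pi * xs k * (x - l * xs k)).

Let is_derive_error l x :
  is_derive l (1:R) (fun l => profile_error l x) (- \sum_(k < n) dT l x k).
Proof.
have db k : is_derive l (1:R) (fun l => bump l x k)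
    (bump l x k * (2 * pi * xs k * (x - l * xs k))).
  have dl : is_derive l (1:R) (fun l => x - l * xs k) (- xs k) by derive_by; ring.
  apply: is_derive_val (is_derive_fun_comp (g := fun l => x - l * xs k) (is_derive_gauss pi _) dl) _.
  rewrite /bump; ring.
have [k0|k0] := pselect ('I_n -> False).
  rewrite (_ : (fun l => _) = fun=> 0).
    rewrite big1 ?oppr0; first exact: is_derive_fun_cst.
    by move=> k; case: (k0 k).
  apply/funext => l'; rewrite error_sum big1 ?oppr0// => k; case: (k0 k).
have [k _] : exists k : 'I_n, True by apply: contrapT => h; apply: k0 => k; apply: h; exists k.
have S0 := bump_sum_gt0 l x k.
have dS := is_derive_fun_sum db.
have dS' := is_derive_fun_powR r S0 dS.
have dbr j := is_derive_fun_powR (g := fun l => bump l x j) r (bump_gt0 l x j) (db j).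
apply: is_derive_val (is_derive_funB dS' (is_derive_fun_sum dbr)) _.
rewrite mulr_sumr -sumrB -sumrN; apply: eq_bigr => j _; rewrite /dT /T; ring.
Qed.

(** The factors are the number of interacting bumps, the coefficient of the logarithmic derivative,
    the cost of absorbing its linear factor, and the cost of moving a centre by at most [X]. *)
Let Cd : R := n%:R * (2 * pi * X * (1 + 2 / (alpha / 2))) * expR (alpha / 2 / 2 * X ^+ 2).

Let X_ge0 k : 0 <= X. Proof. exact: le_trans (xs_le k). Qed.

(** The bound is expressed at [l0], uniformly over a unit step, so that it holds at the unknown
    point given by the mean value theorem. *)
Let derive_bound l0 l x : 0 <= l0 -> l0 <= l <= l0 + 1 ->
  `| - \sum_(k < n) dT l x k| <= Cd * overlap l0 * G l0 x.
Proof.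
move=> l00 /andP[l0l ll0].
rewrite normrN; apply: le_trans (ler_norm_sum _ _ _) _.
rewrite /G mulr_sumr; apply: ler_sum => k _.
have X0 := X_ge0 k.
have /andP[T0 T1] := T_bound l x k.
set u := x - l * xs k; set u0 := x - l0 * xs k.
have ol : overlap l <= overlap l0.
  rewrite /overlap /gauss ler_expR lerN2 ler_wpM2l//.
    by rewrite divr_ge0// mulr_ge0 ?sqr_ge0// ltW.
  by rewrite ler_pXn2r ?nnegrE// (le_trans l00).
have gu : gauss (alpha / 2 / 2) u <= expR (alpha / 2 / 2 * X ^+ 2) * gauss beta u0.
  have -> : u = u0 + (l0 - l) * xs k by rewrite /u /u0; ring.
  have a40 : 0 <= alpha / 2 / 2 by apply: divr_ge0 => //; apply: divr_ge0 => //; exact: ltW.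
  apply: le_trans (gauss_shift_le _ _ a40) _.
  have -> : alpha / 2 / 2 / 2 = beta by rewrite /beta; field.
  rewrite ler_wpM2r ?gauss_ge0// ler_expR ler_wpM2l//.
  rewrite -[leLHS]real_normK ?num_real// ler_pXn2r ?nnegrE//.
  rewrite normrM -[leRHS]mul1r ler_pM// ler_norml; lra.
have pi0 := pi_gt0 R.
rewrite /dT normrM (ger0_norm (mulr_ge0 (ltW r0) T0)) !normrM (ger0_norm (_ : 0 <= 2))//.
rewrite (ger0_norm (ltW pi0)) -/u.
apply: (@le_trans _ _ (n%:R * (overlap l0 * gauss (alpha / 2) u) * (2 * pi * X * `|u|))).
  apply: ler_pM => //.
  - by rewrite mulr_ge0// ltW.
  - by rewrite !mulr_ge0// ltW.
  - apply: (@le_trans _ _ (T l x k)); first by rewrite ler_piMl.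
    by rewrite (le_trans T1)// ler_wpM2l// ler_wpM2r ?gauss_ge0.
  - by rewrite ler_wpM2r// ler_wpM2l// mulr_ge0// ltW.
have a20 : 0 < alpha / 2 by rewrite divr_gt0.
set e1 := expR _ in gu *; set A := gauss _ u; set B := gauss _ u0 in gu *.
pose K := 1 + 2 / (alpha / 2).
have K0 : 0 <= K by rewrite addr_ge0// divr_ge0// ltW.
have h : `|u| * A <= K * (e1 * B).
  by apply: le_trans (normM_gauss_le u a20) _; rewrite ler_wpM2l.
have c0 : 0 <= n%:R * overlap l0 * (2 * pi * X) by rewrite !mulr_ge0// ltW.
have := ler_wpM2l c0 h; rewrite /Cd -/e1 -/K.
have -> : n%:R * overlap l0 * (2 * pi * X) * (`|u| * A) =
  n%:R * (overlap l0 * A) * (2 * pi * X * `|u|) by ring.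
by have -> : n%:R * overlap l0 * (2 * pi * X) * (K * (e1 * B)) =
  n%:R * (2 * pi * X * K) * e1 * overlap l0 * B; [ring|].
Qed.

Let lipschitz_bound l0 l x : 0 <= l0 -> l0 <= l <= l0 + 1 ->
  `|profile_error l x - profile_error l0 x| <= Cd * overlap l0 * (l - l0) * G l0 x.
Proof.
move=> l00 /andP[l0l ll0].
have [c /andP[l0c cl] ->] := MVT_is_derive l0l (fun l => is_derive_error l x).
rewrite normrM (ger0_norm (_ : 0 <= l - l0)) ?subr_ge0//.
rewrite [leRHS]mulrAC ler_wpM2r ?subr_ge0//; apply: derive_bound => //.
by rewrite l0c (le_trans cl).
Qed.

Let measurable_bump l k : measurable_fun setT (fun x => bump l x k).
Proof.
by apply: (measurableT_comp (measurable_gauss pi)); exact: measurable_funB.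
Qed.

Lemma measurable_profile l : measurable_fun setT (profile l).
Proof.
apply: (measurableT_comp (measurable_powR r)).
by apply: measurable_sum => k; exact: measurable_bump.
Qed.

Let measurable_error l : measurable_fun setT (profile_error l).
Proof.
apply: measurable_funB; first exact: measurable_profile.
apply: measurable_sum => k.
by apply: (measurableT_comp (measurable_powR r)); exact: measurable_bump.
Qed.

Let I := Num.sqrt (pi / beta).

Let integrable_shift a c : 0 < a -> L1 (fun x => gauss a (x - c)).
Proof.
move=> a0; have := integrable_affine (- c) (oner_neq0 R) (integrable_gauss a0).
by apply: eq_integrable => // x _ /=; rewrite mul1r.
Qed.

Let G_int l : L1 (G l).
Proof. by apply: integrable_EFin_sum => k; exact: integrable_shift. Qed.

Let RG l : \int[mu]_x G l x = n%:R * I.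
Proof.
rewrite Rintegral_sum; last by move=> k; exact: integrable_shift.
rewrite (eq_bigr (fun=> I)); first by rewrite sumr_const card_ord mulr_natl.
move=> k _; rewrite /I -Rintegral_gauss//.
rewrite [in RHS](Rintegral_affine (- (l * xs k)) (oner_neq0 R) (integrable_gauss beta_gt0)).
by rewrite normr1 mul1r; apply: eq_Rintegral => x _; rewrite mul1r.
Qed.

Let G_sqr l x : G l x ^+ 2 <= n%:R * G l x.
Proof.
rewrite expr2 ler_wpM2r//.
apply: (@le_trans _ _ (\sum_(k < n) 1)); last by rewrite sumr_const card_ord.
by apply: ler_sum => k _; rewrite gauss_le1// ltW.
Qed.

Let dominated_L2 (f : R -> R) (A : R) l : 0 <= A -> measurable_fun setT f ->
  (forall x, `|f x| <= A * G l x) ->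
  [/\ L1 f, L1 (fun x => f x ^+ 2), \int[mu]_x `|f x| <= A * (n%:R * I) &
    \int[mu]_x f x ^+ 2 <= A ^+ 2 * (n%:R ^+ 2 * I)].
Proof.
move=> A0 mf fG.
have AGi : L1 (fun x => A * G l x) by apply: integrable_EFinZl; exact: G_int.
have fi : L1 f by exact: integrable_dominated AGi.
have f2 x : f x ^+ 2 <= A ^+ 2 * n%:R * G l x.
  rewrite -mulrA -[leLHS]real_normK ?num_real//.
  apply: (@le_trans _ _ ((A * G l x) ^+ 2)).
    by rewrite ler_pXn2r ?nnegrE// mulr_ge0.
  by rewrite exprMn ler_wpM2l ?sqr_ge0.
have AG2i : L1 (fun x => A ^+ 2 * n%:R * G l x) by apply: integrable_EFinZl; exact: G_int.
have f2i : L1 (fun x => f x ^+ 2).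
  apply: (integrable_dominated _ _ AG2i); first exact: measurable_funX.
  by move=> x; rewrite ger0_norm ?sqr_ge0.
split => //.
  rewrite -(RG l) -RintegralZl//; apply: le_Rintegral => //.
  exact: (integrable_norm fi).
apply: (@le_trans _ _ (\int[mu]_x (A ^+ 2 * n%:R * G l x))); first exact: le_Rintegral.
by rewrite RintegralZl// RG le_eqVlt; apply/orP; left; apply/eqP; ring.
Qed.

(** The L1 bound will bound the transform of the error uniformly; the L2 bounds are the input of
    [bessel]. The constant does not depend on [l]. *)
Lemma profile_error_L2 : exists2 C : R, 0 < C & forall l, 0 <= l ->
  [/\ L1 (profile_error l), L1 (fun x => profile_error l x ^+ 2),
    \int[mu]_x `|profile_error l x| <= C,
    \int[mu]_x profile_error l x ^+ 2 <= C * overlap l ^+ 2 &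
    forall l', l <= l' <= l + 1 ->
    [/\ L1 (fun x => profile_error l' x - profile_error l x),
      L1 (fun x => (profile_error l' x - profile_error l x) ^+ 2) &
      \int[mu]_x (profile_error l' x - profile_error l x) ^+ 2 <=
        C * (l' - l) ^+ 2 * overlap l ^+ 2]].
Proof.
have I0 : 0 <= I by exact: sqrtr_ge0.
have Cd0 (k : 'I_n) : 0 <= Cd.
  have X0 := X_ge0 k; have pi0 := pi_gt0 R.
  rewrite mulr_ge0 ?expR_ge0// mulr_ge0// mulr_ge0//; first by rewrite mulr_ge0// mulr_ge0// ltW.
  by rewrite addr_ge0// divr_ge0// divr_ge0// ltW.
pose c1 : R := n%:R * (n%:R * I); pose c2 : R := n%:R ^+ 2 * (n%:R ^+ 2 * I).
pose c3 : R := Cd ^+ 2 * (n%:R ^+ 2 * I).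
have c10 : 0 <= c1 by rewrite mulr_ge0// mulr_ge0.
have c20 : 0 <= c2 by rewrite mulr_ge0 ?exprn_ge0// mulr_ge0 ?exprn_ge0.
have c30 : 0 <= c3 by rewrite mulr_ge0 ?sqr_ge0// mulr_ge0 ?exprn_ge0.
have [C [C0 c1C c2C c3C]] := common_bound c10 c20 c30.
exists C => // l l0.
have o0 : 0 <= overlap l by [].
have o1 : overlap l <= 1.
  by rewrite gauss_le1// divr_ge0// mulr_ge0 ?sqr_ge0// ltW.
have no0 : 0 <= n%:R * overlap l by rewrite mulr_ge0.
have [i1 i2 b1 b2] := dominated_L2 no0 (measurable_error l) (error_bound l).
split => //.
- apply: le_trans b1 _; apply: (@le_trans _ _ c1) => //.
  by rewrite /c1 ler_wpM2r ?mulr_ge0// ler_piMr.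
- apply: le_trans b2 _.
  have -> : (n%:R * overlap l) ^+ 2 * (n%:R ^+ 2 * I) = c2 * overlap l ^+ 2 by rewrite /c2; ring.
  by rewrite ler_wpM2r ?sqr_ge0.
move=> l' ll'; have /andP[ll1 _] := ll'.
have mD : measurable_fun setT (fun x => profile_error l' x - profile_error l x).
  by apply: measurable_funB; exact: measurable_error.
have [k0|k0] := pselect ('I_n -> False).
  have e0 l1 x : profile_error l1 x = 0 by rewrite error_sum big1 ?oppr0// => k; case: (k0 k).
  have d0 x : `|profile_error l' x - profile_error l x| <= 0 * G l x.
    by rewrite !e0 subrr normr0 mul0r.
  have [j1 j2 _ d2] := dominated_L2 (lexx 0) mD d0.
  split => //; apply: le_trans d2 _; rewrite expr0n/= mul0r.
  by apply: mulr_ge0 => //; apply: mulr_ge0 => //; rewrite ?sqr_ge0// ltW.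
have [k _] : exists k : 'I_n, True by apply: contrapT => h; apply: k0 => k; apply: h; exists k.
have A0 : 0 <= Cd * overlap l * (l' - l) by apply: mulr_ge0; [apply: mulr_ge0 => //; exact: (Cd0 k)|rewrite subr_ge0].
have [j1 j2 _ d2] := dominated_L2 A0 mD (fun x => lipschitz_bound x l0 ll').
split => //; apply: le_trans d2 _.
have -> : (Cd * overlap l * (l' - l)) ^+ 2 * (n%:R ^+ 2 * I) =
  c3 * (l' - l) ^+ 2 * overlap l ^+ 2 by rewrite /c3; ring.
by rewrite ler_wpM2r ?sqr_ge0// ler_wpM2r ?sqr_ge0.
Qed.

End profile.

(** * Uniform approximation by cosine polynomials *)

Section bernstein.
Context {R : realType}.
Implicit Types (phi psi : nat -> R) (x : R).

(* the expectation of [phi] under the binomial law of parameters [n] and [x] *)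
Fixpoint bernstein n phi x : R :=
  if n is n'.+1 then x * bernstein n' (fun k => phi k.+1) x +
    (1 - x) * bernstein n' phi x
  else phi 0%N.

Lemma bernsteinD n phi psi x :
  bernstein n (fun k => phi k + psi k) x = bernstein n phi x + bernstein n psi x.
Proof.
elim: n phi psi => [//|n IH] phi psi /=.
by rewrite (IH (fun k => phi k.+1)) IH; ring.
Qed.

Lemma bernsteinZ n a phi x :
  bernstein n (fun k => a * phi k) x = a * bernstein n phi x.
Proof.
elim: n phi => [//|n IH] phi /=.
by rewrite (IH (fun k => phi k.+1)) IH; ring.
Qed.

Lemma bernstein_cst n a x : bernstein n (fun=> a) x = a.
Proof. by elim: n => [//|n IH] /=; rewrite IH; ring. Qed.

Lemma le_bernstein n phi psi x : 0 <= x <= 1 ->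
  (forall k, (k <= n)%N -> phi k <= psi k) -> bernstein n phi x <= bernstein n psi x.
Proof.
move=> /andP[x0 x1]; elim: n phi psi => [|n IH] phi psi le /=; first exact: le.
rewrite lerD// ler_wpM2l ?subr_ge0//; apply: IH => k kn; apply: le => //.
exact: leqW.
Qed.

(** Squared bias plus variance of the binomial law. The centre [c] is kept general because the
    recursion replaces it by [c - 1]. *)
Lemma bernstein_sqr n c x : bernstein n (fun k => (k%:R - c) ^+ 2) x =
  (n%:R * x - c) ^+ 2 + n%:R * (x * (1 - x)).
Proof.
elim: n c => [|n IH] c /=; first by rewrite !mul0r addr0.
rewrite IH; have -> : (fun k : nat => (k.+1%:R - c) ^+ 2) = (fun k : nat => (k%:R - (c - 1)) ^+ 2).
  by apply/funext => k; rewrite -natr1; congr (_ ^+ 2); ring.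
by rewrite IH -natr1; ring.
Qed.

(** Bernstein's proof of the Weierstrass theorem. The inequality |u| <= (h + u^2 / h) / 2 takes the
    place of the usual splitting into near and far [k], and the variance bounds the mean of u^2.
    With h = e / L and N >= L^2 / e^2, each of the two terms is at most e / 2. *)
Lemma bernstein_approx (f : R -> R) (L e : R) : 0 < L -> 0 < e ->
  (forall x y, 0 <= x <= 1 -> 0 <= y <= 1 -> `|f x - f y| <= L * `|x - y|) ->
  exists n phi, forall x, 0 <= x <= 1 -> `|bernstein n phi x - f x| <= e.
Proof.
move=> L0 e0 fL; pose N := (Num.trunc (L ^+ 2 / e ^+ 2)).+1.
have Nge : L ^+ 2 / e ^+ 2 <= N%:R.
  by apply/ltW/truncnS_gt.
have N0 : 0 < N%:R :> R by rewrite ltr0n.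
exists N, (fun k => f (k%:R / N%:R)) => x x01.
have -> : bernstein N (fun k => f (k%:R / N%:R)) x - f x =
    bernstein N (fun k => f (k%:R / N%:R) + - f x) x.
  by rewrite bernsteinD bernstein_cst.
pose h := e / L.
have h0 : 0 < h by rewrite divr_gt0.
pose psi (k : nat) := L / 2 * h + L / (2 * h * N%:R ^+ 2) * (k%:R - N%:R * x) ^+ 2.
have psib k : (k <= N)%N -> `|f (k%:R / N%:R) + - f x| <= psi k.
  move=> kN; have kN01 : 0 <= (k%:R / N%:R : R) <= 1.
    by rewrite divr_ge0//= ler_pdivrMr// mul1r ler_nat.
  apply: le_trans (fL _ _ kN01 x01) _.
  set u : R := k%:R / N%:R - x.
  have -> : psi k = L * ((h + `|u| ^+ 2 / h) / 2).
    rewrite real_normK ?num_real// /psi /u; field.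
    by rewrite !gt_eqF.
  rewrite ler_wpM2l ?(ltW L0)// ler_pdivlMr// -subr_ge0.
  have -> : h + `|u| ^+ 2 / h - `|u| * 2 = (`|u| - h) ^+ 2 / h by field; rewrite gt_eqF.
  by rewrite divr_ge0 ?sqr_ge0 ?ltW.
have psiE : bernstein N psi x <= e.
  rewrite /psi bernsteinD bernstein_cst bernsteinZ bernstein_sqr subrr expr0n/= add0r.
  have xx : x * (1 - x) <= 1 by have /andP[? ?] := x01; nra.
  have : L / (2 * h * N%:R ^+ 2) * (N%:R * (x * (1 - x))) <= L / (2 * h * N%:R).
    have -> : L / (2 * h * N%:R ^+ 2) * (N%:R * (x * (1 - x))) = L / (2 * h * N%:R) * (x * (1 - x)).
      by field; rewrite !gt_eqF.
    by rewrite ler_piMr// divr_ge0 ?ltW// mulr_gt0// mulr_gt0.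
  have : L / (2 * h * N%:R) <= e / 2.
    have -> : L / (2 * h * N%:R) = L ^+ 2 / (2 * e * N%:R) by rewrite /h; field; rewrite !gt_eqF.
    rewrite ler_pdivrMr; last by rewrite !mulr_gt0.
    have -> : e / 2 * (2 * e * N%:R) = N%:R * e ^+ 2 by field.
    by rewrite -ler_pdivrMr// exprn_gt0.
  have -> : L / 2 * h = e / 2 by rewrite /h; field; rewrite gt_eqF.
  lra.
rewrite ler_norml; apply/andP; split.
  rewrite lerNl -mulN1r -bernsteinZ; apply: le_trans psiE.
  apply: le_bernstein => // k kN; rewrite mulN1r (le_trans _ (psib _ kN))//.
  by rewrite -normrN ler_norm.
apply: le_trans psiE; apply: le_bernstein => // k kN.
by rewrite (le_trans _ (psib _ kN))// ler_norm.
Qed.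

End bernstein.

Section cosine_polynomials.
Context {R : realType}.
Implicit Types (f g : R -> R) (x : R).

Definition cosw (k : nat) (x : R) : R := cos (2 * pi * k%:R * x).

Definition cospoly f := exists N (c : nat -> R),
  forall x, f x = \sum_(k < N) c k * cosw k x.

Lemma cosw0 x : cosw 0 x = 1. Proof. by rewrite /cosw mulr0 mul0r cos0. Qed.

Lemma coswM_nat (k m : nat) x : cosw k (m%:R * x) = cosw (k * m) x.
Proof. by rewrite /cosw natrM; congr cos; ring. Qed.

Lemma coswM (j k : nat) x : (k <= j)%N ->
  cosw j x * cosw k x = 2^-1 * (cosw (j + k) x + cosw (j - k) x).
Proof.
move=> kj; rewrite /cosw natrD natrB//.
have -> : 2 * pi * (j%:R + k%:R) * x = 2 * pi * j%:R * x + 2 * pi * k%:R * x by ring.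
have -> : 2 * pi * (j%:R - k%:R) * x = 2 * pi * j%:R * x - 2 * pi * k%:R * x by ring.
by rewrite cosD cosB; field.
Qed.

Lemma cosw_max k x : `|cosw k x| <= 1. Proof. exact: cos_max. Qed.

(** Lengthens the sum so that a prescribed frequency has its place among the coefficients. *)
Lemma cospoly_pad f N0 : cospoly f -> exists N (c : nat -> R), (N0 <= N)%N /\
  forall x, f x = \sum_(k < N) c k * cosw k x.
Proof.
move=> [N [c fE]]; exists (N0 + N)%N, (fun k => if (k < N)%N then c k else 0).
split; first exact: leq_addr.
move=> x; rewrite fE addnC big_split_ord/= [X in _ + X]big1 ?addr0.
  by apply: eq_bigr => k _; rewrite ltn_ord.
by move=> k _; rewrite ltnNge leq_addr mul0r.
Qed.

Lemma cospolyD f g : cospoly f -> cospoly g -> cospoly (fun x => f x + g x).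
Proof.
move=> [N [c fE]] [M [d gE]].
have pad (n m : nat) (a : nat -> R) x : \sum_(k < n) a k * cosw k x =
    \sum_(k < n + m) (if (k < n)%N then a k else 0) * cosw k x.
  rewrite big_split_ord/= [X in _ = _ + X]big1 ?addr0.
    by apply: eq_bigr => k _; rewrite ltn_ord.
  by move=> k _; rewrite ltnNge leq_addr mul0r.
exists (N + M)%N, (fun k => (if (k < N)%N then c k else 0) + (if (k < M)%N then d k else 0)).
move=> x; rewrite fE gE (pad N M) (pad M N) (addnC M N) -big_split/=.
by apply: eq_bigr => k _; rewrite mulrDl.
Qed.

Lemma cospolyZ a f : cospoly f -> cospoly (fun x => a * f x).
Proof.
move=> [N [c fE]]; exists N, (fun k => a * c k) => x.
by rewrite fE mulr_sumr; apply: eq_bigr => k _; rewrite mulrA.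
Qed.

Lemma cospoly_cosw k : cospoly (cosw k).
Proof.
exists k.+1, (fun j => (j == k)%:R) => x.
rewrite big_ord_recr/= eqxx mul1r big1 ?add0r// => j _.
by rewrite ltn_eqF ?mul0r.
Qed.

Lemma cospoly_sum N (F : 'I_N -> R -> R) : (forall k, cospoly (F k)) ->
  cospoly (fun x => \sum_(k < N) F k x).
Proof.
elim: N F => [|N IH] F cF.
  by exists 0%N, (fun=> 0) => x; rewrite !big_ord0.
have := cospolyD (cF ord0) (IH _ (fun k => cF (lift ord0 k))).
by congr cospoly; apply/funext => x; rewrite big_ord_recl.
Qed.

Lemma cospoly_cst a : cospoly (fun=> a).
Proof.
have := cospolyZ a (cospoly_cosw 0); congr cospoly; apply/funext => x.
by rewrite cosw0 mulr1.
Qed.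

Lemma cospolyM f g : cospoly f -> cospoly g -> cospoly (fun x => f x * g x).
Proof.
move=> [N [c fE]] [M [d gE]].
have cc j k : cospoly (fun x => cosw j x * cosw k x).
  wlog kj : j k / (k <= j)%N.
    move=> H; have [kj|/ltnW jk] := leqP k j; first exact: H.
    by under eq_fun do rewrite mulrC; exact: H.
  under eq_fun do rewrite coswM//.
  by apply: cospolyZ; apply: cospolyD; exact: cospoly_cosw.
have -> : (fun x => f x * g x) = fun x => \sum_(j < N) \sum_(k < M) (c j * d k) * (cosw j x * cosw k x).
  apply/funext => x; rewrite fE gE big_distrlr/=; apply: eq_bigr => j _.
  by apply: eq_bigr => k _; ring.
apply: cospoly_sum => j; apply: cospoly_sum => k; exact: cospolyZ.
Qed.

Lemma cospoly_dilate f (m : nat) : cospoly f -> cospoly (fun x => f (m%:R * x)).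
Proof.
move=> [N [c fE]]; under eq_fun do rewrite fE.
apply: cospoly_sum => k; under eq_fun do rewrite coswM_nat.
by apply: cospolyZ; exact: cospoly_cosw.
Qed.

Lemma cospoly_bernstein n phi f : cospoly f -> cospoly (fun x => bernstein n phi (f x)).
Proof.
move=> cf; elim: n phi => [|n IH] phi /=; first exact: cospoly_cst.
apply: cospolyD; first exact: cospolyM.
apply: cospolyM => //; under eq_fun do rewrite -mulN1r.
by apply: cospolyD; [exact: cospoly_cst|exact: cospolyZ].
Qed.

Lemma continuous_cosw k : continuous (cosw k).
Proof.
move=> x; have d : is_derive x (1:R) (cosw k) (- sin (2 * pi * k%:R * x) * (2 * pi * k%:R)).
  by rewrite /cosw; derive_by; ring.
exact: is_derive_continuous d.
Qed.

Lemma continuous_sum_fun n (F : 'I_n -> R -> R) : (forall k, continuous (F k)) ->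
  continuous (fun x => \sum_(k < n) F k x).
Proof.
elim: n F => [|n IH] F cF x.
  by under eq_fun do rewrite big_ord0; exact: cvg_cst.
under eq_fun do rewrite big_ord_recl.
by apply: continuousD; [exact: cF|apply: IH => k; exact: cF].
Qed.

Lemma cospoly_continuous f : cospoly f -> continuous f.
Proof.
move=> [N [c fE]].
have -> : f = fun x => \sum_(k < N) c k * cosw k x by apply/funext.
apply: continuous_sum_fun => k x.
by apply: continuousM; [exact: cst_continuous|exact: continuous_cosw].
Qed.

(** Bounded uniform limits of cosine polynomials. The class is stable under products and integer
    dilations and stands in for the convergence of Fourier series. *)
Definition cos_approx f := [/\ continuous f, exists B, forall x, `|f x| <= B &
  forall e, 0 < e -> exists2 g, cospoly g & forall x, `|f x - g x| <= e].

Lemma cos_approxM f g : cos_approx f -> cos_approx g ->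
  cos_approx (fun x => f x * g x).
Proof.
move=> [cf [B fB] fa] [cg [C gC] ga]; split.
- by move=> x; apply: continuousM; [exact: cf|exact: cg].
- exists (B * C) => x; rewrite normrM.
  by apply: ler_pM => //.
move=> e e0.
have B0 : 0 <= B by exact: le_trans (fB 0).
have C0 : 0 <= C by exact: le_trans (gC 0).
pose d := Num.min 1 (e / (B + C + 1)).
have bc0 : 0 < B + C + 1 by rewrite ltr_wpDl// addr_ge0.
have d0 : 0 < d by rewrite lt_min ltr01 divr_gt0.
have d1 : d <= 1 by rewrite ge_min lexx.
have de : d * (B + C + 1) <= e by rewrite -ler_pdivlMr// ge_min lexx orbT.
have [f' cf' ff'] := fa d d0; have [g' cg' gg'] := ga d d0.
exists (fun x => f' x * g' x); first exact: cospolyM.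
move=> x; have -> : f x * g x - f' x * g' x =
  (f x - f' x) * g x + f x * (g x - g' x) - (f x - f' x) * (g x - g' x) by ring.
have h1 : `|(f x - f' x) * g x| <= d * C by rewrite normrM ler_pM.
have h2 : `|f x * (g x - g' x)| <= B * d by rewrite normrM ler_pM.
have h3 : `|(f x - f' x) * (g x - g' x)| <= d * 1.
  by rewrite normrM ler_pM// (le_trans (gg' x)).
apply: le_trans (ler_normB _ _) _; apply: le_trans (lerD (ler_normD _ _) (lexx _)) _.
by apply: le_trans (lerD (lerD h1 h2) h3) _; apply: le_trans de; lra.
Qed.

Lemma cos_approx_dilate f (m : nat) : cos_approx f -> cos_approx (fun x => f (m%:R * x)).
Proof.
move=> [cf [B fB] fa]; split.
- move=> x; apply: (@continuous_comp _ _ _ (fun x => m%:R * x) f); last exact: cf.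
  by apply: continuousM; [exact: cst_continuous|exact: cvg_id].
- by exists B.
move=> e e0; have [g cg fg] := fa e e0.
by exists (fun x => g (m%:R * x)); first exact: cospoly_dilate.
Qed.

Definition cos_power (q x : R) := `|2 * cos (pi * x)| `^ q.

Lemma continuous_cos_power q : 2 < q -> continuous (cos_power q).
Proof.
move=> q2 x.
have d : is_derive x (1:R) (fun x => 2 * cos (pi * x)) (2 * (- sin (pi * x) * pi)) by derive_by; ring.
have d' := is_derive_fun_comp (g := fun x => 2 * cos (pi * x)) (is_derive_norm_powR (2 * cos (pi * x)) q2) d.
exact: is_derive_continuous d'.
Qed.

(** The function is 2^q y^(q/2) with y = cos(pi x)^2 = (1 + cos(2 pi x)) / 2. As q / 2 > 1, the
    power is Lipschitz on [0, 1] with constant q / 2, and a Bernstein polynomial in y is again a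
    cosine polynomial. *)
Lemma cos_approx_cos_power q : 2 < q -> cos_approx (cos_power q).
Proof.
move=> q2; split; first exact: continuous_cos_power.
  exists (2 `^ q) => x; rewrite ger0_norm ?powR_ge0//.
  apply: ge0_ler_powR; rewrite ?nnegrE//; first lra.
  by rewrite normrM ger0_norm// ler_piMr// cos_max.
move=> e e0; pose a := q / 2; pose C := 2 `^ q.
have C0 : 0 < C by exact: powR_gt0.
have a1 : 0 < a - 1 by rewrite /a; lra.
have [|||n [phi H]] := @bernstein_approx R (fun y => y `^ a) a (e / C).
- by rewrite /a; lra.
- exact: divr_gt0.
- move=> x y /andP[x0 x1] /andP[y0 y1].
  have xb : `|x| <= 1 by rewrite ger0_norm.
  have yb : `|y| <= 1 by rewrite ger0_norm.
  have := norm_powRM_lipschitz a1 xb yb.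
  have a0 : 0 < a by rewrite /a; lra.
  by rewrite powR1 mulr1 subrK (ger0_norm x0) (ger0_norm y0) (mulrC _ x) (mulrC _ y) !mulr_powRB1.
exists (fun x => C * bernstein n phi (2^-1 * (1 + cosw 1 x))).
  apply: cospolyZ; apply: cospoly_bernstein; apply: cospolyZ.
  by apply: cospolyD; [exact: cospoly_cst|exact: cospoly_cosw].
move=> x; have cE : 2^-1 * (1 + cosw 1 x) = cos (pi * x) ^+ 2.
  have -> : cosw 1 x = cos (pi * x *+ 2) by rewrite /cosw mulr2n; congr cos; ring.
  by rewrite cos_mulr2n mulr2n; field.
have c01 : 0 <= cos (pi * x) ^+ 2 <= 1.
  by rewrite sqr_ge0/= -real_normK ?num_real// expr_le1// cos_max.
have -> : cos_power q x = C * (cos (pi * x) ^+ 2) `^ a.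
  rewrite /cos_power normrM powRM// (ger0_norm (_ : 0 <= 2))//.
  rewrite -(real_normK (num_real (cos _))) -powR_mulrn// -powRrM /a.
  by congr (_ * _ `^ _); field.
rewrite cE -mulrBr normrM (gtr0_norm C0) mulrC -ler_pdivlMr// distrC.
exact: H.
Qed.

End cosine_polynomials.

(** * Fourier coefficients of powers of the cosine *)

Section period.
Context {R : realType}.
Notation mu := (@lebesgue_measure R).
Implicit Types f g : R -> R.

(** The ends of this period are zeros of cos(pi x), which removes the boundary terms in
    [cos_power_coefS]. *)
Let I : set R := `[(- 2^-1), 2^-1]%classic.

Definition period_mean f : R := \int[mu]_(x in I) f x.

Let muI : mu I = 1%E.
Proof.
rewrite /I lebesgue_measure_itv/= lte_fin.
have -> : (- 2^-1 < 2^-1 :> R) by lra.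
by rewrite -EFinB opprK -[X in X + _]mul1r -[X in _ + X]mul1r -splitr.
Qed.

Let mI : measurable I. Proof. exact: measurable_itv. Qed.

Lemma period_integrable f : continuous f -> mu.-integrable I (EFin \o f).
Proof.
move=> cf; apply: continuous_compact_integrable; first exact: segment_compact.
exact: continuous_subspaceT.
Qed.

Lemma period_meanD f g : continuous f -> continuous g ->
  period_mean (fun x => f x + g x) = period_mean f + period_mean g.
Proof. by move=> cf cg; apply: RintegralD => //; exact: period_integrable. Qed.

Lemma period_meanZ a f : continuous f ->
  period_mean (fun x => a * f x) = a * period_mean f.
Proof. by move=> cf; apply: RintegralZl => //; exact: period_integrable. Qed.

Lemma eq_period_mean f g : f =1 g -> period_mean f = period_mean g.
Proof. by move=> fg; apply: eq_Rintegral => x _; exact: fg. Qed.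

Lemma period_mean_sum n (F : 'I_n -> R -> R) : (forall k, continuous (F k)) ->
  period_mean (fun x => \sum_(k < n) F k x) = \sum_(k < n) period_mean (F k).
Proof.
elim: n F => [|n IH] F cF.
  rewrite big_ord0 /period_mean; under eq_Rintegral do rewrite big_ord0.
  by rewrite Rintegral_cst// mul0r.
rewrite big_ord_recl -IH//; rewrite -period_meanD//; last exact: continuous_sum_fun.
by apply: eq_period_mean => x; rewrite big_ord_recl.
Qed.

Lemma period_mean_cst a : period_mean (fun=> a) = a.
Proof. by rewrite /period_mean Rintegral_cst// [X in fine X](_ : _ = 1%E) ?mulr1//; exact: muI. Qed.

Lemma le_period_mean f g : continuous f -> continuous g ->
  (forall x, f x <= g x) -> period_mean f <= period_mean g.
Proof.
move=> cf cg fg; apply: le_Rintegral => //; exact: period_integrable.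
Qed.

Lemma period_mean_close f g B : continuous f -> continuous g ->
  (forall x, `|f x - g x| <= B) -> `|period_mean f - period_mean g| <= B.
Proof.
move=> cf cg fgB.
have cB b : continuous (fun x : R => g x + b).
  by move=> x; apply: continuousD; [exact: cg|exact: cst_continuous].
have cc (b : R) : continuous (fun _ : R => b) by move=> x; exact: cst_continuous.
have h b : period_mean (fun x => g x + b) = period_mean g + b.
  by rewrite period_meanD// period_mean_cst.
rewrite ler_norml; apply/andP; split.
  rewrite lerBrDl -h; apply: le_period_mean => // x.
  by have := fgB x; rewrite ler_norml => /andP[+ _]; lra.
rewrite lerBlDl -h; apply: le_period_mean => // x.
by have := fgB x; rewrite ler_norml => /andP[_]; lra.
Qed.

Lemma period_mean_derive F f : (forall x, is_derive x (1:R) F (f x)) -> continuous f ->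
  period_mean f = F 2^-1 - F (- 2^-1).
Proof.
move=> dF cf; rewrite /period_mean /Rintegral.
rewrite (@continuous_FTC2 R f F)//.
- lra.
- exact: continuous_subspaceT.
- split => [x _||].
  + exact: (@ex_derive _ _ _ _ _ _ _ (dF x)).
  + by apply: cvg_at_right_filter; exact: (is_derive_continuous (dF _)).
  + by apply: cvg_at_left_filter; exact: (is_derive_continuous (dF _)).
- by move=> x _; rewrite derive1E; exact: (@derive_val _ _ _ _ _ _ _ (dF x)).
Qed.

Lemma period_mean_cosw k : period_mean (cosw k) = (k == 0%N)%:R.
Proof.
have [->|k0] := eqVneq k 0%N.
  by rewrite -[RHS](period_mean_cst 1); apply: eq_period_mean => x; rewrite cosw0.
have pk0 : 2 * pi * k%:R != 0 :> R.
  by rewrite mulf_neq0 ?pnatr_eq0// mulf_neq0// gt_eqF// pi_gt0.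
pose F x : R := (2 * pi * k%:R)^-1 * sin (2 * pi * k%:R * x).
have dF x : is_derive x (1:R) F (cosw k x).
  rewrite /F /cosw; move: (2 * pi * k%:R) pk0 => c c0.
  by derive_by; field.
rewrite (period_mean_derive dF); last exact: continuous_cosw.
rewrite /F -mulrBr.
have E (P K : R) : 2 * P * K * 2^-1 = 2 * P * K * (- 2^-1) + K * (2 * P) by field.
have e2 : k%:R * (2 * pi) = (pi *+ 2) *+ k :> R by rewrite mulr_natl -(mulr_natl pi 2).
rewrite E e2.
by rewrite (periodicn (@sinD2pi R)) subrr mulr0.
Qed.

Lemma continuous_coswM j k : continuous (fun x : R => cosw j x * cosw k x).
Proof. by move=> x; apply: continuousM; exact: continuous_cosw. Qed.

Let continuous_coswMD j k j' k' :
  continuous (fun x : R => cosw j x * cosw k x + cosw j' x * cosw k' x).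
Proof. by move=> x; apply: cvgD; exact: continuous_coswM. Qed.

Lemma period_mean_coswM j k : (0 < k)%N ->
  period_mean (fun x => cosw j x * cosw k x) = 2^-1 * (j == k)%:R.
Proof.
move=> k0; have cs n : continuous (@cosw R n) by exact: continuous_cosw.
have cM n n' : continuous (fun x : R => cosw n x + cosw n' x).
  by move=> x; apply: continuousD; exact: cs.
have [kj|jk] := leqP k j.
  rewrite (@eq_period_mean _ (fun x => 2^-1 * (cosw (j + k) x + cosw (j - k) x))); last first.
    by move=> x; rewrite coswM.
  rewrite period_meanZ// period_meanD// !period_mean_cosw subn_eq0.
  have -> : (j + k == 0)%N = false by lia.
  by rewrite add0r; congr (_ * _%:R); lia.
rewrite (@eq_period_mean _ (fun x => 2^-1 * (cosw (k + j) x + cosw (k - j) x))); last first.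
  by move=> x; rewrite mulrC coswM// ltnW.
rewrite period_meanZ// period_meanD// !period_mean_cosw subn_eq0.
have -> : (k + j == 0)%N = false by lia.
by rewrite add0r; congr (_ * _%:R); lia.
Qed.

(** The product of the first two factors has the frequencies [j + k] and |j - k|, tested against 1.
    Excluded is the pair of frequencies 0 and 1, for which the mean is 1/2. *)
Lemma period_mean_coswMM j k : (j + k != 1)%N ->
  period_mean (fun x => cosw j x * cosw k x * cosw 1 x) =
  4^-1 * ((j == k.+1) || (k == j.+1))%:R.
Proof.
wlog kj : j k / (k <= j)%N.
  move=> H jk1; have [kj|/ltnW jk] := leqP k j; first exact: H.
  rewrite orbC -H//; last by rewrite addnC.
  by apply: eq_period_mean => x; rewrite (mulrC (cosw j x)).
move=> jk1.
rewrite (@eq_period_mean _ (fun x => 2^-1 * (cosw (j + k) x * cosw 1 x + cosw (j - k) x * cosw 1 x))); last first.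
  by move=> x; rewrite coswM//; ring.
rewrite period_meanZ; last exact: continuous_coswMD.
rewrite period_meanD; [|exact: continuous_coswM..].
rewrite !period_mean_coswM// (negbTE jk1) mulr0 add0r mulrA.
have -> : 2^-1 * 2^-1 = 4^-1 :> R by field.
by congr (_ * _%:R); lia.
Qed.

End period.

Section cos_power_coefficients.
Context {R : realType}.
Variable q : R.
Hypothesis q2 : 2 < q.

Definition cos_power_coef j : R := period_mean (fun x => cos_power q x * cosw j x).

Let cV : continuous (cos_power q). Proof. exact: continuous_cos_power. Qed.

Let cVw j : continuous (fun x => cos_power q x * cosw j x).
Proof. by move=> x; apply: continuousM; [exact: cV|exact: continuous_cosw]. Qed.

Let cZ a j : continuous (fun x => a * (cos_power q x * cosw j x)).
Proof. by move=> x; apply: cvgM; [exact: cvg_cst|exact: cVw]. Qed.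

Let cZD a b j k : continuous (fun x => a * (cos_power q x * cosw j x) +
  b * (cos_power q x * cosw k x)).
Proof. by move=> x; apply: cvgD; exact: cZ. Qed.

Lemma cos_power_coefS j : (q + 2 * j%:R + 2) * cos_power_coef j.+1 =
  (q - 2 * j%:R) * cos_power_coef j.
Proof.
have q0 : 0 < q by have := q2; lra.
pose h (y : R) := `|y| `^ q * y.
pose c : R := 2 * j%:R + 1.
(* The frequency j + 1/2 lies midway between [j] and [j.+1], so the addition formulas turn the
   derivative of [F] into a combination of [cosw j] and [cosw j.+1]. The first factor vanishes at
   both ends of the period. *)
pose F (x : R) := h (2 * cos (pi * x)) * sin (pi * c * x).
pose f (x : R) := pi * ((2 * j%:R - q) * (cos_power q x * cosw j x) +
  (q + 2 * j%:R + 2) * (cos_power q x * cosw j.+1 x)).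
have dF x : is_derive x (1:R) F (f x).
  have d1 : is_derive x (1:R) (fun x => 2 * cos (pi * x)) (2 * (- sin (pi * x) * pi)).
    by derive_by; ring.
  have d2 : is_derive x (1:R) (fun x => sin (pi * c * x)) (cos (pi * c * x) * (pi * c)).
    by derive_by; ring.
  have dh := is_derive_fun_comp (g := fun x => 2 * cos (pi * x)) (is_derive_norm_powRM (2 * cos (pi * x)) q0) d1.
  apply: is_derive_val (is_derive_funM dh d2) _.
  rewrite /f /cos_power /cosw.
  have -> : 2 * pi * j%:R * x = pi * c * x - pi * x by rewrite /c; ring.
  have -> : 2 * pi * j.+1%:R * x = pi * c * x + pi * x by rewrite /c -natr1; ring.
  by rewrite cosB cosD /c; ring.
have : period_mean f = 0.
  rewrite (period_mean_derive dF).
    rewrite /F mulrN cosN cos_pihalf mulr0 /h mulr0 !mul0r.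
    exact: subrr.
  by move=> x; apply: cvgM; [exact: cvg_cst|exact: cZD].
rewrite /f period_meanZ; last exact: cZD.
rewrite period_meanD; [|exact: cZ..].
rewrite !period_meanZ// -/(cos_power_coef j) -/(cos_power_coef j.+1) => /eqP.
rewrite mulf_eq0 gt_eqF ?pi_gt0//= => /eqP; lra.
Qed.

(** With y = |2 cos(pi x)|, the minorant 1 + 2 cos(2 pi x) = y^2 - 1 has mean 1. It lies below y^q
    when y >= 1 because q > 2, and it is negative when y < 1. *)
Lemma cos_power_coef0_gt0 : 0 < cos_power_coef 0.
Proof.
have -> : cos_power_coef 0 = period_mean (cos_power q).
  by apply: eq_period_mean => x; rewrite cosw0 mulr1.
apply: (@lt_le_trans _ _ (period_mean (fun x : R => 1 + 2 * cosw 1 x))).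
  have c1 : continuous (fun _ : R => 1 : R) by move=> x; exact: cst_continuous.
  have c2 : continuous (fun x : R => 2 * cosw 1 x).
    by move=> x; apply: cvgM; [exact: cvg_cst|exact: continuous_cosw].
  by rewrite period_meanD// period_meanZ ?period_mean_cosw ?period_mean_cst ?mulr0 ?addr0//; exact: continuous_cosw.
apply: le_period_mean => // x.
  by apply: cvgD; [exact: cvg_cst|apply: cvgM; [exact: cvg_cst|exact: continuous_cosw]].
have -> : 1 + 2 * cosw 1 x = `|2 * cos (pi * x)| ^+ 2 - 1.
  rewrite real_normK ?num_real//.
  have -> : cosw 1 x = cos (pi * x *+ 2) by rewrite /cosw mulr2n; congr cos; ring.
  by rewrite cos_mulr2n mulr2n; ring.
rewrite /cos_power; set y := `|_|; have y0 : 0 <= y by exact: normr_ge0.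
have [y1|y1] := leP 1 y.
  apply: (@le_trans _ _ (y `^ 2)); last by apply: ler_powR => //; exact: ltW.
  by rewrite powR_mulrn//; lra.
apply: le_trans (powR_ge0 _ _).
by rewrite subr_le0 expr_le1// ltW.
Qed.

(** By the recursion the coefficients stay positive as long as q - 2 j is positive. The first
    negative factor occurs at the least [j0] with q < 2 j0 and makes the coefficient of [j0.+1]
    negative; no factor vanishes before, as [q] is not an even integer. *)
Lemma cos_power_coef_neg : ~ (exists j : nat, q = 2 * j%:R) ->
  0 < cos_power_coef 1 /\ exists2 K, (1 < K)%N & cos_power_coef K < 0.
Proof.
move=> qodd.
have ex : exists j : nat, q < 2 * j%:R.
  exists (Num.trunc q).+1; apply: (lt_le_trans (truncnS_gt q)).
  by rewrite ler_peMl// ler1n.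
case: (ex_minnP ex) => j0 qj0 min_j0.
have pos j : (j <= j0)%N -> 0 < cos_power_coef j.
  elim: j => [|j IH] jj0; first exact: cos_power_coef0_gt0.
  have qj : 0 < q - 2 * j%:R.
    rewrite lt_neqAle eq_sym subr_eq0 subr_ge0; apply/andP; split.
      by apply/eqP => qE; apply: qodd; exists j.
    by rewrite leNgt; apply/negP => /min_j0; rewrite leqNgt jj0.
  have := cos_power_coefS j; have := mulr_gt0 qj (IH (ltnW jj0)) => + E.
  rewrite -E pmulr_rgt0//; have : 0 <= j%:R :> R by [].
  by have := q2; lra.
have j01 : (1 < j0)%N.
  rewrite ltnNge; apply/negP => j01; move: qj0.
  have : j0%:R <= 1%:R :> R by rewrite ler_nat.
  by have := q2; lra.
split; first by apply: pos; exact: ltnW.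
exists j0.+1; first exact: ltnW.
have := cos_power_coefS j0.
have : (q - 2 * j0%:R) * cos_power_coef j0 < 0 by rewrite nmulr_rlt0 ?pos// subr_lt0.
move=> + E; rewrite -E pmulr_rlt0//; have : 0 <= j0%:R :> R by [].
by have := q2; lra.
Qed.

End cos_power_coefficients.

(** * Fourier coefficients of products of dilated cosine polynomials *)

Section dilated_products.
Context {R : realType}.

(** Reduce modulo [m], where [K * m + 1] is 1. The first equation would make [k.+1] a multiple of
    [m], although 0 < k + 1 < m; the second forces [k = 1] and then [j = K]. *)
Let dilated_index m K j k : (j.+1 < m)%N -> (k.+1 < m)%N -> (0 < K)%N ->
  ((j * m == (k * (K * m + 1)).+1) || (k * (K * m + 1) == (j * m).+1))%N =
  ((k == 1) && (j == K))%N.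
Proof.
move=> jm km K0; apply/idP/idP; last by move=> /andP[/eqP -> /eqP ->]; lia.
have m1 : (1 < m)%N by lia.
have E : (k * (K * m + 1) = k * K * m + k)%N by lia.
rewrite E => /orP[] /eqP H.
  have : (j * m %% m = (k * K * m + k.+1) %% m)%N by rewrite H addnS.
  by rewrite modnMl modnMDl modn_small.
have H' : (k * K * m + k = j * m + 1)%N by rewrite H addn1.
have : ((k * K * m + k) %% m = (j * m + 1) %% m)%N by rewrite H'.
rewrite !modnMDl !modn_small//; last exact: ltnW.
move=> k1; move: H'; rewrite k1 mul1n => /eqP; rewrite eqn_add2r eqn_pmul2r; last by lia.
by move=> /eqP ->; rewrite !eqxx.
Qed.

Lemma cospoly_coef N (c : nat -> R) j : (0 < j < N)%N ->
  period_mean (fun x => (\sum_(k < N) c k * cosw k x) * cosw j x) = 2^-1 * c j.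
Proof.
move=> /andP[j0 jN].
rewrite (@eq_period_mean _ _ (fun x => \sum_(k < N) c k * (cosw k x * cosw j x))); last first.
  by move=> x; rewrite mulr_suml; apply: eq_bigr => k _; rewrite mulrA.
rewrite period_mean_sum; last first.
  by move=> k x; apply: cvgM; [exact: cvg_cst|exact: continuous_coswM].
rewrite (bigD1 (Ordinal jN))//= big1 => [|k kj].
  by rewrite addr0 period_meanZ ?period_mean_coswM ?eqxx ?mulr1 1?mulrC//; exact: continuous_coswM.
rewrite period_meanZ; last exact: continuous_coswM.
rewrite period_mean_coswM// (_ : (k == j :> nat) = false) ?mulr0//.
by apply: contraNF kj => /eqP kj; apply/eqP; exact: val_inj.
Qed.

(* Only the pair of frequencies (K m, m' = K m + 1) contributes to the frequency 1. *)
Lemma dilated_product_coef N (c : nat -> R) m K : (N < m)%N -> (1 < K < N)%N ->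
  let f x := \sum_(k < N) c k * cosw k x in
  period_mean (fun x => f (m%:R * x) * f ((K * m + 1)%:R * x) * cosw 1 x) =
  4^-1 * (c 1%N * c K).
Proof.
move=> Nm /andP[K1 KN] f; set m' := (K * m + 1)%N.
rewrite (@eq_period_mean _ _ (fun x => \sum_(j < N) \sum_(k < N)
    (c j * c k) * (cosw (j * m) x * cosw (k * m') x * cosw 1 x))); last first.
  move=> x; rewrite /f big_distrlr/= mulr_suml; apply: eq_bigr => j _.
  rewrite mulr_suml; apply: eq_bigr => k _.
  by rewrite !coswM_nat; ring.
have cc j k : continuous (fun x : R => cosw j x * cosw k x * cosw 1 x).
  by move=> x; apply: cvgM; [exact: continuous_coswM|exact: continuous_cosw].
have c1 (a : R) j k : continuous (fun x : R => a * (cosw j x * cosw k x * cosw 1 x)).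
  by move=> x; apply: cvgM; [exact: cvg_cst|exact: cc].
rewrite period_mean_sum; last by move=> j; apply: continuous_sum_fun => k; exact: c1.
rewrite (eq_bigr (fun j : 'I_N => \sum_(k < N) c j * c k *
    (4^-1 * ((k == 1 :> nat) && (j == K :> nat))%:R))); last first.
  move=> j _; rewrite period_mean_sum; last by move=> k; exact: c1.
  apply: eq_bigr => k _; rewrite period_meanZ; last exact: cc.
  rewrite period_mean_coswMM; last first.
    have m1 : (1 < m)%N by apply: ltn_trans Nm; exact: (ltn_trans K1 KN).
    have m1' : (1 < m')%N by rewrite /m' addn1 ltnS muln_gt0 (ltnW K1) (ltnW m1).
    case: (nat_of_ord j) => [|j'].
      case: (nat_of_ord k) => [//|k'].
      by rewrite mul0n add0n mulSn gtn_eqF// (leq_trans m1')// leq_addr.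
    by rewrite mulSn -addnA gtn_eqF// (leq_trans m1)// leq_addr.
  rewrite dilated_index//.
  - exact: leq_ltn_trans (ltn_ord j) Nm.
  - exact: leq_ltn_trans (ltn_ord k) Nm.
  - exact: ltnW.
have N1 : (1 < N)%N by exact: ltn_trans K1 KN.
rewrite (bigD1 (Ordinal KN))//= (bigD1 (Ordinal N1))//= !eqxx/=.
rewrite !big1 ?addr0; first by ring.
- move=> j jK; apply: big1 => k _; rewrite (_ : (j == K :> nat) = false) ?andbF ?mulr0//.
  by apply: contraNF jK => /eqP jK; apply/eqP; exact: val_inj.
- move=> k k1; rewrite (_ : (k == 1 :> nat) = false) ?mulr0//.
  by apply: contraNF k1 => /eqP k1; apply/eqP; exact: val_inj.
Qed.

End dilated_products.

Section negative_coefficient.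
Context {R : realType}.

Lemma exists_negative_coef (q : R) : 2 < q -> ~ (exists j : nat, q = 2 * j%:R) ->
  exists K m, [/\ (1 < K)%N, (5 < m)%N &
    period_mean (fun x => cos_power q (m%:R * x) * cos_power q ((K * m + 1)%:R * x) * cosw 1 x) < 0].
Proof.
move=> q2 qodd; have [B1 [K K1 BK]] := cos_power_coef_neg q2 qodd.
have Va := cos_approx_cos_power q2.
have [cV [S VS] appr] := Va.
have S0 : 0 <= S by exact: le_trans (VS 0).
set b1 := cos_power_coef q 1 in B1; set bK := cos_power_coef q K in BK.
(* The total error will be at most [e * T]: the part [b1 - bK + 1] comes from replacing the
   coefficients of the power by those of its approximant, the part [2 * S + 1] from replacing the
   product. The choice of [e] makes this at most half of |b1 bK|. *)
pose T := b1 - bK + 2 + 2 * S.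
have T0 : 0 < T by rewrite /T; lra.
pose e := Num.min 1 (- (b1 * bK) / (2 * T)).
have bb : 0 < - (b1 * bK) by rewrite oppr_gt0 pmulr_rlt0.
have e0 : 0 < e by rewrite lt_min ltr01 divr_gt0// mulr_gt0.
have e1 : e <= 1 by rewrite ge_min lexx.
have eT : e * T <= - (b1 * bK) / 2.
  have : e <= - (b1 * bK) / (2 * T) by rewrite ge_min lexx orbT.
  rewrite ler_pdivlMr ?mulr_gt0// ler_pdivlMr// => h; apply: le_trans h; lra.
have [v cv Vv] := appr e e0.
have [N [c [NK vE]]] := cospoly_pad K.+1 cv.
(* Exceeding the degree of the approximant keeps its dilated frequencies apart. The 6 provides
   [5 < m], by which the overlap of the bumps will decay fast enough. *)
pose m := (N + 6)%N.
exists K, m; split => //; first by rewrite /m addnC.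
have vb k (k0 : (0 < k < N)%N) : `|cos_power_coef q k - 2^-1 * c k| <= e.
  rewrite -(cospoly_coef c k0); apply: period_mean_close => [|| x].
  - by move=> x; apply: cvgM; [exact: cV|exact: continuous_cosw].
  - move=> x; apply: cvgM; last exact: continuous_cosw.
    apply: (@continuous_sum_fun R) => j y.
    by apply: continuousM; [exact: cst_continuous|exact: continuous_cosw].
  - rewrite -mulrBl normrM -vE -[e]mulr1; apply: ler_pM => //; exact: cosw_max.
have h1 := vb 1%N _; have {}h1 := h1 (ltn_trans K1 NK).
have hK : `|bK - 2^-1 * c K| <= e by apply: vb; rewrite NK ltnW.
pose W x := cos_power q (m%:R * x) * cos_power q ((K * m + 1)%:R * x).
pose w x := v (m%:R * x) * v ((K * m + 1)%:R * x).
have [cW _ _] : cos_approx W by apply: cos_approxM; exact: cos_approx_dilate.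
have cw : continuous w.
  by apply: cospoly_continuous; apply: cospolyM; exact: cospoly_dilate.
have close : `|period_mean (fun x => W x * cosw 1 x) - period_mean (fun x => w x * cosw 1 x)| <= e * (2 * S + 1).
  apply: period_mean_close => [||x].
  - by move=> x; apply: cvgM; [exact: cW|exact: continuous_cosw].
  - by move=> x; apply: cvgM; [exact: cw|exact: continuous_cosw].
  rewrite -mulrBl normrM -[leRHS]mulr1; apply: ler_pM => //; last exact: cosw_max.
  rewrite /W /w; set a := m%:R * x; set b := _ * x.
  have -> : cos_power q a * cos_power q b - v a * v b =
    (cos_power q a - v a) * cos_power q b + cos_power q a * (cos_power q b - v b) -
    (cos_power q a - v a) * (cos_power q b - v b) by ring.
  have g1 : `|(cos_power q a - v a) * cos_power q b| <= e * S by rewrite normrM ler_pM.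
  have g2 : `|cos_power q a * (cos_power q b - v b)| <= S * e by rewrite normrM ler_pM.
  have g3 : `|(cos_power q a - v a) * (cos_power q b - v b)| <= e * 1.
    by rewrite normrM ler_pM// (le_trans (Vv b)).
  apply: le_trans (ler_normB _ _) _; apply: le_trans (lerD (ler_normD _ _) (lexx _)) _.
  by apply: le_trans (lerD (lerD g1 g2) g3) _; lra.
have wE : period_mean (fun x => w x * cosw 1 x) = (2^-1 * c 1%N) * (2^-1 * c K).
  rewrite (_ : (2^-1 * c 1%N) * (2^-1 * c K) = 4^-1 * (c 1%N * c K)); last by field.
  have Nm : (N < m)%N by rewrite /m addnS ltnS leq_addr.
  rewrite -(dilated_product_coef c Nm (K := K)) ?K1//.
  by apply: eq_period_mean => x; rewrite /w !vE.
move: close; rewrite wE ler_norml => /andP[_ close].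
move: h1 hK; rewrite -/b1 !ler_norml.
set u1 := 2^-1 * c 1%N in close *; set uK := 2^-1 * c K in close *.
move=> /andP[h1a h1b] /andP[hKa hKb].
have key : u1 * uK <= b1 * bK + e * (b1 - bK + 1).
  have -> : u1 * uK = b1 * bK - b1 * (bK - uK) - bK * (b1 - u1) + (b1 - u1) * (bK - uK) by ring.
  have k1 : - (b1 * (bK - uK)) <= b1 * e by rewrite -mulrN ler_wpM2l ?(ltW B1)//; lra.
  have k2 : - (bK * (b1 - u1)) <= - bK * e by rewrite -mulNr ler_wpM2l//; lra.
  have k3 : (b1 - u1) * (bK - uK) <= e * 1.
    rewrite (le_trans (ler_norm _))// normrM ler_pM// ler_norml; lra.
  by lra.
have eTE : e * (b1 - bK + 1) + e * (2 * S + 1) = e * T by rewrite /T; ring.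
change (period_mean (fun x => W x * cosw 1 x) < 0).
lra.
Qed.

End negative_coefficient.

(** * Gaussian means of periodic functions *)

Section gaussian_mean.
Context {R : realType}.
Notation mu := (@lebesgue_measure R).
Notation L1 f := (mu.-integrable setT (EFin \o f)).

Lemma gauss_small (c e : R) : 0 < c -> 0 < e ->
  exists2 l0 : R, 1 <= l0 & forall l, l0 <= l -> gauss c l <= e.
Proof.
move=> c0 e0; exists (1 + (c * e)^-1) => [|l ll0].
  by rewrite lerDl invr_ge0 mulr_ge0// ltW.
have ce : 0 < (c * e)^-1 by rewrite invr_gt0 mulr_gt0.
have l1 : 1 <= l by lra.
rewrite /gauss expRN -[e]invrK lef_pV2 ?posrE ?expR_gt0 ?invr_gt0//.
apply: le_trans (expR_ge1Dx _); apply: (@le_trans _ _ (c * l ^+ 2)); last by rewrite lerDr.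
apply: (@le_trans _ _ (c * (c * e)^-1)); first by rewrite invfM mulrA mulfV ?mul1r// gt_eqF.
rewrite ler_wpM2l ?(ltW c0)//; apply: (@le_trans _ _ l); first by lra.
by rewrite expr2 ler_peMl//; lra.
Qed.

Lemma expr_diff_le (y z : R) n : 0 <= z <= y ->
  y ^+ n.+1 - z ^+ n.+1 <= n.+1%:R * y ^+ n * (y - z).
Proof.
move=> /andP[z0 zy]; have y0 : 0 <= y by exact: le_trans zy.
elim: n => [|n IH]; first by rewrite !expr1 expr0 mulr1 mul1r.
have -> : y ^+ n.+2 - z ^+ n.+2 = y * (y ^+ n.+1 - z ^+ n.+1) + (y - z) * z ^+ n.+1.
  by rewrite [y ^+ n.+2]exprS [z ^+ n.+2]exprS; ring.
have h1 := ler_wpM2l y0 IH.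
have h2 : (y - z) * z ^+ n.+1 <= (y - z) * y ^+ n.+1.
  by rewrite ler_wpM2l ?subr_ge0// lerXn2r ?nnegrE.
apply: le_trans (lerD h1 h2) _.
rewrite le_eqVlt; apply/orP; left; apply/eqP.
by rewrite -[n.+2%:R]natr1 !exprS; ring.
Qed.

(** The left side is the derivative of y^(k^2), which controls the contribution of frequency [k].
    The powers of 1/2 make the sum over [k] converge, and the factor [y] makes it negligible against
    frequency 1 for small [y]. *)
Lemma sqr_power_bound (y : R) k : (1 < k)%N -> 0 <= y <= 4^-1 ->
  (k ^ 2)%:R * y ^+ (k ^ 2).-1 <= 2 * y * 2^-1 ^+ k.
Proof.
move=> k1 /andP[y0 y4].
have [n nE] : exists n, (k ^ 2 = k + n.+2)%N.
  by exists (k ^ 2 - k - 2)%N; nia.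
rewrite nE !addnS /= exprS mulrCA.
rewrite (_ : 2 * y * 2^-1 ^+ k = y * (2 * 2^-1 ^+ k)); last by ring.
rewrite ler_wpM2l//.
apply: (@le_trans _ _ ((2 ^+ (k + n).+1) * 4^-1 ^+ (k + n))).
  apply: ler_pM => //; first exact: exprn_ge0.
    rewrite -natrX ler_nat; exact: ltn_expl.
  by rewrite lerXn2r ?nnegrE.
have -> : 4^-1 = 2^-1 * 2^-1 :> R by field.
rewrite exprMn exprS -mulrA ler_wpM2l// mulrA -exprMn mulfV// expr1n mul1r.
rewrite exprD ler_piMr ?exprn_ge0// exprn_ile1//; lra.
Qed.

Lemma sum_half_powers N : \sum_(k < N) 2^-1 ^+ k <= 2 :> R.
Proof.
suff -> : \sum_(k < N) 2^-1 ^+ k = 2 - 2 * 2^-1 ^+ N :> R.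
  by rewrite gerBl mulr_ge0// exprn_ge0.
elim: N => [|N IH]; first by rewrite big_ord0 expr0; ring.
by rewrite big_ord_recr/= IH exprS; field.
Qed.

Variable A : R.
Hypothesis A0 : 0 < A.

Definition gauss_mean (W : R -> R) l := \int[mu]_xi (gauss A xi * W (l * xi)).

Let s := Num.sqrt (pi / A).

(** Up to the factor [s], the Gaussian mean of frequency 1; frequency [k] has the power [k ^ 2] of
    it. *)
Let y l := gauss (pi ^+ 2 / A) l.

Let s0 : 0 < s. Proof. by rewrite sqrtr_gt0 divr_gt0// pi_gt0. Qed.

Let bounded_integrable W B l : continuous W -> (forall x, `|W x| <= B) ->
  L1 (fun xi => gauss A xi * W (l * xi)).
Proof.
move=> cW WB; apply: (@integrable_EFin_bounded _ _ _ mu _ (fun xi => W (l * xi)) B) => //.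
  by apply: (measurableT_comp (continuous_measurable_fun cW)); exact: measurable_funM.
exact: integrable_gauss.
Qed.

Let gauss_mean_cospoly N (c : nat -> R) l :
  gauss_mean (fun x => \sum_(k < N) c k * cosw k x) l =
  s * \sum_(k < N) c k * y l ^+ (k ^ 2).
Proof.
have yk (k : nat) : gauss (4 * A)^-1 (2 * pi * k%:R * l) = y l ^+ (k ^ 2).
  rewrite /y /gauss -expRM_natl natrX; congr expR.
  by move: (pi : R) => P; field; rewrite gt_eqF.
have gi k : L1 (fun xi => gauss A xi * cosw k (l * xi)).
  apply: (bounded_integrable (W := cosw k) (B := 1)); first exact: continuous_cosw.
  exact: cosw_max.
rewrite /gauss_mean (@eq_Rintegral _ _ _ mu setT (fun xi => \sum_(k < N) c k * (gauss A xi * cosw k (l * xi)))); last first.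
  by move=> xi _; rewrite mulr_sumr; apply: eq_bigr => k _; ring.
rewrite Rintegral_sum; last by move=> k; exact: integrable_EFinZl.
rewrite mulr_sumr; apply: eq_bigr => k _; rewrite RintegralZl// mulrCA; congr (_ * _).
rewrite -yk -Rintegral_gauss_cos//; apply: eq_Rintegral => xi _.
by rewrite /cosw mulrA.
Qed.

(* The frequency 1 contributes at least [2 d (y l - y l')]; the frequencies [k > 1],
   which carry [y l ^+ k ^ 2], can only take back half of it. *)
Let cospoly_increase w S d l l' : cospoly w -> (forall x, `|w x| <= S) ->
  period_mean (fun x => w x * cosw 1 x) <= - d ->
  y l' <= y l -> y l <= 4^-1 -> 8 * S * y l <= d ->
  s * (d * (y l - y l')) <= gauss_mean w l' - gauss_mean w l.
Proof.
move=> cw wS wd yl yl4 yd.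
have [N [c [N2 wE]]] := cospoly_pad 2 cw.
have S0 : 0 <= S by exact: le_trans (wS 0).
have -> : w = fun x => \sum_(k < N) c k * cosw k x by apply/funext.
rewrite !gauss_mean_cospoly -mulrBr ler_wpM2l ?(ltW s0)//.
have cP : continuous (fun x : R => \sum_(k < N) c k * cosw k x).
  by apply: cospoly_continuous; exists N, c.
have cS k : (0 < k < N)%N -> `|2^-1 * c k| <= S.
  move=> k0.
  have -> : 2^-1 * c k = period_mean (fun x => (\sum_(k < N) c k * cosw k x) * cosw k x) - period_mean (fun _ : R => 0).
    by rewrite period_mean_cst subr0 cospoly_coef.
  apply: period_mean_close => [||x].
  - by move=> x; apply: cvgM; [exact: cP|exact: continuous_cosw].
  - by move=> x; exact: cst_continuous.
  by rewrite subr0 normrM -wE -[S]mulr1 ler_pM// cosw_max.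
have N1 : (0 < 1 < N)%N by [].
have c1 : 2^-1 * c 1%N <= - d.
  by rewrite -(cospoly_coef c N1); apply: le_trans wd; rewrite le_eqVlt; apply/orP; left; apply/eqP; apply: eq_period_mean => x; rewrite wE.
have y0 l1 : 0 <= y l1 by exact: gauss_ge0.
rewrite -sumrB.
pose n1 : 'I_N := Ordinal N2.
rewrite (bigD1 n1)//= exp1n !expr1.
have tail k : (k != n1) -> - (2 * S * (2 * y l * 2^-1 ^+ k) * (y l - y l')) <=
    c k * y l' ^+ (k ^ 2) - c k * y l ^+ (k ^ 2).
  move=> k1; have D0 : 0 <= y l - y l' by rewrite subr_ge0.
  have [k0|k0] := posnP k.
    by rewrite k0 exp0n// !expr0 subrr oppr_le0 !mulr_ge0.
  have k2 : (1 < k)%N.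
    rewrite ltn_neqAle k0 andbT eq_sym; apply: contra k1 => /eqP k1.
    by apply/eqP; exact: val_inj.
  have kb : (0 < k < N)%N by rewrite k0 ltn_ord.
  rewrite -mulrBr -[y l' ^+ _ - _]opprB mulrN lerN2.
  apply: le_trans (ler_norm _) _; rewrite normrM.
  have nE : (k ^ 2 = (k ^ 2).-1.+1)%N by rewrite prednK// expn_gt0 k0.
  have P0 : 0 <= y l ^+ (k ^ 2) - y l' ^+ (k ^ 2).
    by rewrite subr_ge0 lerXn2r ?nnegrE.
  rewrite (ger0_norm P0) -mulrA; apply: ler_pM => //.
    have := cS k kb; rewrite normrM ger0_norm ?invr_ge0//; lra.
  have yy : 0 <= y l' <= y l by rewrite y0.
  have := expr_diff_le (k ^ 2).-1 yy; rewrite -nE => h; apply: (le_trans h).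
  rewrite ler_wpM2r//; apply: sqr_power_bound => //.
  by rewrite y0.
apply: le_trans (lerD (lexx _) (ler_sum _ tail)).
have D0 : 0 <= y l - y l' by rewrite subr_ge0.
have -> : \sum_(i < N | i != n1) - (2 * S * (2 * y l * 2^-1 ^+ i) * (y l - y l')) =
   - (4 * S * y l * (y l - y l') * \sum_(i < N | i != n1) 2^-1 ^+ i).
  by rewrite mulr_sumr sumrN; congr (- _); apply: eq_bigr => i _; ring.
have sum2 : \sum_(i < N | i != n1) 2^-1 ^+ i <= 2 :> R.
  apply: le_trans (sum_half_powers N); rewrite [leRHS](bigD1 n1)//= lerDr.
  by rewrite exprn_ge0.
have c40 : 0 <= 4 * S * y l * (y l - y l') by rewrite !mulr_ge0.
have h1 := ler_wpM2l c40 sum2.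
have h2 := ler_wpM2r D0 yd.
have h3 : 2 * d * (y l - y l') <= c 1%N * y l' - c 1%N * y l.
  rewrite -mulrBr -[y l' - y l]opprB mulrN -mulNr ler_wpM2r//; lra.
by lra.
Qed.

(** The constants of [cospoly_increase] involve only a uniform bound and the first coefficient, not
    the degree, so the estimate passes to uniform limits. *)
Lemma gauss_mean_increase W : cos_approx W ->
  period_mean (fun x => W x * cosw 1 x) < 0 ->
  exists d l0 : R, [/\ 0 < d, 1 <= l0 & forall l l', l0 <= l -> l <= l' ->
    d * (gauss (pi ^+ 2 / A) l - gauss (pi ^+ 2 / A) l') <= gauss_mean W l' - gauss_mean W l].
Proof.
move=> [cW [S WS] appr]; set a1 := period_mean _ => a10.
have S0 : 0 <= S by exact: le_trans (WS 0).
(* Half of the first coefficient is given away, so that an approximant within [d] still satisfies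
   the coefficient bound of [cospoly_increase]. Similarly [e0] uses [S + 1], which bounds every
   approximant within 1. *)
pose d := - a1 / 2.
have d0 : 0 < d by rewrite /d; lra.
pose e0 := Num.min (4^-1) (d / (8 * (S + 1))).
have S8 : 0 < 8 * (S + 1) by lra.
have e0_gt0 : 0 < e0 by rewrite lt_min invr_gt0 ltr0n/= divr_gt0.
have pA : 0 < pi ^+ 2 / A by rewrite divr_gt0// exprn_gt0// pi_gt0.
have [l0 l01 yl0] := gauss_small pA e0_gt0.
exists (s * d), l0; split => //; first exact: mulr_gt0.
move=> l l' l0l ll'; rewrite -/(y l) -/(y l') -mulrA.
have yle0 : y l <= e0 by exact: yl0.
have yl4 : y l <= 4^-1 by apply: le_trans yle0 _; rewrite ge_min lexx.
have ySd : 8 * (S + 1) * y l <= d.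
  rewrite mulrC -ler_pdivlMr//; apply: le_trans yle0 _; by rewrite ge_min lexx orbT.
have yl' : y l' <= y l.
  rewrite /y /gauss ler_expR lerN2 ler_wpM2l ?(ltW pA)//.
  by rewrite lerXn2r ?nnegrE//; lra.
(* The parameters [l] and [l'] are fixed before the approximant is chosen: its error must be small
   even compared with a tiny [y l - y l']. *)
apply/ler_addgt0Pr => eta eta0.
pose e := Num.min (Num.min 1 d) (eta / (2 * s)).
have e_gt0 : 0 < e by rewrite !lt_min ltr01 d0/= divr_gt0// mulr_gt0.
have e1 : e <= 1 by rewrite !ge_min lexx.
have ed : e <= d by rewrite !ge_min lexx orbT.
have es : 2 * s * e <= eta by rewrite mulrC -ler_pdivlMr ?mulr_gt0// ge_min lexx orbT.
have [w cw Ww] := appr e e_gt0.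
have cwc := cospoly_continuous cw.
have wS x : `|w x| <= S + 1.
  have -> : w x = W x - (W x - w x) by ring.
  by apply: le_trans (ler_normB _ _) _; rewrite lerD// (le_trans (Ww x)).
have wd : period_mean (fun x => w x * cosw 1 x) <= - d.
  have : `|a1 - period_mean (fun x => w x * cosw 1 x)| <= e.
    apply: period_mean_close => [||x].
    - by move=> x; apply: cvgM; [exact: cW|exact: continuous_cosw].
    - by move=> x; apply: cvgM; [exact: cwc|exact: continuous_cosw].
    by rewrite -mulrBl normrM -[e]mulr1 ler_pM// cosw_max.
  rewrite ler_norml => /andP[+ _]; rewrite /d in ed *; lra.
have := cospoly_increase cw wS wd yl' yl4 ySd.
have cl l1 : `|gauss_mean W l1 - gauss_mean w l1| <= s * e.
  rewrite /gauss_mean -RintegralB//; [|exact: (bounded_integrable _ cW WS)|exact: (bounded_integrable _ cwc wS)].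
  apply: le_trans (le_normr_Rintegral measurableT _) _.
    by apply: integrable_EFinB; [exact: (bounded_integrable _ cW WS)|exact: (bounded_integrable _ cwc wS)].
  rewrite mulrC /s -Rintegral_gauss// -RintegralZl//; last exact: integrable_gauss.
  apply: le_Rintegral => //.
  - apply: integrable_norm.
    by apply: integrable_EFinB; [exact: (bounded_integrable _ cW WS)|exact: (bounded_integrable _ cwc wS)].
  - by apply: integrable_EFinZl; exact: integrable_gauss.
  move=> xi _; rewrite -mulrBr normrM (ger0_norm (gauss_ge0 _ _)) mulrC.
  by rewrite ler_wpM2r ?gauss_ge0.
have := cl l; have := cl l'; rewrite !ler_norml => /andP[? ?] /andP[? ?].
lra.
Qed.

End gaussian_mean.

(** * The one-dimensional norm *)

Section norm_power_integrals.
Context {R : realType}.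
Notation mu := (@lebesgue_measure R).
Notation L1 f := (mu.-integrable setT (EFin \o f)).

Lemma integrable_norm_powR (q B : R) (f : R -> R) : 2 < q -> measurable_fun setT f ->
  (forall x, `|f x| <= B) -> L1 (fun x => f x ^+ 2) -> L1 (fun x => `|f x| `^ q).
Proof.
move=> q2 mf fB f2i.
have mp : measurable_fun setT (fun x => `|f x| `^ (q - 2)).
  apply: (measurableT_comp (measurable_powR (q - 2))).
  exact: measurableT_comp.
have B0 : 0 <= B by exact: le_trans (fB 0).
have pB x : `| `|f x| `^ (q - 2)| <= B `^ (q - 2).
  rewrite ger0_norm ?powR_ge0//.
  by apply: ge0_ler_powR; rewrite ?nnegrE// subr_ge0 ltW.
have := @integrable_EFin_bounded _ _ _ mu (fun x => f x ^+ 2) (fun x => `|f x| `^ (q - 2)) _ mp pB f2i.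
apply: eq_integrable => // x _ /=.
by rewrite (norm_powR_split (f x) q2) expr2 mulrC mulrA.
Qed.

Lemma integrable_sum_sqr (f g : R -> R) : measurable_fun setT f -> measurable_fun setT g ->
  L1 (fun x => f x ^+ 2) -> L1 (fun x => g x ^+ 2) -> L1 (fun x => (f x + g x) ^+ 2).
Proof.
move=> mf mg f2 g2.
apply: (@integrable_dominated _ _ _ mu _ (fun x => 2 * (f x ^+ 2 + g x ^+ 2))).
- by apply: measurable_funX; exact: measurable_funD.
- move=> x; rewrite ger0_norm ?sqr_ge0//.
  by have := sqr_ge0 (f x - g x); nra.
- by apply: integrable_EFinZl; exact: integrable_EFinD.
Qed.

Lemma amgm (a b k : R) : 0 < k -> `|a| * `|b| <= 2^-1 * (k * a ^+ 2 + k^-1 * b ^+ 2).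
Proof.
move=> k0; rewrite -[a ^+ 2]real_normK ?num_real// -[b ^+ 2]real_normK ?num_real//.
set u := `|a|; set v := `|b|; rewrite -subr_ge0.
have -> : 2^-1 * (k * u ^+ 2 + k^-1 * v ^+ 2) - u * v = 2^-1 * k^-1 * (k * u - v) ^+ 2.
  by field; rewrite gt_eqF.
by rewrite mulr_ge0 ?sqr_ge0// mulr_ge0 ?invr_ge0// ltW.
Qed.

End norm_power_integrals.

(** * Differences of L^q norms under a small perturbation *)

Section perturbation.
Context {R : realType}.
Notation mu := (@lebesgue_measure R).
Notation L1 f := (mu.-integrable setT (EFin \o f)).
Variables (q B : R).
Hypothesis q2 : 2 < q.
Variables (z e z' e' : R -> R) (eta D Cw Cz Ce : R).
(* [D] stands for the step in [l] and [eta] for the overlap of the bumps. *)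
Hypotheses (eta0 : 0 < eta) (eta1 : eta <= 1) (D0 : 0 < D).
Hypotheses (mz : measurable_fun setT z) (me : measurable_fun setT e).
Hypotheses (mz' : measurable_fun setT z') (me' : measurable_fun setT e').
Hypotheses (zB : forall x, `|z x| <= B) (eB : forall x, `|e x| <= B).
Hypotheses (z'B : forall x, `|z' x| <= B) (e'B : forall x, `|e' x| <= B).
Hypotheses (z2i : L1 (fun x => z x ^+ 2)) (e2i : L1 (fun x => e x ^+ 2)).
Hypotheses (z'2i : L1 (fun x => z' x ^+ 2)) (e'2i : L1 (fun x => e' x ^+ 2)).
Hypotheses (w2i : L1 (fun x => (z' x - z x) ^+ 2)) (u2i : L1 (fun x => (e' x - e x) ^+ 2)).
Hypotheses (Iw : \int[mu]_x (z' x - z x) ^+ 2 <= Cw * D ^+ 2).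
Hypotheses (Iz' : \int[mu]_x z' x ^+ 2 <= Cz).
Hypotheses (Ie : \int[mu]_x e x ^+ 2 <= Ce * eta ^+ 2).
Hypotheses (Ie' : \int[mu]_x e' x ^+ 2 <= Ce).
Hypotheses (Iu : \int[mu]_x (e' x - e x) ^+ 2 <= Ce * D ^+ 2 * eta ^+ 2).

Let L := q * ((q - 1) * (B + B) `^ (q - 2)).

(* AM-GM for the products in [norm_powR_diff2], weighted so that each integral is
   O(D * eta). *)
Let h1 x := 2^-1 * (eta / D * (z' x - z x) ^+ 2 + (eta / D)^-1 * e x ^+ 2).
Let h2 x := 2^-1 * (D^-1 * (e' x - e x) ^+ 2 + D^-1^-1 * e x ^+ 2).
Let h3 x := 2^-1 * (eta * D * z' x ^+ 2 + (eta * D)^-1 * (e' x - e x) ^+ 2).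
Let h4 x := 2^-1 * (eta * D * e' x ^+ 2 + (eta * D)^-1 * (e' x - e x) ^+ 2).

Let combo_int (a b : R) (f g : R -> R) A C : 0 <= a -> 0 <= b ->
  L1 f -> L1 g -> \int[mu]_x f x <= A -> \int[mu]_x g x <= C ->
  L1 (fun x => 2^-1 * (a * f x + b * g x)) /\
  \int[mu]_x (2^-1 * (a * f x + b * g x)) <= 2^-1 * (a * A + b * C).
Proof.
move=> a0 b0 fi gi fA gC.
have af : L1 (fun x => a * f x) by exact: integrable_EFinZl.
have bg : L1 (fun x => b * g x) by exact: integrable_EFinZl.
split; first by apply: integrable_EFinZl; exact: integrable_EFinD.
rewrite RintegralZl//; last exact: integrable_EFinD.
rewrite RintegralD// !RintegralZl// ler_wpM2l//.
by rewrite lerD// ler_wpM2l.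
Qed.

(** The loss carries the factor [D] besides [eta]. A loss of size [eta] alone would exceed the
    growth of the unperturbed norm between two close parameters. *)
Lemma perturbation :
  [/\ L1 (fun x => `|z x + e x| `^ q), L1 (fun x => `|z' x + e' x| `^ q),
      L1 (fun x => `|z x| `^ q), L1 (fun x => `|z' x| `^ q) &
  \int[mu]_x `|z' x| `^ q - \int[mu]_x `|z x| `^ q -
    L * ((2^-1 * Cw + 2^-1 * Cz + 3 * Ce) * D * eta) <=
  \int[mu]_x `|z' x + e' x| `^ q - \int[mu]_x `|z x + e x| `^ q].
Proof.
have BB (x y : R) : `|x| <= B -> `|y| <= B -> `|x + y| <= B + B.
  by move=> xB yB; apply: le_trans (ler_normD _ _) _; rewrite lerD.
have B0 : 0 <= B by exact: le_trans (zB 0).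
have i1 : L1 (fun x => `|z x + e x| `^ q).
  apply: (@integrable_norm_powR _ q (B + B) (fun x => z x + e x)) => //.
  - exact: measurable_funD.
  - by move=> x; exact: BB.
  - exact: integrable_sum_sqr.
have i2 : L1 (fun x => `|z' x + e' x| `^ q).
  apply: (@integrable_norm_powR _ q (B + B) (fun x => z' x + e' x)) => //.
  - exact: measurable_funD.
  - by move=> x; exact: BB.
  - exact: integrable_sum_sqr.
have i3 : L1 (fun x => `|z x| `^ q) by exact: (integrable_norm_powR q2 mz zB).
have i4 : L1 (fun x => `|z' x| `^ q) by exact: (integrable_norm_powR q2 mz' z'B).
split => //.
have Ce0 : 0 <= Ce by apply: le_trans Ie'; apply: Rintegral_ge0 => x _; exact: sqr_ge0.
have q0 : 0 <= q by apply: le_trans (ltW q2).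
have L0 : 0 <= L.
  by rewrite mulr_ge0// mulr_ge0 ?powR_ge0// subr_ge0 (le_trans _ (ltW q2))// ler1n.
have eD : 0 < eta / D by exact: divr_gt0.
have eD' : 0 < eta * D by exact: mulr_gt0.
have eDV : 0 < (eta / D)^-1 by rewrite invr_gt0.
have eDV' : 0 < (eta * D)^-1 by rewrite invr_gt0.
have DV : 0 < D^-1 by rewrite invr_gt0.
have DVV : 0 < D^-1^-1 by rewrite invr_gt0.
have [j1 k1] := combo_int (ltW eD) (ltW eDV) w2i e2i Iw Ie.
have [j2 k2] := combo_int (ltW DV) (ltW DVV) u2i e2i Iu Ie.
have [j3 k3] := combo_int (ltW eD') (ltW eDV') z'2i u2i Iz' Iu.
have [j4 k4] := combo_int (ltW eD') (ltW eDV') e'2i u2i Ie' Iu.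
pose h x := h1 x + h2 x + (h3 x + h4 x).
have hi12 : L1 (fun x => h1 x + h2 x) by exact: integrable_EFinD.
have hi34 : L1 (fun x => h3 x + h4 x) by exact: integrable_EFinD.
have hi : L1 h by exact: integrable_EFinD.
have ih : \int[mu]_x h x <= (2^-1 * Cw + 2^-1 * Cz + 3 * Ce) * D * eta.
  rewrite RintegralD// !RintegralD//.
  have l1 : \int[mu]_x h1 x <= 2^-1 * (Cw + Ce) * (D * eta).
    apply: le_trans k1 _.
    by rewrite le_eqVlt; apply/orP; left; apply/eqP; field; rewrite !gt_eqF.
  have l2 : \int[mu]_x h2 x <= Ce * (D * eta).
    apply: le_trans k2 _.
    apply: (@le_trans _ _ (Ce * (D * (eta * eta)))).
      by rewrite le_eqVlt; apply/orP; left; apply/eqP; field; rewrite !gt_eqF.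
    rewrite ler_wpM2l// ler_wpM2l ?(ltW D0)// ler_piMr// ltW//.
  have l3 : \int[mu]_x h3 x <= 2^-1 * (Cz + Ce) * (D * eta).
    apply: le_trans k3 _.
    by rewrite le_eqVlt; apply/orP; left; apply/eqP; field; rewrite !gt_eqF.
  have l4 : \int[mu]_x h4 x <= Ce * (D * eta).
    apply: le_trans k4 _.
    by rewrite le_eqVlt; apply/orP; left; apply/eqP; field; rewrite !gt_eqF.
  by apply: le_trans (lerD (lerD l1 l2) (lerD l3 l4)) _; lra.
have iA : L1 (fun x => `|z' x + e' x| `^ q - `|z x + e x| `^ q) by exact: integrable_EFinB.
have iB : L1 (fun x => `|z' x| `^ q - `|z x| `^ q) by exact: integrable_EFinB.
have iC : L1 (fun x => `|z' x| `^ q - `|z x| `^ q - L * h x).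
  by apply: integrable_EFinB => //; exact: integrable_EFinZl.
have : \int[mu]_x (`|z' x| `^ q - `|z x| `^ q - L * h x) <=
    \int[mu]_x (`|z' x + e' x| `^ q - `|z x + e x| `^ q).
  apply: le_Rintegral => // x _.
  have := norm_powR_diff2 q2 (zB x) (eB x) (z'B x) (e'B x); rewrite -/L.
  have hb : (`|z x - z' x| + `|e x - e' x|) * `|e x| + (`|z' x| + `|e' x|) * `|e x - e' x| <= h x.
    rewrite [`|z x - _|]distrC [`|e x - e' x|]distrC !mulrDl.
    have g1 := amgm (z' x - z x) (e x) eD.
    have Dv : 0 < D^-1 by rewrite invr_gt0.
    have g2 := amgm (e' x - e x) (e x) Dv.
    have g3 := amgm (z' x) (e' x - e x) eD'.
    have g4 := amgm (e' x) (e' x - e x) eD'.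
    exact: lerD (lerD g1 g2) (lerD g3 g4).
  have := ler_wpM2l L0 hb.
  rewrite ler_norml => g /andP[_ g']; lra.
rewrite RintegralB//; last exact: integrable_EFinZl.
rewrite !RintegralB// RintegralZl//.
by move=> H1; apply: le_trans H1; rewrite lerD2l lerN2; exact: ler_wpM2l.
Qed.

End perturbation.

Lemma half_gap (R : realType) (P X b f : R) : 0 < P * X -> P * X <= b ->
  f <= P / 2 * X -> 0 < b - f.
Proof. by rewrite mulrAC => *; lra. Qed.

(** * Growth of the norm for the four masses *)

Section one_dimensional.
Context {R : realType}.
Notation mu := (@lebesgue_measure R).
Notation L1 f := (mu.-integrable setT (EFin \o f)).

(** The difference is [gauss c l'] times exp(c (l'^2 - l^2)) - 1, and the latter is at least 2 c (l'
    - l) since both parameters are at least 1. Over a unit step l' <= 2 l, whence the factor 4. *)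
Lemma gauss_diff_ge (c l l' : R) : 0 < c -> 1 <= l -> l <= l' <= l + 1 ->
  2 * c * (l' - l) * gauss (4 * c) l <= gauss c l - gauss c l'.
Proof.
move=> c0 l1 /andP[ll' l'l].
have E : gauss c l = gauss c l' * expR (c * (l' ^+ 2 - l ^+ 2)).
  by rewrite /gauss -expRD; congr expR; ring.
have h1 : 1 + c * (l' ^+ 2 - l ^+ 2) <= expR (c * (l' ^+ 2 - l ^+ 2)) by exact: expR_ge1Dx.
have h2 : 2 * c * (l' - l) <= c * (l' ^+ 2 - l ^+ 2).
  have -> : 2 * c * (l' - l) = c * ((l' - l) * 2) by ring.
  rewrite ler_wpM2l ?(ltW c0)//.
  have -> : l' ^+ 2 - l ^+ 2 = (l' - l) * (l' + l) by ring.
  by rewrite ler_wpM2l ?subr_ge0//; lra.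
have h3 : gauss (4 * c) l <= gauss c l'.
  rewrite /gauss ler_expR lerN2 mulrAC -[leLHS]mul1r -mulrA.
  have -> : 1 * (c * l' ^+ 2) = c * l' ^+ 2 by ring.
  have -> : 4 * (l ^+ 2 * c) = c * (4 * l ^+ 2) by ring.
  by rewrite ler_wpM2l ?(ltW c0)//; nra.
have g0 : 0 < gauss c l' by exact: gauss_gt0.
have -> : gauss c l - gauss c l' = gauss c l' * (expR (c * (l' ^+ 2 - l ^+ 2)) - 1).
  by rewrite [in LHS]E; ring.
rewrite mulrC; apply: ler_pM => //; first exact: gauss_ge0.
  by rewrite mulr_ge0 ?subr_ge0// mulr_ge0// ltW.
lra.
Qed.

Lemma increasing_by_unit_steps (N : R -> R) (l0 : R) :
  (forall l l', l0 <= l -> l < l' -> l' <= l + 1 -> N l < N l') ->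
  forall l l', l0 <= l -> l < l' -> N l < N l'.
Proof.
move=> step l l' l0l ll'.
have [n] : exists n : nat, l' <= l + n%:R.
  by exists (Num.trunc (l' - l)).+1; have := truncnS_gt (l' - l); lra.
elim: n l l0l ll' => [|n IH] l l0l ll'; first by rewrite addr0 leNgt ll'.
move=> l'n; have [l'1|l'1] := leP l' (l + 1); first exact: step.
apply: lt_trans (step l (l + 1) l0l _ _) _ => //; first by rewrite ltrDl.
by apply: IH => //; [lra|move: l'n; rewrite -natr1; lra].
Qed.

Lemma cos_transformB (f g : R -> R) xi : L1 f -> L1 g ->
  cos_transform (fun x => f x - g x) xi = cos_transform f xi - cos_transform g xi.
Proof.
move=> fi gi.
have fc := integrable_cosM (2 * pi * xi) fi; have gc := integrable_cosM (2 * pi * xi) gi.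
rewrite /cos_transform -(RintegralB measurableT fc gc).
by apply: eq_Rintegral => x _; rewrite mulrBl.
Qed.

Variables (K m : nat).
Hypotheses (K1 : (1 < K)%N) (m5 : (5 < m)%N).

Let m' : nat := (K * m + 1)%N.
Let x1 : R := (m'%:R + m%:R) / 2.
Let x2 : R := (m'%:R - m%:R) / 2.

Definition nodes (k : 'I_4) : R := nth 0 [:: x1; - x1; x2; - x2] k.

Let m6 : 6 <= m%:R :> R. Proof. by rewrite ler_nat. Qed.

(** The distances between nodes are m, m', m' - m and m' + m; by this bound, which uses [K > 1], the
    least of them is m. *)
Let m'2 : 2 * m%:R <= m'%:R :> R.
Proof. by rewrite -natrM ler_nat /m'; nia. Qed.

Lemma nodes_sep j k : j != k -> m%:R <= `|nodes j - nodes k|.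
Proof.
have := m6; have := m'2.
by case: j => [[|[|[|[|//]]]] ?]; case: k => [[|[|[|[|//]]]] ?] //= h1 h2 _;
  rewrite /nodes /x1 /x2/= ler_normr; apply/orP; (left; lra) || (right; lra).
Qed.

Lemma nodes_le k : `|nodes k| <= m'%:R.
Proof.
have := m6; have := m'2.
by case: k => [[|[|[|[|//]]]] ?] //= h1 h2;
  rewrite /nodes /x1 /x2/= ler_norml; apply/andP; split; lra.
Qed.

Variables (r q : R).
Hypotheses (r_ge : 2^-1 <= r) (r_le : r <= 1) (q2 : 2 < q).

Let r0 : 0 < r. Proof. by apply: lt_le_trans r_ge; rewrite invr_gt0. Qed.

Definition heat_profile := @profile R 4 nodes r.

Let T (x : R) : R := (2 * cos (pi * (m%:R * x))) * (2 * cos (pi * (m'%:R * x))).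

Let z (l xi : R) : R := Num.sqrt r^-1 * gauss (pi / r) xi * T (l * xi).

Let er := @profile_error R 4 nodes r.

Let e (l : R) := cos_transform (er l).

Lemma heat_profile_even l x : heat_profile l (- x) = heat_profile l x.
Proof.
rewrite /heat_profile /profile; congr (_ `^ _).
rewrite !big_ord_recl !big_ord0 /bump /nodes/=.
have gN (a b : R) : gauss pi (- x - a * b) = gauss pi (x - a * - b).
  by rewrite -gaussN; congr gauss; ring.
by rewrite !gN !opprK; ring.
Qed.

Let shift_int a c : 0 < a -> L1 (fun x => gauss a (x - c)).
Proof.
move=> a0; have := integrable_affine (- c) (oner_neq0 R) (integrable_gauss a0).
by apply: eq_integrable => // x _ /=; rewrite mul1r.
Qed.

Let rpi : 0 < r * pi. Proof. by rewrite mulr_gt0// pi_gt0. Qed.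

Let bump_int l k : L1 (fun x => bump nodes l x k `^ r).
Proof.
have := shift_int (l * nodes k) rpi.
by apply: eq_integrable => // x _ /=; rewrite bump_powR.
Qed.

Let er_L2 := profile_error_L2 r_ge r_le nodes_le (ler0n R m) nodes_sep.

Lemma integrable_heat_profile l : 0 <= l -> L1 (heat_profile l).
Proof.
move=> l0; have [C C0 H] := er_L2; have [i1 _ _ _ _] := H l l0.
have := integrable_EFinD i1 (integrable_EFin_sum (bump_int l)).
by apply: eq_integrable => // x _ /=; rewrite /er /profile_error subrK.
Qed.

Let zE l xi : \sum_(k < 4) \int[mu]_x (bump nodes l x k `^ r * cos (2 * pi * xi * x)) = z l xi.
Proof.
rewrite (eq_bigr (fun k : 'I_4 => Num.sqrt r^-1 * gauss (pi / r) xi * cos (2 * pi * xi * (l * nodes k)))).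
  rewrite -mulr_sumr /z; congr (_ * _).
  rewrite !big_ord_recl !big_ord0 /nodes/= /T.
  have cE (a : R) : cos (2 * pi * xi * (l * - a)) = cos (2 * pi * xi * (l * a)).
    by rewrite !mulrN cosN.
  rewrite !cE.
  have -> : 2 * pi * xi * (l * x1) = pi * (m%:R * (l * xi)) + pi * (m'%:R * (l * xi)).
    by rewrite /x1; move: (pi : R) => P; field.
  have -> : 2 * pi * xi * (l * x2) = pi * (m'%:R * (l * xi)) - pi * (m%:R * (l * xi)).
    by rewrite /x2; move: (pi : R) => P; field.
  by rewrite cosD cosB; ring.
move=> k _.
rewrite (@eq_Rintegral _ _ _ mu setT (fun x => gauss (r * pi) (x - l * nodes k) * cos (2 * pi * xi * x))); last first.
  by move=> x _; rewrite bump_powR.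
rewrite Rintegral_gauss_shift_cos//; congr (_ * _ * _).
  congr Num.sqrt; have := lt0r_neq0 (pi_gt0 R); move: (pi : R) => P P0.
  by field; rewrite P0 gt_eqF.
have E4 (P : R) : P != 0 -> (4 * (r * P))^-1 * (2 * P) ^+ 2 = P / r.
  by move=> P0; field; rewrite P0 gt_eqF.
by rewrite gaussM E4// gt_eqF// pi_gt0.
Qed.

Lemma cos_transform_heat_profile l xi : 0 <= l ->
  cos_transform (heat_profile l) xi = z l xi + e l xi.
Proof.
move=> l0; have [C C0 H] := er_L2; have [i1 _ _ _ _] := H l l0.
rewrite -zE addrC -Rintegral_sum; last by move=> k; exact: integrable_cosM.
rewrite /e /cos_transform -RintegralD//.
- apply: eq_Rintegral => x _; rewrite -mulr_suml -mulrDl; congr (_ * _).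
  by rewrite /er /profile_error subrK.
- exact: integrable_cosM.
- by apply: integrable_EFin_sum => k; exact: integrable_cosM.
Qed.

(** The parameter of the q-th power of the Gaussian factor of [z]. *)
Let A : R := q * (pi / r).

Let A0 : 0 < A. Proof. by rewrite mulr_gt0 ?divr_gt0 ?pi_gt0//; apply: lt_trans q2. Qed.

Let W (x : R) := cos_power q (m%:R * x) * cos_power q (m'%:R * x).

Let z_powR l xi : `|z l xi| `^ q = Num.sqrt r^-1 `^ q * (gauss A xi * W (l * xi)).
Proof.
rewrite /z /T normrM powRM// normrM powRM// (ger0_norm (sqrtr_ge0 _)) (ger0_norm (gauss_ge0 _ _)).
rewrite gauss_powR -mulrA; congr (_ * (_ * _)).
by rewrite normrM powRM.
Qed.

Let T_max x : `|T x| <= 4.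
Proof.
have -> : 4 = 2 * 2 :> R by ring.
by rewrite /T !normrM (ger0_norm (_ : 0 <= 2))// ler_pM// ler_piMr// cos_max.
Qed.

Let cT : R := 4 * (pi * m%:R + pi * m'%:R).

Let T_lip x y : `|T x - T y| <= cT * `|x - y|.
Proof.
wlog yx : x y / y <= x.
  move=> H; have [yx|/ltW xy] := leP y x; first exact: H.
  by rewrite distrC [`|x - y|]distrC; exact: H.
pose dT (x : R) := - (4 * (pi * m%:R * (sin (pi * (m%:R * x)) * cos (pi * (m'%:R * x))) +
  pi * m'%:R * (cos (pi * (m%:R * x)) * sin (pi * (m'%:R * x))))).
have dTE u : is_derive u (1:R) T (dT u) by rewrite /T /dT; derive_by; ring.
have [c _ ->] := MVT_is_derive yx dTE.
rewrite normrM ler_wpM2r// /dT normrN normrM (ger0_norm (_ : 0 <= 4))// ler_wpM2l//.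
have pm (n : nat) : 0 <= pi * n%:R :> R by rewrite mulr_ge0// pi_ge0.
apply: le_trans (ler_normD _ _) _; rewrite lerD// normrM (ger0_norm (pm _)) ler_piMr//;
  rewrite normrM -[1]mulr1 ler_pM// ?sin_max ?cos_max//.
Qed.

Let mT : measurable_fun setT T.
Proof.
have mc (n : nat) : measurable_fun setT (fun x : R => 2 * cos (pi * (n%:R * x))).
  apply: measurable_funM => //; apply: (measurableT_comp (continuous_measurable_fun (@continuous_cos R))).
  by apply: measurable_funM => //; exact: measurable_funM.
exact: measurable_funM (mc m) (mc m').
Qed.

Let mz l : measurable_fun setT (z l).
Proof.
apply: measurable_funM; first by apply: measurable_funM => //; exact: measurable_gauss.
by apply: (measurableT_comp mT); exact: measurable_funM.
Qed.

Let pr0 : 0 < pi / r. Proof. by rewrite divr_gt0// pi_gt0. Qed.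

Let gauss_sqr a (x : R) : gauss a x ^+ 2 = gauss (2 * a) x.
Proof. by rewrite expr2 /gauss -expRD; congr expR; ring. Qed.

Let Cz := 16 * (r^-1 * \int[mu]_x gauss (2 * (pi / r)) x).
Let Cw := r^-1 * cT ^+ 2 * \int[mu]_x (x ^+ 2 * gauss (2 * (pi / r)) x).

Let pr20 : 0 < 2 * (pi / r). Proof. by rewrite mulr_gt0. Qed.

Let sqr_sqrt_r : Num.sqrt r^-1 ^+ 2 = r^-1. Proof. by rewrite sqr_sqrtr// invr_ge0 ltW. Qed.

Let z_L2 l : L1 (fun xi => z l xi ^+ 2) /\ \int[mu]_xi z l xi ^+ 2 <= Cz.
Proof.
have gi := integrable_gauss pr20.
have zb xi : z l xi ^+ 2 <= 16 * r^-1 * gauss (2 * (pi / r)) xi.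
  rewrite /z [_ ^+ 2]exprMn [(_ * gauss _ _) ^+ 2]exprMn sqr_sqrt_r gauss_sqr.
  have h : T (l * xi) ^+ 2 <= 16.
    rewrite -real_normK ?num_real// (_ : 16 = 4 ^+ 2 :> R); last by ring.
    by rewrite lerXn2r ?nnegrE.
  have g0 : 0 <= r^-1 * gauss (2 * (pi / r)) xi by rewrite mulr_ge0 ?gauss_ge0// invr_ge0 ltW.
  have -> : 16 * r^-1 * gauss (2 * (pi / r)) xi = r^-1 * gauss (2 * (pi / r)) xi * 16 by ring.
  exact: ler_wpM2l.
have bi : L1 (fun xi => 16 * r^-1 * gauss (2 * (pi / r)) xi) by exact: integrable_EFinZl.
have zi : L1 (fun xi => z l xi ^+ 2).
  apply: (integrable_dominated _ _ bi); first by apply: measurable_funX; exact: mz.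
  by move=> xi; rewrite ger0_norm ?sqr_ge0.
split => //; rewrite /Cz mulrA -RintegralZl//.
exact: le_Rintegral.
Qed.

Let z_lip_L2 l l' : L1 (fun xi => (z l' xi - z l xi) ^+ 2) /\
  \int[mu]_xi (z l' xi - z l xi) ^+ 2 <= Cw * (l' - l) ^+ 2.
Proof.
have gi := integrable_sqr_gauss pr20.
have zb xi : (z l' xi - z l xi) ^+ 2 <= r^-1 * cT ^+ 2 * (l' - l) ^+ 2 * (xi ^+ 2 * gauss (2 * (pi / r)) xi).
  rewrite /z -mulrBr 2!exprMn sqr_sqrt_r gauss_sqr.
  have h : (T (l' * xi) - T (l * xi)) ^+ 2 <= cT ^+ 2 * ((l' - l) ^+ 2 * xi ^+ 2).
    rewrite -real_normK ?num_real// -!exprMn -[leRHS]real_normK ?num_real//.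
    rewrite lerXn2r ?nnegrE//; apply: le_trans (T_lip _ _) _.
    by rewrite -mulrBl [leRHS]normrM ler_wpM2r// ler_norm.
  have g0 : 0 <= r^-1 * gauss (2 * (pi / r)) xi by rewrite mulr_ge0 ?gauss_ge0// invr_ge0 ltW.
  have := ler_wpM2l g0 h; set G := gauss _ _.
  have -> : r^-1 * G * (cT ^+ 2 * ((l' - l) ^+ 2 * xi ^+ 2)) =
    r^-1 * cT ^+ 2 * (l' - l) ^+ 2 * (xi ^+ 2 * G) by ring.
  by [].
have bi : L1 (fun xi => r^-1 * cT ^+ 2 * (l' - l) ^+ 2 * (xi ^+ 2 * gauss (2 * (pi / r)) xi)).
  exact: integrable_EFinZl.
have zi : L1 (fun xi => (z l' xi - z l xi) ^+ 2).
  apply: (integrable_dominated _ _ bi); first by apply: measurable_funX; apply: measurable_funB; exact: mz.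
  by move=> xi; rewrite ger0_norm ?sqr_ge0.
split => //; rewrite /Cw mulrAC -RintegralZl//.
exact: le_Rintegral.
Qed.

Let z_max l xi : `|z l xi| <= Num.sqrt r^-1 * 4.
Proof.
rewrite /z normrM normrM (ger0_norm (sqrtr_ge0 _)) (ger0_norm (gauss_ge0 _ _)).
rewrite ler_pM ?mulr_ge0 ?sqrtr_ge0 ?gauss_ge0//.
by rewrite ler_piMr ?sqrtr_ge0// gauss_le1// ltW.
Qed.

Definition transform_norm l := \int[mu]_xi `|cos_transform (heat_profile l) xi| `^ q.

Let c1 : R := pi * r / 2 * m%:R ^+ 2 / 4.
Let c0 : R := pi ^+ 2 / A.

Let c0_gt0 : 0 < c0. Proof. by rewrite divr_gt0// exprn_gt0// pi_gt0. Qed.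

(** Here c0 = pi r / q, so q > 2 gives 4 c0 < 2 pi r, while m >= 6 gives c1 >= 36 pi r / 8. The
    factor 4 is the one lost in [gauss_diff_ge]. *)
Let c01 : 4 * c0 < c1.
Proof.
have p0 := pi_gt0 R.
have c0E : c0 = pi * r / q.
  rewrite /c0 /A; have := lt0r_neq0 p0; move: (pi : R) => P P0.
  by field; rewrite P0 !gt_eqF//; apply: lt_trans q2.
have q0 : 0 < q by apply: lt_trans q2.
have pr : 0 < pi * r by rewrite mulr_gt0.
apply: (@lt_trans _ _ (2 * (pi * r))).
  by rewrite c0E mulrCA [ltRHS]mulrC ltr_pM2l// ltr_pdivrMr//; have := q2; lra.
rewrite /c1; have : 36 <= m%:R ^+ 2 :> R.
  have -> : 36 = 6 ^+ 2 :> R by ring.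
  by rewrite lerXn2r ?nnegrE//; exact: m6.
move=> /(ler_wpM2l (ltW pr)); move: (pi * r) pr (m%:R ^+ 2) => P P0 M; lra.
Qed.

Theorem transform_norm_increasing :
  period_mean (fun x => W x * cosw 1 x) < 0 ->
  (forall l, 0 <= l -> L1 (fun xi => `|cos_transform (heat_profile l) xi| `^ q)) /\
  exists2 l0 : R, 1 <= l0 & forall l l', l0 <= l -> l < l' ->
    transform_norm l < transform_norm l'.
Proof.
move=> Wneg; have [C C0 H] := er_L2.
have aW : cos_approx W by apply: cos_approxM; apply: cos_approx_dilate; exact: cos_approx_cos_power.
have [d [l1 [d0 l11 Hd]]] := gauss_mean_increase A0 aW Wneg.
(* A common bound for [z] and [e], as [perturbation] requires; [e] is bounded by the L1 norm of the
   profile error. *)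
pose B := Num.sqrt r^-1 * 4 + C.
have B0 : 0 <= Num.sqrt r^-1 * 4 by rewrite mulr_ge0 ?sqrtr_ge0.
have zB l xi : `|z l xi| <= B by apply: le_trans (z_max l xi) _; rewrite lerDl ltW.
have eB l xi : 0 <= l -> `|e l xi| <= B.
  move=> l0; have [i1 i2 b1 b2 _] := H l l0.
  apply: le_trans (cos_transform_bounded xi i1) _; apply: le_trans b1 _.
  by rewrite lerDr.
have me l : 0 <= l -> measurable_fun setT (e l).
  by move=> l0; have [i1 _ _ _ _] := H l l0; exact: measurable_cos_transform.
have eL2 l : 0 <= l -> L1 (fun xi => e l xi ^+ 2) /\ \int[mu]_xi e l xi ^+ 2 <= C * overlap m%:R r l ^+ 2.
  move=> l0; have [i1 i2 b1 b2 _] := H l l0.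
  have [j1 j2] := bessel i1 i2; split => //; exact: le_trans b2.
have eB2 l l' : 0 <= l -> l <= l' <= l + 1 -> L1 (fun xi => (e l' xi - e l xi) ^+ 2) /\
    \int[mu]_xi (e l' xi - e l xi) ^+ 2 <= C * (l' - l) ^+ 2 * overlap m%:R r l ^+ 2.
  move=> l0 ll'; have l'0 : 0 <= l' by case/andP: ll' => ? _; exact: le_trans l0 _.
  have [i1 _ _ _ Hl] := H l l0; have [i1' _ _ _ _] := H l' l'0.
  have [k1 k2 k3] := Hl l' ll'.
  have eE xi : e l' xi - e l xi = cos_transform (fun x => er l' x - er l x) xi.
    by rewrite /e -(cos_transformB xi i1' i1).
  have [j1 j2] := bessel k1 k2.
  split; first by move: j1; apply: eq_integrable => // x _ /=; rewrite eE.
  rewrite (@eq_Rintegral _ _ _ mu setT (fun xi => cos_transform (fun x => er l' x - er l x) xi ^+ 2)); last first.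
    by move=> xi _; rewrite eE.
  exact: le_trans k3.
have o0 l : 0 < overlap m%:R r l by exact: gauss_gt0.
have o1 l : overlap m%:R r l <= 1.
  rewrite gauss_le1// divr_ge0// mulr_ge0 ?sqr_ge0// divr_ge0// mulr_ge0 ?pi_ge0//; exact: ltW.
pose Lc := q * ((q - 1) * (B + B) `^ (q - 2)).
pose C2 := Lc * (2^-1 * Cw + 2^-1 * Cz + 3 * C).
have main l l' : 0 <= l -> l < l' -> l' <= l + 1 ->
  [/\ L1 (fun xi => `|cos_transform (heat_profile l) xi| `^ q) &
  \int[mu]_x `|z l' x| `^ q - \int[mu]_x `|z l x| `^ q - C2 * (l' - l) * overlap m%:R r l <=
  transform_norm l' - transform_norm l].
  move=> l0 ll' l'l.
  have l'0 : 0 <= l' by apply: le_trans l0 (ltW ll').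
  have ll : l <= l' <= l + 1 by rewrite l'l ltW.
  have [ei eI] := eL2 l l0; have [ei' eI'] := eL2 l' l'0.
  have [ui uI] := eB2 l l' l0 ll.
  have [zi zI] := z_L2 l; have [zi' zI'] := z_L2 l'.
  have [wi wI] := z_lip_L2 l l'.
  have D0 : 0 < l' - l by rewrite subr_gt0.
  have eI1 : \int[mu]_xi e l' xi ^+ 2 <= C.
    by apply: le_trans eI' _; rewrite ler_piMr ?(ltW C0)// expr_le1// ltW.
  have [p1 p2 p3 p4] := perturbation q2 (o0 l) (o1 l) D0 (mz l) (me l l0) (mz l') (me l' l'0)
    (zB l) (fun xi => eB l xi l0) (zB l') (fun xi => eB l' xi l'0) zi ei zi' ei' wi ui wI zI' eI eI1 uI.
  have tE l2 : 0 <= l2 -> transform_norm l2 = \int[mu]_x `|z l2 x + e l2 x| `^ q.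
    by move=> l20; apply: eq_Rintegral => xi _; rewrite cos_transform_heat_profile.
  rewrite !tE// /C2 /Lc => pp; split.
    by move: p1; apply: eq_integrable => // xi _ /=; rewrite cos_transform_heat_profile.
  by rewrite -!mulrA in pp *.
split.
  by move=> l l0; have [] := main l (l + 1) l0 _ _ => //; rewrite ltrDl.
pose s := Num.sqrt r^-1 `^ q.
have s0 : 0 < s by rewrite powR_gt0// sqrtr_gt0 invr_gt0.
have zN l : \int[mu]_x `|z l x| `^ q = s * gauss_mean A W l.
  rewrite /gauss_mean -RintegralZl//; first by apply: eq_Rintegral => x _; rewrite z_powR.
  have [cW [S WS] _] := aW.
  apply: (@integrable_EFin_bounded _ _ _ mu _ (fun xi => W (l * xi)) S) => //.
    by apply: (measurableT_comp (continuous_measurable_fun cW)); exact: measurable_funM.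
  exact: integrable_gauss.
(* The overlap is [gauss (4 * c0) l], of the order of the gain per unit of step, times the surplus
   factor [gauss (c1 - 4 * c0) l]. Once the latter is below [eps / 2], the error takes at most half
   of the gain. *)
pose eps := s * d * (2 * c0) / (`|C2| + 1).
have C21 : 0 < `|C2| + 1 by rewrite ltr_wpDl.
have sd0 : 0 < s * d * (2 * c0) by apply: mulr_gt0; exact: mulr_gt0.
have eps0 : 0 < eps / 2 by apply: divr_gt0 => //; exact: divr_gt0.
have c10 : 0 < c1 - 4 * c0 by rewrite subr_gt0.
have [l2 l21 small] := gauss_small c10 eps0.
exists (Num.max l1 l2); first by rewrite le_max l11.
apply: increasing_by_unit_steps => l l' ; rewrite ge_max => /andP[l1l l2l] ll' l'l.
have l1' : 1 <= l by exact: le_trans l1l.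
have l0 : 0 <= l by exact: le_trans l1'.
have [_] := main l l' l0 ll' l'l.
rewrite !zN -subr_gt0 => /lt_le_trans; apply.
have ll : l <= l' <= l + 1 by rewrite l'l ltW.
have g1 := gauss_diff_ge c0_gt0 l1' ll.
have g2 := Hd l l' l1l (ltW ll').
have oE : overlap m%:R r l = gauss (c1 - 4 * c0) l * gauss (4 * c0) l.
  by rewrite /overlap /gauss -expRD -/c1; congr expR; ring.
have D0 : 0 < l' - l by rewrite subr_gt0.
rewrite oE; set g4 := gauss (4 * c0) l in g1 *.
have g40 : 0 < g4 by exact: gauss_gt0.
set g5 := gauss _ l.
have g5e : g5 <= eps / 2 by exact: small.
have g50 : 0 <= g5 by exact: gauss_ge0.
have h1 : s * d * (2 * c0) * ((l' - l) * g4) <= s * (gauss_mean A W l' - gauss_mean A W l).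
  rewrite -mulrA -mulrA ler_wpM2l ?(ltW s0)//; apply: le_trans g2.
  rewrite ler_wpM2l ?(ltW d0)//; apply: le_trans g1.
  by rewrite le_eqVlt; apply/orP; left; apply/eqP; ring.
have h2 : C2 * (l' - l) * (g5 * g4) <= s * d * (2 * c0) / 2 * ((l' - l) * g4).
  have -> : C2 * (l' - l) * (g5 * g4) = C2 * g5 * ((l' - l) * g4) by ring.
  rewrite ler_wpM2r ?mulr_ge0 ?(ltW D0) ?(ltW g40)//.
  apply: (@le_trans _ _ ((`|C2| + 1) * (eps / 2))).
    by apply: (@le_trans _ _ ((`|C2| + 1) * g5)); [rewrite ler_wpM2r// (le_trans (ler_norm _))// lerDl|rewrite ler_wpM2l// ltW].
  by rewrite /eps le_eqVlt; apply/orP; left; apply/eqP; field; rewrite gt_eqF.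
have h3 : 0 < s * d * (2 * c0) * ((l' - l) * g4) by apply: mulr_gt0 => //; exact: mulr_gt0.
by rewrite -mulrBr; exact: half_gap h3 h1 h2.
Qed.

End one_dimensional.

(** * Tensor products on R^d *)

Section dirac_sum.
Context d (T : measurableType d) (R : realType).
Variables (n : nat) (a : nat -> T).

Definition dirac_sum : set T -> \bar R :=
  msum (fun k => dirac (a k) : {measure set T -> \bar R}) n.

HB.instance Definition _ := Measure.on dirac_sum.

Let dirac_sum_finite : fin_num_fun dirac_sum.
Proof.
move=> A mA; rewrite /dirac_sum /msum; apply/sum_fin_numP => k _ _.
by rewrite /= diracE.
Qed.

HB.instance Definition _ := @Measure_isFinite.Build _ _ _ dirac_sum dirac_sum_finite.

Lemma Rintegral_dirac_sum (f : T -> R) : measurable_fun setT f -> (forall x, 0 <= f x) ->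
  \int[dirac_sum]_x f x = \sum_(k < n) f (a k).
Proof.
move=> mf f0; have mf' : measurable_fun setT (EFin \o f) by exact/measurable_EFinP.
rewrite /Rintegral ge0_integral_measure_sum//=; last by move=> x _; rewrite lee_fin.
rewrite (eq_bigr (fun k : 'I_n => (f (a k))%:E)) => [|k _]; first by rewrite sumEFin.
by rewrite integral_dirac// diracT mul1e.
Qed.

End dirac_sum.

Section tuple_product.
Context {R : realType}.
Notation mu := (@lebesgue_measure R).
Notation leb d := (@lebesgue_tuple R d).

Lemma tnth_consp0 d (v : d.-tuple R) (s : R) : tnth (consp (v, s)) ord0 = s.
Proof. by rewrite tnth0. Qed.

Lemma tnth_consp_lift d (v : d.-tuple R) (s : R) i :
  tnth (consp (v, s)) (lift ord0 i) = tnth v i.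
Proof. by rewrite tnthS. Qed.

Lemma integral_tupleS d (H : d.+1.-tuple R -> R) :
  measurable_fun setT H ->
  ((leb d) \x mu)%E.-integrable setT (EFin \o (H \o @consp R d)) ->
  (leb d.+1).-integrable setT (EFin \o H) /\
  \int[leb d.+1]_x H x = \int[((leb d) \x mu)%E]_z H (consp z).
Proof.
move=> mH Hi.
have mH' : measurable_fun setT (EFin \o H) by exact/measurable_EFinP.
have mc : measurable_fun [set: (d.-tuple R * measurableTypeR R)%type] (@consp R d).
  exact: measurable_consp.
have Hi' : ((leb d) \x mu)%E.-integrable (@consp R d @^-1` setT) ((EFin \o H) \o @consp R d).
  exact: Hi.
have h1 := integrable_pushforward mc mH' Hi' measurableT.
have h2 := integral_pushforward mc mH' Hi' measurableT.
split; first exact: h1.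
rewrite /Rintegral; congr fine.
exact: h2.
Qed.

(** Two products are allowed because the addition formulas split a cosine or sine of [dotp] into
    two. *)
Lemma integral_tupleS_prod d (H : d.+1.-tuple R -> R) (G1 G2 : d.-tuple R -> R)
    (g1 g2 : R -> R) : measurable_fun setT H ->
  (leb d).-integrable setT (EFin \o G1) -> (leb d).-integrable setT (EFin \o G2) ->
  mu.-integrable setT (EFin \o g1) -> mu.-integrable setT (EFin \o g2) ->
  (forall v s, H (consp (v, s)) = G1 v * g1 s + G2 v * g2 s) ->
  (leb d.+1).-integrable setT (EFin \o H) /\
  \int[leb d.+1]_x H x = \int[leb d]_v G1 v * \int[mu]_s g1 s +
    \int[leb d]_v G2 v * \int[mu]_s g2 s.
Proof.
move=> mH G1i G2i g1i g2i HE.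
have i1 := integrable_prod G1i g1i; have i2 := integrable_prod G2i g2i.
have i12 := integrable_EFinD i1 i2.
have [|j1 ->] := integral_tupleS mH.
  by move: i12; apply: eq_integrable => // -[v s] _ /=; rewrite HE.
split => //.
rewrite -Rintegral_prod// -(Rintegral_prod G2i g2i) -RintegralD//.
by apply: eq_Rintegral => -[v s] _; rewrite HE.
Qed.

Implicit Types d : nat.

Definition tprod d (F : 'I_d -> R -> R) (x : d.-tuple R) : R := \prod_(i < d) F i (tnth x i).

Lemma measurable_dotp d (y : d.-tuple R) : measurable_fun setT (fun x => dotp x y).
Proof.
apply: measurable_sum => i; apply: measurable_funM => //; exact: measurable_tnth.
Qed.

Lemma measurable_tprod d (F : 'I_d -> R -> R) : (forall i, measurable_fun setT (F i)) ->
  measurable_fun setT (tprod F).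
Proof.
move=> mF; apply: measurable_prod => i _.
by apply: (measurableT_comp (mF i)); exact: measurable_tnth.
Qed.

Lemma tprod_cons d (F : 'I_d.+1 -> R -> R) v s :
  tprod F (consp (v, s)) = tprod (fun i => F (lift ord0 i)) v * F ord0 s.
Proof.
rewrite /tprod big_ord_recl tnth_consp0 mulrC; congr (_ * _).
by apply: eq_bigr => i _; rewrite tnth_consp_lift.
Qed.

Lemma dotp_cons d v s (xi : d.+1.-tuple R) : exists w : d.-tuple R,
  (forall i, tnth w i = tnth xi (lift ord0 i)) /\
  dotp (consp (v, s)) xi = dotp v w + s * tnth xi ord0.
Proof.
exists [tuple tnth xi (lift ord0 i) | i < d]; split => [i|]; first by rewrite tnth_mktuple.
rewrite /dotp big_ord_recl tnth_consp0 addrC; congr (_ + _).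
by apply: eq_bigr => i _; rewrite tnth_consp_lift tnth_mktuple.
Qed.

Lemma integral_tuple0 (H : 0.-tuple R -> R) : measurable_fun setT H ->
  (leb 0).-integrable setT (EFin \o H) /\ \int[leb 0]_x H x = H [tuple].
Proof.
move=> mH; have mH' : measurable_fun setT (EFin \o H) by exact/measurable_EFinP.
have iE (f : 0.-tuple R -> \bar R) : measurable_fun setT f -> (\int[leb 0]_x f x = f [tuple])%E.
  by move=> mf; rewrite [LHS]integral_dirac// diracT mul1e.
split; last by rewrite /Rintegral iE.
apply/integrableP; split => //.
by rewrite iE ?ltry//; exact: measurableT_comp.
Qed.

Lemma integral_tprod d (F : 'I_d -> R -> R) :
  (forall i, mu.-integrable setT (EFin \o F i)) ->
  (leb d).-integrable setT (EFin \o tprod F) /\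
  \int[leb d]_x tprod F x = \prod_(i < d) \int[mu]_s F i s.
Proof.
elim: d F => [|d IH] F Fi.
  have [] := integral_tuple0 (measurable_tprod (fun i => integrable_EFin_measurable (Fi i))).
  by move=> i1 i2; split => //; rewrite i2 /tprod !big_ord0.
have [i1 e1] := IH _ (fun i => Fi (lift ord0 i)).
have z1 : (leb d).-integrable setT (EFin \o (fun _ : d.-tuple R => 0 : R)) by exact: integrable0.
have z2 : mu.-integrable setT (EFin \o (fun _ : R => 0 : R)) by exact: integrable0.
have [|i ->] := integral_tupleS_prod (measurable_tprod (fun i => integrable_EFin_measurable (Fi i))) i1 z1 (Fi ord0) z2.
  by move=> v s; rewrite tprod_cons mulr0 addr0.
split => //; rewrite e1 big_ord_recl mulrC.
by rewrite [X in _ + _ * X]/Rintegral integral0 mulr0 addr0.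
Qed.

(** The cosine and sine integrals are treated together since the addition formulas mix them in the
    induction on [d]. Evenness kills every term with a sine in some coordinate. *)
Lemma transform_tprod d (F : 'I_d -> R -> R) (xi : d.-tuple R) :
  (forall i, mu.-integrable setT (EFin \o F i)) -> (forall i s, F i (- s) = F i s) ->
  \int[leb d]_x (cos (2 * pi * dotp x xi) * tprod F x) =
    \prod_(i < d) cos_transform (F i) (tnth xi i) /\
  \int[leb d]_x (sin (2 * pi * dotp x xi) * tprod F x) = 0.
Proof.
move=> Fi FN.
have mc : measurable_fun setT (@cos R) by apply: continuous_measurable_fun; exact: continuous_cos.
have ms : measurable_fun setT (@sin R) by apply: continuous_measurable_fun; exact: continuous_sin.
have mtc n (H : 'I_n -> R -> R) (y : n.-tuple R) : (forall i, mu.-integrable setT (EFin \o H i)) ->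
    measurable_fun setT (fun x => cos (2 * pi * dotp x y) * tprod H x).
  move=> Hi; apply: measurable_funM.
    by apply: (measurableT_comp mc); apply: measurable_funM => //; exact: measurable_dotp.
  by apply: measurable_tprod => i; exact: (integrable_EFin_measurable (Hi i)).
have mts n (H : 'I_n -> R -> R) (y : n.-tuple R) : (forall i, mu.-integrable setT (EFin \o H i)) ->
    measurable_fun setT (fun x => sin (2 * pi * dotp x y) * tprod H x).
  move=> Hi; apply: measurable_funM.
    by apply: (measurableT_comp ms); apply: measurable_funM => //; exact: measurable_dotp.
  by apply: measurable_tprod => i; exact: (integrable_EFin_measurable (Hi i)).
elim: d F xi Fi FN => [|d IH] F xi Fi FN.
  have [_ ->] := integral_tuple0 (mtc _ _ xi Fi).
  have [_ ->] := integral_tuple0 (mts _ _ xi Fi).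
  by rewrite /dotp /tprod !big_ord0 mulr0 cos0 sin0 mulr1 mul0r.
have Fi' i := Fi (lift ord0 i).
have [i1 _] := integral_tprod Fi'.
have mdot n (y : n.-tuple R) : measurable_fun setT (fun x => 2 * pi * dotp x y).
  by apply: measurable_funM => //; exact: measurable_dotp.
have [w [wE _]] := dotp_cons [tuple of nseq d 0] 0 xi.
have dE v s : 2 * pi * dotp (consp (v, s)) xi = 2 * pi * dotp v w + 2 * pi * tnth xi ord0 * s.
  have [w' [w'E ->]] := dotp_cons v s xi.
  have -> : w' = w by apply: eq_from_tnth => i; rewrite wE w'E.
  by ring.
have [IHc IHs] := IH _ w Fi' (fun i => FN (lift ord0 i)).
pose G := tprod (fun i => F (lift ord0 i)).
have Gc : (leb d).-integrable setT (EFin \o (fun v => cos (2 * pi * dotp v w) * G v)).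
  have := integrable_EFin_bounded (measurableT_comp mc (mdot d w)) (fun x => cos_max _) i1.
  by apply: eq_integrable => // v _ /=; rewrite mulrC.
have Gs : (leb d).-integrable setT (EFin \o (fun v => sin (2 * pi * dotp v w) * G v)).
  have := integrable_EFin_bounded (measurableT_comp ms (mdot d w)) (fun x => sin_max _) i1.
  by apply: eq_integrable => // v _ /=; rewrite mulrC.
have fc := integrable_cosM (2 * pi * tnth xi ord0) (Fi ord0).
have fs := integrable_sinM (2 * pi * tnth xi ord0) (Fi ord0).
have fs' : mu.-integrable setT (EFin \o (fun s => - 1 * (F ord0 s * sin (2 * pi * tnth xi ord0 * s)))).
  exact: integrable_EFinZl.
have fs0 : \int[mu]_s (F ord0 s * sin (2 * pi * tnth xi ord0 * s)) = 0.
  by apply: Rintegral_odd => // s; rewrite FN mulrN sinN mulrN.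
split.
  have [|_ ->] := integral_tupleS_prod (mtc _ _ xi Fi) Gc Gs fc fs'.
    by move=> v s; rewrite dE tprod_cons cosD -/G; ring.
  rewrite RintegralZl// fs0 mulr0 mulr0 addr0 IHc big_ord_recl mulrC; congr (_ * _).
  by apply: eq_bigr => i _; rewrite wE.
have [|_ ->] := integral_tupleS_prod (mts _ _ xi Fi) Gs Gc fc fs.
  by move=> v s; rewrite dE tprod_cons sinD -/G; ring.
by rewrite IHs mul0r fs0 mulr0 addr0.
Qed.

Lemma fourier_L1_tprod d (F : 'I_d -> R -> R) (xi : d.-tuple R) :
  (forall i, mu.-integrable setT (EFin \o F i)) -> (forall i s, F i (- s) = F i s) ->
  fourier_L1 (tprod F) xi = (\prod_(i < d) cos_transform (F i) (tnth xi i))%:C%C.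
Proof.
move=> Fi FN; have [tc ts] := transform_tprod xi Fi FN.
have [i1 _] := integral_tprod Fi.
rewrite /fourier_L1 /cintegral -tc; congr (Complex _ _).
  by apply: eq_Rintegral => x _; rewrite /expi/= mulr0 subr0 cosN.
rewrite -[RHS]oppr0 -ts -mulN1r -RintegralZl//.
  by apply: eq_Rintegral => x _; rewrite /expi/= mulr0 add0r sinN mulN1r mulNr.
have ms : measurable_fun setT (fun x : d.-tuple R => sin (2 * pi * dotp x xi)).
  have ms0 : measurable_fun setT (@sin R) by apply: continuous_measurable_fun; exact: continuous_sin.
  by apply: (measurableT_comp ms0); apply: measurable_funM => //; exact: measurable_dotp.
have := integrable_EFin_bounded ms (fun x => sin_max _) i1.
by apply: eq_integrable => // v _ /=; rewrite mulrC.
Qed.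

Lemma cLnorm_tprod d (q : R) (G : 'I_d -> R -> R) : 0 < q ->
  (forall i, mu.-integrable setT (EFin \o (fun s => `|G i s| `^ q))) ->
  cLnorm q%:E (fun xi : d.-tuple R => (tprod G xi)%:C%C) =
  ((\prod_(i < d) \int[mu]_s `|G i s| `^ q) `^ q^-1)%:E.
Proof.
move=> q0 Gi; have [i1 i2] := integral_tprod Gi.
rewrite -i2 /cLnorm unlock -poweR_EFin; congr poweR.
rewrite EFin_Rintegral//; apply: eq_integral => x _.
rewrite /= expr0n/= addr0 sqrtr_sqr normr_id; congr EFin.
rewrite /tprod normr_prod.
(* Powers are multiplicative on nonnegative reals only, so nonnegativity is carried along the
   product. *)
pose K (a b : R) := 0 <= a /\ a `^ q = b.
suff: K (\prod_(i < d) `|G i (tnth x i)|) (\prod_(i < d) `|G i (tnth x i)| `^ q) by case.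
apply: (big_ind2 K); first by split => //; rewrite powR1.
  by move=> a b a' b' [a0 <-] [a'0 <-]; split; [exact: mulr_ge0 | rewrite powRM].
by move=> i _; split.
Qed.

End tuple_product.

(** * Dilations and the cosine transform *)

Section dilation.
Context {R : realType}.
Notation mu := (@lebesgue_measure R).
Notation L1 f := (mu.-integrable setT (EFin \o f)).

(** The factor l^r is the share of one coordinate in the r-th power of the normalisation of the heat
    kernel at time l^(-2). *)
Definition dilate (r l : R) (h : R -> R) (s : R) : R := l `^ r * h (l * s).

Variables (r l : R).
Hypothesis l0 : 0 < l.
Implicit Type h : R -> R.

Let l_neq0 : l != 0. Proof. exact: lt0r_neq0. Qed.

Lemma integrable_dilate h : L1 h -> L1 (dilate r l h).
Proof.
move=> hi; apply: integrable_EFinZl.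
have := integrable_affine 0 l_neq0 hi.
by apply: eq_integrable => // x _ /=; rewrite addr0.
Qed.

Lemma cos_transform_dilate h xi : L1 h ->
  cos_transform (dilate r l h) xi = l `^ (r - 1) * cos_transform h (l^-1 * xi).
Proof.
move=> hi; rewrite /cos_transform.
rewrite (Rintegral_affine 0 l_neq0 (integrable_cosM _ hi)) (gtr0_norm l0) mulrA.
have -> : l `^ (r - 1) * l = l `^ r.
  by rewrite -[X in _ * X]powRr1 ?(ltW l0)// -powRD ?l_neq0 ?implybT// subrK.
rewrite -RintegralZl//; last first.
  have := integrable_affine 0 l_neq0 (integrable_cosM (2 * pi * (l^-1 * xi)) hi).
  by apply: eq_integrable => // x _ /=.
apply: (@eq_Rintegral _ _ _ mu setT) => x _; rewrite /dilate addr0 mulrA.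
congr (_ * cos _); move: (pi : R) => P; field; exact: l_neq0.
Qed.

Lemma integral_cos_transform_dilate h q : L1 h -> L1 (fun xi => `|cos_transform h xi| `^ q) ->
  L1 (fun xi => `|cos_transform (dilate r l h) xi| `^ q) /\
  \int[mu]_xi `|cos_transform (dilate r l h) xi| `^ q =
    l `^ ((r - 1) * q + 1) * \int[mu]_xi `|cos_transform h xi| `^ q.
Proof.
move=> hi hq; have li0 : l^-1 != 0 by rewrite invr_neq0.
have E xi : `|cos_transform (dilate r l h) xi| `^ q =
    l `^ ((r - 1) * q) * `|cos_transform h (l^-1 * xi + 0)| `^ q.
  rewrite (addr0 (l^-1 * xi)) (cos_transform_dilate xi hi) normrM.
  rewrite (ger0_norm (powR_ge0 l (r - 1))) (powRM q (powR_ge0 l (r - 1)) (normr_ge0 _)).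
  by rewrite -powRrM.
have i1 := integrable_affine 0 li0 hq.
split.
  have := integrable_EFinZl (l `^ ((r - 1) * q)) i1.
  by apply: eq_integrable => // x _ /=; rewrite E.
transitivity (\int[mu]_x (l `^ ((r - 1) * q) * `|cos_transform h (l^-1 * x + 0)| `^ q)).
  by apply: (@eq_Rintegral _ _ _ mu setT) => x _; exact: E.
rewrite (RintegralZl _ measurableT i1) [X in _ = _ * X](Rintegral_affine 0 li0 hq) mulrA.
congr (_ * _).
rewrite powRD ?l_neq0 ?implybT// powRr1 ?(ltW l0)// -mulrA (gtr0_norm _) ?invr_gt0//.
by rewrite mulfV// mulr1.
Qed.

End dilation.

Section gauss_transform_norm.
Context {R : realType}.
Notation mu := (@lebesgue_measure R).
Notation L1 f := (mu.-integrable setT (EFin \o f)).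

(** Each coordinate other than the first contributes this integral, a positive constant independent
    of time. *)
Lemma gauss_transform_norm (a q : R) : 0 < a -> 0 < q ->
  L1 (fun xi => `|cos_transform (gauss a) xi| `^ q) /\
  0 < \int[mu]_xi `|cos_transform (gauss a) xi| `^ q.
Proof.
move=> a0 q0.
pose b : R := q * (4 * a)^-1 * (2 * pi) ^+ 2; pose c : R := Num.sqrt (pi / a).
have pi0 := @pi_gt0 R.
have b0 : 0 < b.
  apply: mulr_gt0; last by rewrite exprn_gt0// mulr_gt0.
  by apply: mulr_gt0 => //; rewrite invr_gt0 mulr_gt0.
have c0 : 0 < c by rewrite sqrtr_gt0 divr_gt0.
have E xi : `|cos_transform (gauss a) xi| `^ q = c `^ q * gauss b xi.
  rewrite /cos_transform Rintegral_gauss_cos// -/c gtr0_norm; last first.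
    by apply: mulr_gt0 => //; exact: gauss_gt0.
  rewrite powRM ?(ltW c0) ?gauss_ge0// gauss_powR; congr (_ * _).
  by rewrite /gauss /b; congr expR; move: (pi : R) ((4 * a)^-1) => P A; ring.
split.
  have := integrable_EFinZl (c `^ q) (integrable_gauss b0).
  by apply: eq_integrable => // x _ /=; rewrite E.
have -> : \int[mu]_xi `|cos_transform (gauss a) xi| `^ q = \int[mu]_x (c `^ q * gauss b x).
  by apply: (@eq_Rintegral _ _ _ mu setT) => x _; exact: E.
rewrite (RintegralZl _ measurableT (integrable_gauss b0)) (Rintegral_gauss b0).
by apply: mulr_gt0; [exact: powR_gt0|rewrite sqrtr_gt0 divr_gt0].
Qed.

End gauss_transform_norm.

(** * Measures carried by the first axis *)

Section on_first_axis.
Context {R : realType}.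
Variables (d n : nat) (xs : 'I_n.+1 -> R).

Definition axis_point (k : nat) : d.+1.-tuple R :=
  [tuple if i == ord0 then xs (inord k) else 0 | i < d.+1].

Definition axis_measure := dirac_sum R n.+1 axis_point.

Definition axis_factor (r l : R) (i : 'I_d.+1) : R -> R :=
  if i == ord0 then profile xs r l else gauss (r * pi).

(** All masses lie on the first axis, so the Gaussians in the other coordinates are common to them
    and come out of the sum before the power is taken. What remains is a tensor product. *)
Lemma heat_flow_axis (r l : R) (x : d.+1.-tuple R) : 0 < l ->
  heat_flow axis_measure (l ^- 2) x `^ r = tprod (fun i => dilate r l (axis_factor r l i)) x.
Proof.
move=> l0; have l_neq0 : l != 0 by rewrite gt_eqF.
pose c : R := l `^ d.+1%:R.
have lN2 : l ^- 2 = l `^ (- 2) by rewrite powRN powR_mulrn ?(ltW l0).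
have cE : (l ^- 2) `^ (- (d.+1%:R / 2)) = c.
  by rewrite lN2 -powRrM mulrNN mulrCA mulfV ?mulr1// pnatr_eq0.
have kE y : heat_kernel (l ^- 2) y = c * \prod_(i < d.+1) gauss pi (l * tnth y i).
  rewrite /heat_kernel cE /dotp /gauss -expR_sum; congr (_ * expR _).
  rewrite invrK mulr_sumr mulr_suml -sumrN; apply: eq_bigr => i _.
  by move: (pi : R) => P; ring.
have k0 y : 0 <= heat_kernel (l ^- 2) y.
  by rewrite /heat_kernel mulr_ge0 ?powR_ge0 ?expR_ge0.
have km : measurable_fun setT (fun y : d.+1.-tuple R => heat_kernel (l ^- 2) (subt x y)).
  rewrite /heat_kernel; apply: measurable_funM => //.
  apply: measurableT_comp => //; apply: measurableT_comp => //.
  apply: measurable_funM => //; apply: measurable_funM => //.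
  apply: measurable_sum => i.
  have mi : measurable_fun setT (fun y : d.+1.-tuple R => tnth (subt x y) i).
    rewrite (_ : (fun y => _) = fun y : d.+1.-tuple R => tnth x i - tnth y i).
      by apply: measurable_funB => //; exact: measurable_tnth.
    by apply/funext => y; rewrite /subt tnth_mktuple.
  exact: measurable_funM.
rewrite /heat_flow (Rintegral_dirac_sum _ _ km)//.
pose P := \prod_(i < d) gauss pi (l * tnth x (lift ord0 i)).
have -> : \sum_(k < n.+1) heat_kernel (l ^- 2) (subt x (axis_point k)) =
    c * (\sum_(k < n.+1) bump xs l (l * tnth x ord0) k * P).
  rewrite mulr_sumr; apply: eq_bigr => k _; rewrite kE; congr (_ * _).
  rewrite big_ord_recl; congr (_ * _).
    rewrite /subt /axis_point !tnth_mktuple eqxx inord_val /bump.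
    by congr gauss; ring.
  apply: eq_bigr => i _; rewrite /subt /axis_point !tnth_mktuple.
  by rewrite (_ : _ == _ = false)// subr0.
rewrite -mulr_suml.
have P0 : 0 <= P by apply: prodr_ge0 => i _; exact: gauss_ge0.
have B0 : 0 <= \sum_(k < n.+1) bump xs l (l * tnth x ord0) k.
  by apply: sumr_ge0 => k _; exact: gauss_ge0.
rewrite powRM ?powR_ge0 ?mulr_ge0// powRM//.
rewrite /tprod /dilate big_split/= prodr_const card_ord; congr (_ * _).
  by rewrite /c -powRrM mulrC powRrM powR_mulrn// powR_ge0.
rewrite [RHS]big_ord_recl /axis_factor/=; congr (_ * _).
pose K (a b : R) := 0 <= a /\ a `^ r = b.
suff: K P (\prod_(i < d) gauss (r * pi) (l * tnth x (lift ord0 i))) by case.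
apply: (big_ind2 K); first by split => //; rewrite powR1.
  by move=> a b a' b' [a0 <-] [a'0 <-]; split; [exact: mulr_ge0 | rewrite powRM].
by move=> i _; split; [exact: gauss_ge0|exact: gauss_powR].
Qed.

(** The power of time in [Q] is the one that makes it invariant under dilation, so all powers of [l]
    cancel and time survives only in the shape of [profile]. *)
Lemma Q_axis (p : \bar R) (q l : R) :
  let r := fine p^-1%E in
  let N := \int[lebesgue_measure]_xi `|cos_transform (profile xs r l) xi| `^ q in
  let N0 := \int[lebesgue_measure]_xi `|cos_transform (gauss (r * pi)) xi| `^ q in
  fine (hoelder_conjugate p)^-1%E = 1 - r -> 0 < r -> 0 < q -> 0 < l ->
  (forall x, profile xs r l (- x) = profile xs r l x) ->
  lebesgue_measure.-integrable setT (EFin \o profile xs r l) ->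
  lebesgue_measure.-integrable setT
    (EFin \o (fun xi => `|cos_transform (profile xs r l) xi| `^ q)) ->
  Q p q axis_measure (l ^- 2) = ((N * N0 ^+ d) `^ q^-1)%:E.
Proof.
move=> r N N0 p'E r0 q0 l0 even_p ip iq.
have rpi0 : 0 < r * pi by rewrite mulr_gt0// pi_gt0.
have l_neq0 : l != 0 by rewrite gt_eqF.
pose h := axis_factor r l; pose F i := dilate r l (h i).
have h_even i s : h i (- s) = h i s.
  by rewrite /h /axis_factor; case: ifP => _; rewrite ?gaussN.
have hi i : lebesgue_measure.-integrable setT (EFin \o h i).
  by rewrite /h /axis_factor; case: ifP => _; [exact: ip|exact: integrable_gauss].
have hq i : lebesgue_measure.-integrable setT (EFin \o (fun xi => `|cos_transform (h i) xi| `^ q)).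
  by rewrite /h /axis_factor; case: ifP => _; [exact: iq|exact: (gauss_transform_norm rpi0 q0).1].
have Fi i : lebesgue_measure.-integrable setT (EFin \o F i) by exact: integrable_dilate.
have FN i s : F i (- s) = F i s by rewrite /F /dilate mulrN h_even.
rewrite /Q -/r.
have -> : (fun x : d.+1.-tuple R => heat_flow axis_measure (l ^- 2) x `^ r) = tprod F.
  by apply/funext => x; rewrite heat_flow_axis.
(* The function is integrable, so its transform is the defining integral. *)
rewrite /fourier; case: asboolP => [_|[]]; last exact: (integral_tprod Fi).1.
have -> : fourier_L1 (tprod F) =
    fun xi : d.+1.-tuple R => (tprod (fun i => cos_transform (F i)) xi)%:C%C.
  by apply/funext => xi; rewrite fourier_L1_tprod.
rewrite (cLnorm_tprod q0 (fun i => (integral_cos_transform_dilate r l0 (hi i) (hq i)).1)).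
rewrite -EFinM; congr EFin.
rewrite (eq_bigr _ (fun i _ => (integral_cos_transform_dilate r l0 (hi i) (hq i)).2)).
rewrite big_split/= prodr_const card_ord.
have -> : \prod_(i < d.+1) \int[lebesgue_measure]_xi `|cos_transform (h i) xi| `^ q = N * N0 ^+ d.
  by rewrite big_ord_recl /h /axis_factor eqxx/= prodr_const card_ord.
have N_ge0 : 0 <= N by apply: Rintegral_ge0 => x _; exact: powR_ge0.
have N0_ge0 : 0 <= N0 by apply: Rintegral_ge0 => x _; exact: powR_ge0.
have NN_ge0 : 0 <= N * N0 ^+ d by apply: mulr_ge0 => //; exact: exprn_ge0.
rewrite (powRM q^-1 (exprn_ge0 _ (powR_ge0 _ _)) NN_ge0) mulrA.
rewrite -[RHS]mul1r; congr (_ * _).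
have lN2 : l ^- 2 = l `^ (- 2) by rewrite powRN powR_mulrn ?(ltW l0).
rewrite lN2 -powR_mulrn ?powR_ge0// -!powRrM -powRD ?l_neq0 ?implybT//.
rewrite p'E [X in _ `^ X](_ : _ = 0) ?powRr0//.
by field; rewrite gt_eqF.
Qed.

End on_first_axis.

(** For finite p > 1 the hypothesis reads q (p - 1) <= p, which with q > 2 forces p <= 2. For p = 1
    the conjugate is infinite with inverse 0; infinite p has conjugate 1 < q and is impossible. *)
Lemma exponent_bounds (R : realType) (p : \bar R) (q : R) : (1 <= p)%E -> 2 < q ->
  (q%:E <= hoelder_conjugate p)%E ->
  [/\ 2^-1 <= fine p^-1%E, fine p^-1%E <= 1 &
    fine (hoelder_conjugate p)^-1%E = 1 - fine p^-1%E].
Proof.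
move=> p1 q2; case: p p1 => [x| |] //; last first.
  by move=> _; rewrite hoelder_conjugatey lee_fin => ?; exfalso; lra.
rewrite lee_fin => x1; have x0 : x != 0 by rewrite gt_eqF//; lra.
rewrite /hoelder_conjugate/= eqe (negbTE x0) fine_invr -EFinB inver subr_eq0.
case: eqVneq => [->|xN1].
  rewrite mul1e invey/= invr1 subrr => _; split => //; lra.
have d0 : 0 < x - 1 by rewrite subr_gt0 lt_neqAle eq_sym xN1.
rewrite -EFinM lee_fin fine_invr => qle.
have : q * (x - 1) <= x by rewrite -ler_pdivlMr.
move=> h; have x2 : x <= 2 by nra.
have x00 : 0 < x by lra.
split; [by rewrite lef_pV2// posrE|by rewrite invf_le1|].
by rewrite invf_div; field.
Qed.

Theorem theorem1 (R : realType) (d : nat) (d_gt0 : (0 < d)%N)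
    (p : \bar R) (p_ge1 : (1 <= p)%E)
    (q : R) (q_ge2 : 2 <= q) (q_le_p' : (q%:E <= hoelder_conjugate p)%E)
    (q_not_even : ~ exists m : int, q = (2 * m)%:~R) :
  exists mu : {finite_measure set (d.-tuple R) -> \bar R},
  exists2 delta : R, 0 < delta &
    forall s t : R, 0 < s -> s < t -> t < delta -> (Q p q mu t < Q p q mu s)%E.
Proof.
have q2 : 2 < q.
  rewrite lt_neqAle q_ge2 andbT; apply/eqP => q2; apply: q_not_even.
  by exists 1; rewrite mulr1 -q2.
have q0 : 0 < q by exact: lt_trans q2.
have q_odd : ~ exists j : nat, q = 2 * j%:R.
  by move=> [j qE]; apply: q_not_even; exists j%:Z; rewrite qE intrM.
have [r_ge r_le p'E] := exponent_bounds p_ge1 q2 q_le_p'.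
set r := fine p^-1%E in r_ge r_le p'E.
have r0 : 0 < r by apply: lt_le_trans r_ge; rewrite invr_gt0.
have [K [m [K1 m5 Wneg]]] := exists_negative_coef q2 q_odd.
have [Lq [l0 l01 incr]] := transform_norm_increasing K1 m5 r_ge r_le q2 Wneg.
have l00 : 0 < l0 by exact: lt_le_trans l01.
case: d d_gt0 => // d _.
(* With l = t^(-1/2), the condition t < l0^(-2) means l > l0, and a decrease in t is an increase in
   l. *)
exists (@axis_measure R d 3 (nodes K m)); exists (l0 ^- 2); first by rewrite invr_gt0 exprn_gt0.
pose N0 := \int[lebesgue_measure]_xi `|cos_transform (gauss (r * pi)) xi| `^ q.
have N00 : 0 < N0 by apply: (gauss_transform_norm _ q0).2; rewrite mulr_gt0// pi_gt0.
have QE t : 0 < t -> Q p q (@axis_measure R d 3 (nodes K m)) t =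
    ((transform_norm K m r q (Num.sqrt t)^-1 * N0 ^+ d) `^ q^-1)%:E.
  move=> t0; have l0' : 0 < (Num.sqrt t)^-1 by rewrite invr_gt0 sqrtr_gt0.
  rewrite -[t in LHS]sqr_sqrtr ?(ltW t0)// -[Num.sqrt t ^+ 2]invrK -exprVn.
  exact: (Q_axis d p'E r0 q0 l0' (heat_profile_even K m r _)
    (integrable_heat_profile K1 m5 r_ge r_le (ltW l0')) (Lq _ (ltW l0'))).
move=> s t s0 st tl0; have t0 := lt_trans s0 st.
rewrite (QE _ s0) (QE _ t0) lte_fin.
have N_ge0 l : 0 <= transform_norm K m r q l * N0 ^+ d.
  apply: mulr_ge0; last by rewrite exprn_ge0// ltW.
  by apply: Rintegral_ge0 => x _; exact: powR_ge0.
apply: gt0_ltr_powR; rewrite ?invr_gt0 ?nnegrE ?N_ge0//.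
rewrite (ltr_pM2r (exprn_gt0 d N00)); apply: incr.
  rewrite -[l0]invrK lef_pV2 ?posrE ?sqrtr_gt0 ?invr_gt0//.
  have := ler_wsqrtr (ltW tl0).
  by rewrite -exprVn sqrtr_sqr gtr0_norm ?invr_gt0.
by rewrite ltf_pV2 ?posrE ?sqrtr_gt0// ltr_sqrt.
Qed.
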